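(* Let $\mathcal{S}=(\mathbb{E},\mathbb{E}_\vee,\mathbb{E}_<,\Gamma)$ be a Euclidean cut and project scheme with (possibly multi-coloured) polytopal window $W$. Assume that there is a linear automorphism $M\colon\mathbb{E}\to\mathbb{E}$ with $M(\Gamma)=\Gamma$, $M(\mathbb{E}_\vee)=\mathbb{E}_\vee$ and $M(\mathbb{E}_<)=\mathbb{E}_<$, and put $L:=M|_{\mathbb{E}_\vee}$, $A:=M|_{\mathbb{E}_<}$, where $L$ is expansive. Then the following are equivalent: (1) there is some $m\in\mathbb{N}$, $m\ge1$, so that all elements of $\Omega(\mathcal{S},W)$ are $L^m$-sub; (2) $W$ is FD-invariant with respect to $A^p$ for some $p\in\mathbb{N}$, $p\geq1$, and $W$ is rational.
   Context: **Patterns.** A Delone multiset in a finite-dimensional real normed space $E$ is a tuple $\Lambda=(\Lambda_1,\dots,\Lambda_\ell)$ of subsets of $E$ whose union is uniformly discrete and relatively dense. Translates and linear images $L\Lambda$ are taken componentwise. A patch of $\Lambda$ is a tuple $(\Lambda_i\cap U)_i$ with $U$ bounded. With $B(x,r)$ the closed ball, $\Lambda[x,r]:=((\Lambda_i\cap B(x,r))-x)_i$. $\mathcal{Q}$ is locally derivable (LD) from $\mathcal{P}$ if there is $c\ge0$ such that for all $x,y\in E$, $\mathcal{P}[x,c]=\mathcal{P}[y,c]$ implies $\mathcal{Q}[x,0]=\mathcal{Q}[y,0]$. $\mathcal{P}$ is locally indistinguishable (LI) from $\mathcal{Q}$ if every patch of $\mathcal{P}$ occurs, up to translation, in $\mathcal{Q}$.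 The hull $\Omega_{\mathcal{P}}$ is the set of all patterns LI from $\mathcal{P}$. For a linear automorphism $L$ of $E$, $\mathcal{P}$ is $L$-sub if there is $\mathcal{P}'$, LI from $\mathcal{P}$, such that $\mathcal{P}$ is LD from $L\mathcal{P}'$. A linear map is expansive if all its eigenvalues have modulus $>1$. **Cut and project.** A Euclidean cut and project scheme $\mathcal{S}=(\mathbb{E},\mathbb{E}_\vee,\mathbb{E}_<,\Gamma)$ consists of a $k$-dimensional real vector space $\mathbb{E}$, complementary subspaces $\mathbb{E}_\vee$ of dimension $d>0$ and $\mathbb{E}_<$ of dimension $k-d>0$, and a full rank lattice $\Gamma\subset\mathbb{E}$. Write $x_\vee,x_<$ for the projections of $x$ to $\mathbb{E}_\vee,\mathbb{E}_<$ along $\mathbb{E}=\mathbb{E}_\vee\oplus\mathbb{E}_<$. It is required that $\gamma\mapsto\gamma_\vee$, $\gamma\mapsto\gamma_<$ are injective on $\Gamma$ and $\Gamma_<$ is dense in $\mathbb{E}_<$. A window is a finite tuple $W=(W_i)_{i=1}^\ell$ of compact, topologically regular (equal to the closure of their interior) subsets of $\mathbb{E}_<$, not all empty. It is non-singular if $\Gamma_<\cap\partial W_i=\emptyset$ for all $i$; then $\Lambda(\mathcal{S},W)=(\Lambda_i)_i$, $\Lambda_i=\{\gamma_\vee:\gamma\in\Gamma,\gamma_<\in W_i\}$. For arbitrary $W$, $\Omega(\mathcal{S},W):=\Omega_{\Lambda(\mathcal{S},W+s)}$ for any $s\in\mathbb{E}_<$ with $W+s$ non-singular (independent of $s$). **Polytopal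 windows.** An affine hyperplane $H\subset\mathbb{E}_<$ (translate of a codimension 1 subspace) is supporting for a compact topologically regular $X\subset\mathbb{E}_<$ if there are $w\in H\cap X$, an open neighbourhood $U$ of $w$ and a closed half-space $H^+$ bounded by $H$ with $X\cap U=H^+\cap U$. $X$ is polytopal if $\partial X$ is contained in a finite union of supporting hyperplanes (equivalently, $X$ is a finite union of convex polytopes with non-empty interior). $W$ is polytopal if each $W_i$ is; $\mathscr{H}$ denotes the (finite) set of all supporting hyperplanes of the $W_i$ and $\mathscr{H}_0=\{H-H: H\in\mathscr{H}\}$ the set of supporting subspaces. $W$ is FD-invariant with respect to a linear map $B$ of $\mathbb{E}_<$ if $B(V)=V$ for each $V\in\mathscr{H}_0$. $\mathrm{Ver}(W)$ is the union of the vertex sets (0-cells of the polytope cell structure) of the $W_i$; a vertex of a polytope $X$ is a point $v\in\partial X$ at which the tangent cone of $X$ is not invariant under translation along any line. $W$ is rational if there is $N\in\mathbb{N}$, $N\geq 1$, with $v-v'\in\frac1N\Gamma_<$ for all $v,v'\in\mathrm{Ver}(W)$. *)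

(* Defs.v *)
From HB Require Import structures.
From mathcomp Require Import all_boot all_order all_algebra.
From mathcomp.real_closed Require Export complex.
From mathcomp Require Export all_classical all_reals all_analysis.
Export Order.TTheory GRing.Theory Num.Theory.
Export numFieldNormedType.Exports.

Set Implicit Arguments.
Unset Strict Implicit.
Unset Printing Implicit Defensive.

Local Open Scope classical_set_scope.
Local Open Scope ring_scope.

#[short(type="normedVectType")]
HB.structure Definition NormedVector (R : realType) :=
  {V of NormedModule R V & Vector R V}.

(* A linear subspace, seen as a space in its own right, carries the norm
   inherited from the ambient space, hence the subspace topology. *)
Section SubspaceNorm.
Context (R : realType) (V : normedVectType R) (U : {vspace V}).

Let sub_norm (x : subvs_of U) : R := `|vsval x|.

Let sub_normD x y : sub_norm (x + y) <= sub_norm x + sub_norm y.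
Proof. by rewrite /sub_norm linearD ler_normD. Qed.

Let sub_normZ (l : R) x : sub_norm (l *: x) = `|l| * sub_norm x.
Proof. by rewrite /sub_norm linearZ normrZ. Qed.

Let sub_norm0 x : sub_norm x = 0 -> x = 0.
Proof. by move=> /normr0_eq0 x0; apply/val_inj; rewrite [LHS]x0 [RHS]linear0. Qed.

HB.instance Definition _ :=
  Lmodule_isNormed.Build R (subvs_of U) sub_normD sub_normZ sub_norm0.

End SubspaceNorm.

Section Patterns.
Context (R : realType) (E : normedVectType R) (l : nat).
Implicit Types (P Q : 'I_l -> set E) (D : set E).

Definition uniformly_discrete D := exists2 r : R, 0 < r &
  forall x y, D x -> D y -> x != y -> r <= `|x - y|.

Definition relatively_dense D := exists2 r : R, 0 < r &
  forall x, exists2 y, D y & `|x - y| <= r.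

Definition Delone_multiset P :=
  uniformly_discrete (\bigcup_i P i) /\ relatively_dense (\bigcup_i P i).

(* [closed_ball_ Num.norm x r] is {y | |x - y| <= r}; the library's
   [closed_ball x r] is empty for r = 0, which occurs in [LD]. *)
Definition cluster_at P (x : E) (r : R) : 'I_l -> set E :=
  fun i => [set y - x | y in P i `&` closed_ball_ Num.norm x r].

(* Q is locally derivable from P. *)
Definition LD P Q := exists2 c : R, 0 <= c &
  forall x y, cluster_at P x c = cluster_at P y c ->
    cluster_at Q x 0 = cluster_at Q y 0.

(* P is locally indistinguishable from Q: the patch of P over a bounded set B,
   translated by t, is the patch of Q over B + t. *)
Definition LI P Q := forall B : set E, bounded_set B ->
  exists t : E, forall i,
    [set x + t | x in P i `&` B] = Q i `&` [set x + t | x in B].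

Definition hull P : set ('I_l -> set E) :=
  [set Q | Delone_multiset Q /\ LI Q P].

Definition sub_wrt (L : E -> E) P := exists P',
  [/\ Delone_multiset P', LI P' P & LD (fun i => L @` P' i) P].

End Patterns.

Section Linear.
Context (R : realType) (V : vectType R).

(* The eigenvalues of a real endomorphism are the complex eigenvalues of its
   matrix in a basis. *)
Definition expansive (f : 'End(V)) := forall z : R[i],
  eigenvalue (map_mx (real_complex R)
    (passmx.mxof (vbasis {:V}) (vbasis {:V}) f)) z -> 1 < `|z|.

(* Only meaningful when f maps U into itself: [vsproj U] is then the identity
   on the vectors it is applied to. *)
Definition restrict_end (f : 'End(V)) (U : {vspace V}) : 'End(subvs_of U) :=
  linfun (fun u : subvs_of U => vsproj U (f (vsval u))).

Definition full_rank_lattice (G : set V) :=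
  exists2 b : (\dim {:V}).-tuple V, basis_of {:V} b &
    G = [set x | exists z : 'I_(\dim {:V}) -> int,
                   x = \sum_(i < \dim {:V}) b`_i *~ z i].

Definition proj_along (U U' : {vspace V}) (x : V) : subvs_of U :=
  Subvs (memv_pi U U' x).

End Linear.

Record cpscheme (R : realType) (E : normedVectType R) := CPScheme {
  Evee : {vspace E};
  Eint : {vspace E};
  lat : set E;
  vee (x : E) : subvs_of Evee := proj_along Evee Eint x;
  star (x : E) : subvs_of Eint := proj_along Eint Evee x;
  dim_Evee : (0 < \dim Evee)%N;
  dim_Eint : (0 < \dim Eint)%N;
  cps_sum : (Evee + Eint = fullv)%VS;
  cps_cap : (Evee :&: Eint = 0)%VS;
  lat_lattice : full_rank_lattice lat;
  vee_inj : {in lat &, injective vee};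
  star_inj : {in lat &, injective star};
  star_dense : dense (star @` lat)
}.

Section Polytopal.
Context (R : realType) (F : normedVectType R).
Implicit Types X H : set F.

Definition boundary X := closure X `\` X°.

Definition affine_hyperplane H := exists (V : {vspace F}) (p : F),
  (\dim V).+1 = \dim {:F} /\ H = [set p + v | v in [set` V]].

Definition closed_half_space (H Hp : set F) := exists (phi : 'Hom(F, R^o)) (c : R),
  [/\ phi != 0, H = [set x : F | phi x = c] & Hp = [set x : F | c <= phi x]].

Definition supporting X H := affine_hyperplane H /\
  exists (w : F) (U Hp : set F),
    [/\ (H `&` X) w, open U /\ U w, closed_half_space H Hp &
        X `&` U = Hp `&` U].

Definition polytopal X := exists A : set (set F),
  [/\ finite_set A, A `<=` supporting X & boundary X `<=` \bigcup_(H in A) H].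

(* Near v a finite union of convex polytopes coincides with v + C for a unique
   cone C; this is C, in terms of germs of rays. *)
Definition tangent_cone X (v : F) : set F := [set u |
  exists2 e : R, 0 < e & forall t : R, 0 <= t <= e -> X (v + t *: u)].

Definition polytope_vertex X (v : F) := boundary X v /\
  forall w, w != 0 ->
    ~ (forall t : R, [set u + t *: w | u in tangent_cone X v]
                     = tangent_cone X v).

Context (l : nat).
Implicit Type W : 'I_l -> set F.

Definition is_window W :=
  (forall i, compact (W i) /\ regclosed (W i)) /\ exists i, W i !=set0.

Definition translate_window W (s : F) : 'I_l -> set F :=
  fun i => [set w + s | w in W i].

Definition supporting_hyperplanes W : set (set F) :=
  [set H | exists i, supporting (W i) H].

Definition supporting_subspaces W : set (set F) :=
  [set [set x - y | x in H & y in H] | H in supporting_hyperplanes W].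

Definition FD_invariant W (B : F -> F) :=
  forall V, supporting_subspaces W V -> B @` V = V.

Definition Ver W : set F := \bigcup_i polytope_vertex (W i).

End Polytopal.

Section CutAndProject.
Context (R : realType) (E : normedVectType R) (S : cpscheme E) (l : nat).
Implicit Type W : 'I_l -> set (subvs_of (Eint S)).

Definition nonsingular W :=
  forall i, (star S @` lat S) `&` boundary (W i) = set0.

Definition cpset W : 'I_l -> set (subvs_of (Evee S)) :=
  fun i => [set vee S g | g in [set g | lat S g /\ W i (star S g)]].

(* All non-singular s give the same hull, so this union is the hull of
   [cpset (W + s)] for any one of them. *)
Definition Omega W : set ('I_l -> set (subvs_of (Evee S))) :=
  [set P | exists2 s, nonsingular (translate_window W s) &
                      hull (cpset (translate_window W s)) P].

Definition rational_window W := exists2 N : nat, (1 <= N)%N &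
  forall v v', Ver W v -> Ver W v' ->
    exists2 g, lat S g & v - v' = N%:R^-1 *: star S g.

End CutAndProject.

(* Main.v *)
(** Write [G_<] for the projected lattice and [B] for a power of [A^-1]; since
    [L] is expansive, a large power of [L^-1] is contracting.

    (2) => (1). Rationality, together with the finiteness of [G / d G], yields an
    affine map [tau x = B x + t0] that carries every supporting hyperplane of the
    window to a [G_<]-translate of itself. An element of the hull with internal
    parameter [u] is locally derivable from the image under a power of [L] of the
    one with parameter [tau u]: whether [g_< + u] lies in [W_i] can be decoded,
    by compactness, from finitely many of the statuses of the points
    [tau (h_< + u)], with [h - g] bounded.

    (1) => (2). If a model set is locally derivable from its substituted image,
    then at every facet point the derivation rule must see the boundary of the
    window, so for some [beta] the map [x |-> B x + beta] carries the supporting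
    hyperplanes to supporting hyperplanes modulo [G_<]; a further power fixes
    every one of them modulo [G_<], whence FD-invariance. At a vertex, suitable
    supporting hyperplanes define coordinates diagonalising [B]. Covering more
    and more points of a segment by boundedly many lattice translates shows, by
    the pigeonhole principle, that the coordinate axes contain elements of
    [G_<] and that all eigenvalues have modulus > 1. Then [(B - 1) (v - v')] is a
    torsion element of the internal space modulo [G_<] for all vertices [v] and
    [v'], and [B - 1] is invertible on the rational span of [G_<]. *)

(* A power of [A^-1] rather than of [A] appears because a point of [L P'] over the lattice vector
   [g] is the image of a point of [P'] over [M^-1 g]. Both directions rest on one tension. A power
   [N] of [M^-1] contracts the physical directions and does not enlarge internal coordinates whose
   eigenvalue under [B] has modulus at most 1. Lattice points with small such coordinates are
   therefore driven towards a span of lattice vectors, where discreteness traps them, while density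
   of [G_<] supplies points that are not trapped. This excludes such eigenvalues
   ([noncontracting_empty]) once suitable lattice vectors are known: they come from differences of
   vertices in one direction, from the pigeonhole argument in the other. The pigeonhole works
   because physical parts of the translates add up along a geometric series and internal parts are
   confined by the compact windows. Elements of the hull with a singular parameter need not be model
   sets; describing them by ultrafilters lets every finite question about them be settled at a
   genuine nonsingular parameter. *)
From HB Require Import structures.
Require Import Defs.
From mathcomp Require Import all_boot all_order all_algebra.
From mathcomp Require Import classical_sets topology_structure.
From mathcomp Require Import zify lra ring.
Set Implicit Arguments.
Unset Strict Implicit.
Unset Printing Implicit Defensive.
Local Open Scope classical_set_scope.
Local Open Scope ring_scope.

(** * Module identities *)

Section ModuleExpressions.
Context (R : pzRingType) (V : lmodType R).

Inductive mexp :=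
  MVar of nat | MZero | MAdd of mexp & mexp | MOpp of mexp | MScale of R & mexp.

Fixpoint meval (env : seq V) (e : mexp) : V :=
  match e with
  | MVar n => nth 0 env n
  | MZero => 0
  | MAdd a b => meval env a + meval env b
  | MOpp a => - meval env a
  | MScale k a => k *: meval env a
  end.

(** [eqn] rather than [==] keeps the coefficients computable by [cbn] in the tactic [module]. *)
Fixpoint mcoef (e : mexp) (n : nat) : R :=
  match e with
  | MVar m => if eqn m n then 1 else 0
  | MZero => 0
  | MAdd a b => mcoef a n + mcoef b n
  | MOpp a => - mcoef a n
  | MScale k a => k * mcoef a n
  end.

Lemma meval_coef env e : meval env e = \sum_(i < size env) mcoef e i *: nth 0 env i.
Proof.
have eqnb m n : eqn m n = (m == n) by [].
elim: e => [m||a IHa b IHb|a IH|k a IH] /=.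
- have [lm|lm] := ltnP m (size env).
    rewrite (bigD1 (Ordinal lm))//= eqnb eqxx scale1r big1 ?addr0// => i.
    by rewrite -val_eqE /= eqnb eq_sym => /negPf->; rewrite scale0r.
  rewrite nth_default// big1// => i _; rewrite eqnb gtn_eqF ?scale0r//.
  exact: leq_trans (ltn_ord i) lm.
- by rewrite big1// => i _; rewrite scale0r.
- by rewrite IHa IHb -big_split; apply: eq_bigr => i _; rewrite scalerDl.
- by rewrite IH -sumrN; apply: eq_bigr => i _; rewrite scaleNr.
- by rewrite IH scaler_sumr; apply: eq_bigr => i _; rewrite scalerA.
Qed.

(** For a concrete list of atoms the [foldr] unfolds to one ring identity per atom, the form that
    [module] passes to [ring]. *)
Lemma meval_eq env e1 e2 :
  foldr (fun i P => mcoef e1 i = mcoef e2 i /\ P) True (iota 0 (size env)) ->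
  meval env e1 = meval env e2.
Proof.
move=> h; rewrite !meval_coef; apply: eq_bigr => i _; congr (_ *: _).
have : val i \in iota 0 (size env) by rewrite mem_iota /=.
elim: (iota _ _) h => [//|j s IH] /= [h hs]; rewrite inE => /orP[/eqP->//|].
exact: IH.
Qed.

End ModuleExpressions.

Ltac module_index x l :=
  lazymatch l with
  | ?y :: ?l' =>
    match constr:(tt) with
    | _ => let _ := match constr:(tt) with _ => first [constr_eq x y | unify x y] end in constr:(O)
    | _ => let n := module_index x l' in constr:(S n)
    end
  end.
Ltac module_atoms l t :=
  lazymatch t with
  | (?a + ?b)%R => let l := module_atoms l a in module_atoms l b
  | (- ?a)%R => module_atoms l a
  | (?k *: ?a)%R => module_atoms l a
  | 0%R => l
  | _ => match constr:(tt) with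
         | _ => let _ := module_index t l in l
         | _ => constr:(t :: l)
         end
  end.
Ltac module_quote l t :=
  lazymatch t with
  | (?a + ?b)%R => let a := module_quote l a in let b := module_quote l b in
    uconstr:(MAdd a b)
  | (- ?a)%R => let a := module_quote l a in uconstr:(MOpp a)
  | (?k *: ?a)%R => let a := module_quote l a in uconstr:(MScale k a)
  | 0%R => uconstr:(MZero _)
  | _ => let n := module_index t l in uconstr:(MVar _ n)
  end.
(* Proves an equality in a module by comparing, with [ring], the coefficients
   of the non-module subterms. *)
Ltac module :=
  lazymatch goal with
  | |- @eq ?T ?x ?y =>
    let l := module_atoms (@nil T) x in
    let l := module_atoms l y in
    let e1 := module_quote l x in
    let e2 := module_quote l y in
    refine (@meval_eq _ _ l e1 e2 _); cbn [mcoef foldr iota size eqn];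
    repeat (split; [ring|]); exact I
  end.

(** * Metric and linear preliminaries *)

Lemma common_radius (R : realType) (T : eqType) (t : seq T) (Q : T -> R -> Prop) :
  (forall x e e', e' <= e -> Q x e -> Q x e') ->
  (forall x, x \in t -> exists2 e, 0 < e & Q x e) ->
  exists2 e, 0 < e & forall x, x \in t -> Q x e.
Proof.
move=> Qm; elim: t => [|x t IH] h; first by exists 1.
have [e e0 eP] := IH (fun y yt => h y (mem_behead (s := x :: t) yt)).
have [e' e'0 e'P] := h x (mem_head _ _).
exists (Num.min e e') => [|y]; first by rewrite lt_min e0.
rewrite inE => /orP[/eqP->|/eP]; first by apply: Qm e'P; rewrite ge_min lexx orbT.
by apply: Qm; rewrite ge_min lexx.
Qed.

Lemma common_bound (R : realType) (T : eqType) (t : seq T) (Q : T -> R -> Prop) :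
  (forall x c c', c <= c' -> Q x c -> Q x c') ->
  (forall x, x \in t -> exists c, Q x c) ->
  exists c, forall x, x \in t -> Q x c.
Proof.
move=> Qm; elim: t => [|x t IH] h; first by exists 1.
have [c cP] := IH (fun y yt => h y (mem_behead (s := x :: t) yt)).
have [c' c'P] := h x (mem_head _ _).
exists (Num.max c c') => y.
rewrite inE => /orP[/eqP->|/cP]; first by apply: Qm c'P; rewrite le_max lexx orbT.
by apply: Qm; rewrite le_max lexx.
Qed.

Lemma iter_cancel (T : Type) (f g : T -> T) n : (forall x, f (g x) = x) ->
  forall x, iter n f (iter n g x) = x.
Proof. by move=> fg; elim: n => // n IH x; rewrite iterSr iterS fg IH. Qed.

Lemma iter_intertwine (T T' : Type) (r : T -> T') (f : T -> T) (g : T' -> T') n :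
  (forall x, r (f x) = g (r x)) -> forall x, r (iter n f x) = iter n g (r x).
Proof. by move=> rf; elim: n => // n IH x; rewrite !iterS rf IH. Qed.

Section LinearIterates.
Context (R : fieldType) (V : vectType R).

Fixpoint lfpow (f : 'End(V)) n : 'End(V) :=
  if n is n'.+1 then (f \o lfpow f n')%VF else \1%VF.

Lemma lfpowE f n x : lfpow f n x = iter n f x.
Proof. by elim: n => [|n IH]; rewrite /= ?id_lfunE// comp_lfunE IH. Qed.

Lemma iter_lfpow (f : 'End(V)) n k x : iter k (lfpow f n) x = iter (k * n) f x.
Proof. by elim: k => // k IH; rewrite iterS IH lfpowE mulSn iterD. Qed.

Lemma iter_lfunD (f : 'End(V)) k x y : iter k f (x + y) = iter k f x + iter k f y.
Proof. by rewrite -!lfpowE linearD. Qed.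

Lemma iter_lfunB (f : 'End(V)) k x y : iter k f (x - y) = iter k f x - iter k f y.
Proof. by rewrite -!lfpowE linearB. Qed.

Lemma iter_lfunZ (f : 'End(V)) k a x : iter k f (a *: x) = a *: iter k f x.
Proof. by rewrite -!lfpowE linearZ. Qed.

Lemma iter_lfun_sum (f : 'End(V)) k (I : finType) (a : I -> R) (x : I -> V) :
  iter k f (\sum_i a i *: x i) = \sum_i a i *: iter k f (x i).
Proof.
by rewrite -lfpowE linear_sum; apply: eq_bigr => i _; rewrite linearZ /= lfpowE.
Qed.

End LinearIterates.

Section Metric.
Context (R : realType) (F : normedModType R).
Implicit Types (X : set F) (x : F).

Lemma nbhs_distP X x :
  nbhs x X <-> exists2 e : R, 0 < e & forall y, `|x - y| < e -> X y.
Proof.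
split=> [/nbhs_normP[e e0 eX]|[e e0 eX]]; first by exists e.
by apply/nbhs_normP; exists e.
Qed.

Lemma interior_distP X x :
  X° x <-> exists2 e : R, 0 < e & forall y, `|x - y| < e -> X y.
Proof. exact: nbhs_distP. Qed.

Lemma closure_distP X x :
  closure X x <-> forall e : R, 0 < e -> exists2 y, X y & `|x - y| < e.
Proof.
split=> [cX e e0|cX B /nbhs_distP[e e0 eB]].
  have /cX[y [Xy ye]] : nbhs x [set y | `|x - y| < e] by apply/nbhs_distP; exists e.
  by exists y.
by have [y Xy /eB] := cX _ e0; exists y.
Qed.

Lemma closed_dist X x : closed X ->
  (forall e : R, 0 < e -> exists2 y, X y & `|x - y| < e) -> X x.
Proof. by move=> cX xX; apply: cX; apply/closure_distP. Qed.

Lemma open_distP X :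
  open X <-> forall x, X x -> exists2 e : R, 0 < e & forall y, `|x - y| < e -> X y.
Proof.
by rewrite openE; split=> h x /h /interior_distP.
Qed.

Lemma not_closed_dist X x : closed X -> ~ X x ->
  exists2 e : R, 0 < e & forall y, `|x - y| < e -> ~ X y.
Proof. by rewrite -openC => /open_distP; exact. Qed.

Lemma closed_ballP (x : F) (r : R) : closed [set y | `|x - y| <= r].
Proof.
move=> y /closure_distP cy /=; rewrite leNgt; apply/negP => ry.
have [z /= xz yz] := cy (`|x - y| - r) ltac:(by rewrite subr_gt0).
have := ler_distD z x y; rewrite (distrC z); lra.
Qed.

Lemma compact_dist_bounded X : compact X ->
  exists2 C : R, 0 < C & forall x, X x -> `|x| <= C.
Proof.
move=> /compact_bounded [C [Cr CX]].
by exists (Num.max 1 (C + 1)) => [|x]; [rewrite lt_max ltr01 | apply: CX; rewrite lt_max ltrDl ltr01 orbT].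
Qed.

(** The near-covering form of compactness along the filter at [+oo]: monotonicity in the scale
    merges the local scales into one. It turns the pointwise existence of a lattice vector into
    existence with a uniform bound. *)
Lemma compact_cover_scale X (P : R -> F -> Prop) : compact X ->
  (forall c c' x, c <= c' -> P c x -> P c' x) ->
  (forall x, X x -> exists2 e : R, 0 < e &
     exists c, forall y, `|x - y| < e -> P c y) ->
  exists c, forall x, X x -> P c x.
Proof.
move=> /compact_near_coveringP cX Pm hP.
have [//|M [_ hM]] := cX R +oo P _ _.
  move=> x /hP[e e0 [c ec]]; exists ([set y | `|x - y| < e], [set c' | c < c']).
    by split=> /=; [apply/nbhs_distP; exists e | apply: nbhs_pinfty_gt; rewrite num_real].
  by move=> [y c'] /= [ye cc']; apply: Pm (ltW cc') (ec _ ye).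
by exists (M + 1); apply: hM; rewrite ltrDl.
Qed.

End Metric.

Section FiniteDim.
Import VectorInternalTheory.
Context (R : realType).

Lemma linear_bound_dist (V W : normedModType R) (f : {linear V -> W}) (C : R) :
  (forall x, `|f x| <= C * `|x|) -> continuous f.
Proof.
move=> fC; apply/bounded_linear_continuous/bounded_funP => r.
exists (`|C| * r) => x xr; apply: le_trans (fC x) _.
by apply: le_trans (ler_norm _) _; rewrite normrM normr_id ler_wpM2l.
Qed.

Let rV_bound n (W : normedModType R) (f : {linear 'rV[R]_n -> W}) :
  exists2 C : R, 0 < C & forall x, `|f x| <= C * `|x|.
Proof.
exists (1 + \sum_(i < n) `|f (delta_mx 0 i)|) => [|x].
  by apply: ltr_pwDl => //; apply: sumr_ge0.
rewrite {1}(row_sum_delta x) linear_sum; apply: le_trans (ler_norm_sum _ _ _) _.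
rewrite mulrDl mul1r -[leLHS]add0r lerD// mulr_suml; apply: ler_sum => i _.
rewrite linearZ normrZ mulrC ler_wpM2l// [leRHS]/Num.norm /= mx_normrE.
by apply/bigmax_geP; right; exists (ord0, i).
Qed.

(** The norm of [V] is arbitrary, so this is the substantial half of the equivalence of norms:
    [|r2v u|] attains a positive minimum on the unit sphere of the coordinate norm. *)
Lemma v2r_bound (V : normedVectType R) :
  exists2 C : R, 0 < C & forall x : V, `|v2r x| <= C * `|x|.
Proof.
set n := dim V; have [C C0 CP] := rV_bound (@r2v R V).
(* In dimension 0 the unit sphere is empty and there is no minimum to take. *)
have [n0|n0] := eqVneq n 0%N.
  exists 1 => // x; rewrite (_ : v2r x = 0) ?normr0 ?mul1r//.
  by apply/rowP => -[i ip]; exfalso; rewrite -/n n0 in ip.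
pose S := [set u : 'rV[R]_n | `|u| = 1].
have cS : compact S.
  apply: bounded_closed_compact.
    exists 1; split; first exact: num_real.
    by move=> M M1 u /= ->; exact: ltW.
  have -> : S = (fun u : 'rV[R]_n => `|u|) @^-1` [set 1] by [].
  by apply: preimage_closed => [u _|]; [exact: norm_continuous|exact: closed_eq].
have S0 : S !=set0.
  exists (const_mx 1); rewrite /S /= [LHS]/Num.norm /= mx_normrE.
  apply/eqP; rewrite eq_le; apply/andP; split.
    by apply/bigmax_leP; split=> // i _; rewrite mxE normr1.
  apply/bigmax_geP; right; exists (ord0, Ordinal (n:=n) (m:=0) ltac:(by rewrite lt0n)) => //.
  by rewrite mxE normr1.
have cf : continuous (fun u : 'rV[R]_(dim V) => `|r2v u : V|).
  move=> u; apply: continuous_comp; last exact: norm_continuous.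
  exact: (linear_bound_dist CP).
have [|u0 /set_mem Su0 u0P] := compact_EVT_min S0 cS (f := fun u : 'rV[R]_(dim V) => `|r2v u : V|).
  exact/continuous_subspaceT.
set m := `|r2v u0 : V| in u0P.
have m0 : 0 < m.
  rewrite normr_gt0; apply/eqP => u00; have := Su0; rewrite /S /= -(r2vK u0) u00 linear0 normr0.
  by move/esym/eqP; rewrite oner_eq0.
exists m^-1 => [|x]; first by rewrite invr_gt0.
have [->|x0] := eqVneq x 0; first by rewrite linear0 !normr0 mulr0.
have vx0 : 0 < `|v2r x| by rewrite normr_gt0; apply: contra_neq x0 => /(congr1 r2v); rewrite v2rK linear0.
have xS : `|v2r x|^-1 *: v2r x \in S.
  by apply/mem_set; rewrite /S /= normrZ normfV normr_id mulVf// gt_eqF.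
have := u0P _ xS; rewrite linearZ /= v2rK normrZ normfV normr_id mulrC.
by rewrite ler_pdivlMr// ler_pdivlMl.
Qed.

Lemma lin_bound (V : normedVectType R) (W : normedModType R) (f : {linear V -> W}) :
  exists2 C : R, 0 < C & forall x, `|f x| <= C * `|x|.
Proof.
have [C C0 CP] := v2r_bound V; have [D D0 DP] := rV_bound (f \o r2v).
exists (D * C) => [|x]; first exact: mulr_gt0.
rewrite -{1}(v2rK x) -mulrA; apply: le_trans (DP _) _.
by rewrite ler_pM2l.
Qed.

Lemma lin_continuous (V : normedVectType R) (W : normedModType R)
  (f : {linear V -> W}) : continuous f.
Proof. by have [C _] := lin_bound f; exact: linear_bound_dist. Qed.

Lemma bounded_closed_compactV (V : normedVectType R) (X : set V) (C : R) :
  (forall x, X x -> `|x| <= C) -> closed X -> compact X.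
Proof.
move=> XC cX; have [D D0 DP] := v2r_bound V.
have [D' D'0 D'P] := rV_bound (@r2v R V).
have -> : X = r2v @` (r2v @^-1` X).
  by rewrite eqEsubset; split=> [x Xx|x [u ux <-]//]; exists (v2r x); rewrite /= v2rK.
apply: continuous_compact; first exact/continuous_subspaceT/(linear_bound_dist D'P).
apply: bounded_closed_compact; last first.
  by apply: preimage_closed => // u _; exact: (linear_bound_dist D'P).
exists (D * C); split; first exact: num_real.
move=> M MC u /= /XC uC; apply: le_trans (ltW MC).
by rewrite -{1}(r2vK u); apply: le_trans (DP _) _; rewrite ler_pM2l.
Qed.

End FiniteDim.

Section Span.
Context (R : realType) (V : vectType R).

Lemma span_set (D : set V) : exists s : seq V,
  [/\ free s, forall x, x \in s -> D x & forall x, D x -> x \in << s >>%VS].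
Proof.
suff H k : forall s : seq V, free s -> (forall x, x \in s -> D x) ->
    (\dim {:V} <= k + size s)%N -> exists s : seq V,
  [/\ free s, forall x, x \in s -> D x & forall x, D x -> x \in << s >>%VS].
  by apply: (H (\dim {:V}) [::]); rewrite ?nil_free ?addn0.
elim: k => [|k IH] s fs sD ks.
  exists s; split=> // x _; suff -> : << s >>%VS = fullv by rewrite memvf.
  by apply/eqP; rewrite -(dimv_leqif_eq (subvf _)) (eqP fs) eqn_leq ks -(eqP fs) dimvS// subvf.
have [[x [Dx xs]]|h] := pselect (exists x, D x /\ x \notin << s >>%VS); last first.
  by exists s; split=> // x Dx; apply/negPn/negP => xs; apply: h; exists x.
apply: (IH (x :: s)); rewrite ?free_cons ?xs//=; last by rewrite addnS.
by move=> y; rewrite inE => /orP[/eqP->|/sD].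
Qed.

Lemma span_coef (s : seq V) x : x \in << s >>%VS ->
  exists r : 'I_(size s) -> R, x = \sum_i r i *: s`_i.
Proof.
move=> xs; exists (fun i => coord (in_tuple s) i x).
exact: (@coord_span _ _ _ (in_tuple s) x xs).
Qed.

Lemma span_stable (f : 'End(V)) (s : seq V) : (forall x, x \in s -> f x \in << s >>%VS) ->
  forall x, x \in << s >>%VS -> f x \in << s >>%VS.
Proof.
move=> h x xs; suff /subvP : (f @: << s >> <= << s >>)%VS by apply; exact: memv_img.
by rewrite limg_span; apply/span_subvP => _ /mapP[y /h ys ->].
Qed.

(** The map [\1 - projv U] vanishes exactly on [U], so one of its coordinates detects [x]. *)
Lemma separating_functional (U : {vspace V}) x : x \notin U ->
  exists psi : 'Hom(V, R^o), psi x != 0 /\ forall y, y \in U -> psi y = 0.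
Proof.
move=> xU; set f := (\1 - projv U)%VF.
have fx : f x != 0.
  apply: contraNneq xU; rewrite /f add_lfunE opp_lfunE id_lfunE => /subr0_eq ->.
  exact: memv_proj.
have fU y : y \in U -> f y = 0.
  by move=> yU; rewrite /f add_lfunE opp_lfunE id_lfunE projv_id// subrr.
have [i fxi] : exists i, coord (vbasis {:V}) i (f x) != 0.
  apply/existsP; apply: contraNT fx; rewrite negb_exists => /forallP h.
  rewrite (coord_vbasis (memvf (f x))); apply/eqP; apply: big1 => i _.
  by have := h i; rewrite negbK => /eqP->; rewrite scale0r.
exists (linfun (coord (vbasis {:V}) i : V -> R^o) \o f)%VF.
split=> [|y yU]; first by rewrite comp_lfunE lfunE.
by rewrite comp_lfunE fU// linear0.
Qed.

End Span.

(** * Lattices *)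

Section Lattice.
Context (R : realType) (E : normedVectType R).

(** Later arguments see the lattice only through these properties: a group, discrete and
    cocompact. *)
Record lattice_set (G : set E) : Prop := LatticeSet {
  lattice0 : G 0;
  latticeB : forall x y, G x -> G y -> G (x - y);
  lattice_finite : forall C : R, exists s : seq E, forall g, G g -> `|g| <= C -> g \in s;
  lattice_cover : exists C : R, forall x, exists2 g, G g & `|x - g| <= C }.

Lemma full_rank_lattice_set (G : set E) : full_rank_lattice G -> lattice_set G.
Proof.
case=> b bb ->; have sb : <<b>>%VS = fullv := span_basis bb.
split.
- by exists (fun=> 0); rewrite big1.
- move=> _ _ [z ->] [z' ->]; exists (fun i => z i - z' i).
  by rewrite -sumrB; apply: eq_bigr => i _; rewrite mulrzBr.
- move=> C; set n := \dim {:E}.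
  have [K KP] : exists K : nat, forall i x, `|x| <= C -> `|coord b i x| <= K%:R.
    have H (i : 'I_n) := lin_bound (coord b i : {linear E -> R^o}).
    have {}H i : exists Ci : R, 0 < Ci /\ forall x, `|coord b i x| <= Ci * `|x|.
      by have [Ci Ci0 CiP] := H i; exists Ci.
    have [D DP] := choice H.
    exists (Num.truncn (\sum_i D i * `|C|)).+1 => i x xC.
    apply: le_trans (ltW (truncnS_gt _)).
    rewrite (bigD1 i)//= -[leLHS]addr0 lerD//; last first.
      by apply: sumr_ge0 => j _; rewrite mulr_ge0// ltW//; have [] := DP j.
    have [Di0 /(_ x) h] := DP i; apply: le_trans h _; rewrite ler_pM2l//.
    by apply: le_trans xC (ler_norm _).
  exists [seq \sum_(i < n) b`_i *~ ((f i)%:Z - K%:Z) | f : {ffun 'I_n -> 'I_(2 * K).+1}].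
  move=> _ [z ->] zC.
  have zK i : `|z i| <= K%:Z.
    have := KP i _ zC; have -> : coord b i (\sum_(j < n) b`_j *~ z j) = (z i)%:~R.
      under eq_bigr => j _ do rewrite -scaler_int.
      by rewrite coord_sum_free// (basis_free bb).
    by rewrite -intr_norm -(ler_int R).
  apply/mapP; exists [ffun i => inord (absz (z i + K%:Z)%R)]; first by rewrite mem_enum.
  apply: eq_bigr => i _; rewrite ffunE inordK; last by have := zK i; lia.
  by congr (_ *~ _); have := zK i; lia.
- exists (\sum_(i < \dim {:E}) `|b`_i|) => x.
  exists (\sum_(i < \dim {:E}) b`_i *~ Num.floor (coord b i x)).
    by exists (fun i => Num.floor (coord b i x)).
  rewrite {1}(coord_span (X := b) (v := x)) ?sb ?memvf// -sumrB.
  apply: le_trans (ler_norm_sum _ _ _) _; apply: ler_sum => i _.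
  rewrite -scaler_int -scalerBl normrZ ger0_norm ?subr_ge0 ?ge_floor// ler_piMl//.
  by have := floorD1_gt (coord b i x); rewrite intrD1; lra.
Qed.

Context (G : set E) (hG : lattice_set G).

Lemma latticeN x : G x -> G (- x).
Proof. by move=> Gx; rewrite -sub0r; apply: latticeB => //; exact: lattice0. Qed.

Lemma latticeD x y : G x -> G y -> G (x + y).
Proof. by move=> Gx Gy; rewrite -[y]opprK; apply: latticeB => //; exact: latticeN. Qed.

Lemma latticeMz x (n : int) : G x -> G (x *~ n).
Proof.
move=> Gx; have H (k : nat) : G (x *+ k).
  elim: k => [|k IH]; first exact: lattice0.
  by rewrite mulrS; exact: latticeD.
by case: n => k; [exact: H | rewrite NegzE mulrNz; apply/latticeN/H].
Qed.

Lemma lattice_sum (I : Type) (r : seq I) (P : pred I) (f : I -> E) :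
  (forall i, P i -> G (f i)) -> G (\sum_(i <- r | P i) f i).
Proof. by move=> h; apply: big_ind => //; [exact: lattice0|exact: latticeD]. Qed.

Lemma lattice_countable : countable G.
Proof.
have H (n : nat) := lattice_finite hG n%:R.
have [s sP] := choice H.
have : countable (\bigcup_n [set` s n]).
  by apply: bigcup_countable => // n _; exact: finite_set_countable.
apply: sub_countable; apply: subset_card_le => g Gg.
exists (Num.truncn `|g|).+1 => //=; apply: sP => //; exact/ltW/truncnS_gt.
Qed.

(** Choosing [h] close to [g / N] moves [g - N h] into one fixed ball, which contains finitely many
    lattice points. *)
Lemma lattice_mod_finite (N : nat) : (0 < N)%N -> exists s : seq E,
  (forall g, g \in s -> G g) /\
  forall g, G g -> exists2 g', g' \in s & exists2 h, G h & g - g' = N%:R *: h.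
Proof.
move=> N0; have [C CP] := lattice_cover hG; have [s sP] := lattice_finite hG (N%:R * C).
exists [seq g <- s | `[< G g >]]; split=> [g|g Gg].
  by rewrite mem_filter => /andP[/asboolP].
have [h Gh hC] := CP (N%:R^-1 *: g).
have N0' : (N%:R : R) != 0 by rewrite pnatr_eq0 -lt0n.
exists (g - N%:R *: h); last by exists h; rewrite // opprB addrC subrK.
have GN : G (g - N%:R *: h).
  by apply: latticeB => //; rewrite scaler_nat; exact: (@latticeMz h N).
rewrite mem_filter sP ?andbT//; first by apply/asboolP.
have -> : g - N%:R *: h = N%:R *: (N%:R^-1 *: g - h).
  by rewrite scalerBr scalerA divff// scale1r.
by rewrite normrZ ger0_norm// ler_wpM2l.
Qed.

(* Reducing the real coefficients of [y] modulo 1 moves [g - y] by lattice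
   vectors into one fixed ball, where only finitely many values are possible. *)
Lemma lattice_discrete_mod (s : seq E) : (forall x, x \in s -> G x) ->
  exists2 e : R, 0 < e &
    forall g y, G g -> y \in << s >>%VS -> `|g - y| < e -> g \in << s >>%VS.
Proof.
move=> sG; set U := << s >>%VS; set f := (\1 - projv U)%VF.
have fU y : y \in U -> f y = 0.
  by move=> yU; rewrite /f add_lfunE opp_lfunE id_lfunE projv_id// subrr.
have f0 y : f y = 0 -> y \in U.
  by rewrite /f add_lfunE opp_lfunE id_lfunE => /subr0_eq ->; exact: memv_proj.
have [D D0 DP] := lin_bound f.
set K := \sum_(i < size s) `|s`_i|.
have [t tP] := lattice_finite hG (K + 1).
set eps := \big[Num.min/1]_(x <- t | f x != 0) `|f x|.
have eps0 : 0 < eps.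
  rewrite /eps; elim/big_ind: _ => [//|x y x0 y0|x]; first by rewrite lt_min x0.
  by rewrite normr_gt0.
exists (Num.min 1 (eps / D)); first by rewrite lt_min ltr01 divr_gt0.
move=> g y Gg /span_coef [r yE]; rewrite lt_min => /andP[gy1 gyD].
set h := \sum_(i < size s) s`_i *~ Num.floor (r i).
have Gh : G h by apply: lattice_sum => i _; apply/latticeMz/sG/mem_nth.
have hU : h \in U.
  by apply: memv_suml => i _; rewrite -scaler_int memvZ// memv_span// mem_nth.
have yhK : `|y - h| <= K.
  rewrite yE /h -sumrB; apply: le_trans (ler_norm_sum _ _ _) _; apply: ler_sum => i _.
  rewrite -scaler_int -scalerBl normrZ ger0_norm ?subr_ge0 ?ge_floor// ler_piMl//.
  by have := floorD1_gt (r i); rewrite intrD1; lra.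
have gt : g - h \in t.
  apply: tP; first exact: latticeB.
  rewrite (_ : g - h = (g - y) + (y - h)); last by rewrite addrA subrK.
  by apply: le_trans (ler_normD _ _) _; rewrite addrC lerD// ltW.
have yU : y \in U.
  by rewrite yE; apply: memv_suml => i _; rewrite memvZ// memv_span// mem_nth.
apply: f0; have fgy : f g = f (g - h) by rewrite [in RHS]linearB /= (fU h hU) subr0.
rewrite fgy; apply/eqP; apply: contraTT gyD => fgh.
rewrite -leNgt ler_pdivrMr// (le_trans (y := `|f (g - h)|))//.
  exact: (@ge_bigmin_seq _ _ _ t 1 (g - h) (fun x => f x != 0) (fun x => `|f x|) gt fgh).
by have := DP (g - y); rewrite linearB /= (fU y yU) subr0 -fgy mulrC.
Qed.

(** Dirichlet's pigeonhole: removing the integer parts of the coefficients of [n g] leaves lattice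
    points in one bounded ball, so two multiples [i < j] leave the same remainder and [(j - i) g] is
    an integer combination. *)
Lemma lattice_span_torsion (s : seq E) g : (forall x, x \in s -> G x) ->
  G g -> g \in << s >>%VS ->
  exists2 n : nat, (0 < n)%N & exists z : 'I_(size s) -> int, g *+ n = \sum_(i < size s) s`_i *~ z i.
Proof.
move=> sG Gg /span_coef [r gE].
set K := \sum_(i < size s) `|s`_i|.
have [t tP] := lattice_finite hG K.
pose h (n : nat) := \sum_(i < size s) s`_i *~ Num.floor (n%:R * r i).
have ht n : g *+ n - h n \in t.
  apply: tP.
    apply: (latticeB hG); first exact: (@latticeMz g n).
    by apply: lattice_sum => i _; apply/latticeMz/sG/mem_nth.
  rewrite gE -scaler_nat scaler_sumr /h -sumrB.
  apply: le_trans (ler_norm_sum _ _ _) _; apply: ler_sum => i _.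
  rewrite -scaler_int scalerA -scalerBl normrZ ger0_norm ?subr_ge0 ?ge_floor// ler_piMl//.
  by have := floorD1_gt (n%:R * r i); rewrite intrD1; lra.
pose f (n : 'I_(size t).+1) : 'I_(size t) := Ordinal (etrans (index_mem _ _) (ht n)).
have /injectivePn [i [j ij fij]] : ~~ injectiveb f.
  by apply/negP => /injectiveP /leq_card; rewrite !card_ord ltnn.
wlog lij : i j ij fij / (i < j)%N => [H|].
  have [/H|ji|/ord_inj] := ltngtP i j; [exact| |by move/eqP: ij].
  by apply: (H j i); rewrite // eq_sym.
have eij : g *+ i - h i = g *+ j - h j.
  by move/(congr1 val): fij => /= /(congr1 (nth 0 t)); rewrite !nth_index.
exists (j - i)%N; first by rewrite subn_gt0.
exists (fun k => Num.floor (j%:R * r k) - Num.floor (i%:R * r k)).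
rewrite mulrnBr ?(ltnW lij)//.
transitivity (h j - h i).
  have -> : g *+ j = g *+ i - h i + h j by rewrite eij subrK.
  by rewrite addrAC (addrAC (g *+ i)) subrr add0r addrC.
by rewrite /h -sumrB; apply: eq_bigr => k _; rewrite mulrzBr.
Qed.

End Lattice.

(** * Expansive maps *)

Section Expansive.
Context (R : realType).
Import ComplexField.Normc.

Lemma geometric_small (rho a e : R) : 0 <= rho < 1 -> 0 < e ->
  exists N, forall n, (N <= n)%N -> rho ^+ n * a < e.
Proof.
move=> /andP[rho0 rho1] e0.
have rhoN : `|rho| < 1 by rewrite ger0_norm.
have e'0 : 0 < e / (1 + `|a|) by rewrite divr_gt0// ltr_pwDl.
have [N _ NP] := iffLR (cvgrPdist_lt _ _) (cvg_expr rhoN) _ e'0.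
exists N => n /NP; rewrite sub0r normrN ger0_norm ?exprn_ge0// ltr_pdivlMr; last first.
  by rewrite ltr_pwDl.
apply: le_lt_trans; rewrite ler_wpM2l ?exprn_ge0//.
by rewrite (le_trans (ler_norm a))// lerDr.
Qed.

Lemma contracting_recurrence (rho : R) (x y : nat -> R) : 0 <= rho < 1 ->
  (forall n, x n.+1 <= rho * (x n + y n.+1)) ->
  (forall e, 0 < e -> exists N, forall n, (N <= n)%N -> y n < e) ->
  forall e, 0 < e -> exists N, forall n, (N <= n)%N -> x n < e.
Proof.
move=> rho01 xy y0 e e0; have /andP[rho0 rho1] := rho01.
(* Once [y] is below this bound, the level [e / 2] is not exceeded by the recurrence:
   [rho (e / 2 + e / 2 (1 - rho))] equals [e / 2 (1 - (1 - rho)^2)]. *)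
have [N NP] := y0 (e / 2 * (1 - rho)) ltac:(rewrite mulr_gt0 ?subr_gt0 ?divr_gt0//).
have H k : x (N + k)%N <= rho ^+ k * x N + e / 2.
  elim: k => [|k IH]; first by rewrite addn0 expr0 mul1r; lra.
  rewrite addnS; apply: le_trans (xy _) _.
  have yk := NP (N + k).+1 ltac:(lia).
  apply: le_trans (_ : rho * (rho ^+ k * x N + e / 2 + e / 2 * (1 - rho)) <= _).
    by rewrite ler_wpM2l// lerD// ltW.
  rewrite exprS -(mulrA rho); set t := rho ^+ k * x N.
  have : 0 <= e / 2 * (1 - rho) ^+ 2 by rewrite mulr_ge0 ?sqr_ge0//; lra.
  by move=> h; rewrite -subr_ge0; apply: le_trans h _; rewrite le_eqVlt; apply/orP; left; apply/eqP; ring.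
have [K KP] := geometric_small (x N) rho01 (e := e / 2) ltac:(lra).
exists (N + K)%N => n nNK.
have -> : n = (N + (n - N))%N by lia.
apply: le_lt_trans (H _) _; have := KP (n - N)%N ltac:(lia); lra.
Qed.

Let cnorm d (u : 'rV[R[i]]_d) : R := \sum_j normc (u 0 j).

Let normc_ge0 (z : R[i]) : 0 <= normc z.
Proof. by case: z => a b; rewrite sqrtr_ge0. Qed.

Let cnormD d (u v : 'rV[R[i]]_d) : cnorm (u + v) <= cnorm u + cnorm v.
Proof.
rewrite /cnorm -big_split; apply: ler_sum => j _ /=; rewrite mxE; exact: le_normcD.
Qed.

Let cnormZ d z (u : 'rV[R[i]]_d) : cnorm (z *: u) = normc z * cnorm u.
Proof. by rewrite /cnorm mulr_sumr; apply: eq_bigr => j _; rewrite mxE normcM. Qed.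

(* With [b n = a n *m (B - z)], the backward orbit [a] satisfies
   [a n.+1 = z^-1 *: (a n - b n.+1)], and [b] is killed by one factor fewer. *)
Lemma backward_orbit_cvg0 d (B : 'M[R[i]]_d.+1) (zs : seq R[i]) (a : nat -> 'rV[R[i]]_d.+1) :
  (forall z, z \in zs -> 1 < `|z|) ->
  (forall n, a n = a n.+1 *m B) ->
  (forall n, a n *m horner_mx B (\prod_(z <- zs) ('X - z%:P)) = 0) ->
  forall e, 0 < e -> exists N, forall n, (N <= n)%N -> cnorm (a n) < e.
Proof.
elim: zs a => [|z zs IH] a zs1 aB a0 e e0.
  exists 0%N => n _; have := a0 n; rewrite big_nil rmorph1 mulmx1 => ->.
  by rewrite /cnorm big1// => j _; rewrite mxE normc0.
pose b n := a n *m (B - z%:M).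
have Bz : horner_mx B ('X - z%:P) = B - z%:M by rewrite rmorphB /= horner_mx_X horner_mx_C.
have zgt1 : 1 < normc z.
  have := zs1 z (mem_head _ _); rewrite normc_def -[1]/((1 : R)%:C)%C ltcR.
  by case: (z).
have z0 : z != 0 by apply: contraTneq zgt1 => ->; rewrite normc0 ltr10.
have {}IH := IH b.
apply: (@contracting_recurrence (normc z)^-1 (fun n => cnorm (a n)) (fun n => cnorm (b n)) _ _ _ e e0) => [|n|].
- by rewrite invr_ge0 normc_ge0 invf_lt1// (lt_trans ltr01).
- rewrite /= -normcV.
  have -> : a n.+1 = z^-1 *: (a n - b n.+1).
    rewrite /b mulmxBr -aB mul_mx_scalar opprB addrC subrK scalerA mulVf// scale1r //.
  rewrite cnormZ ler_wpM2l ?normc_ge0//.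
  apply: le_trans (cnormD _ _) _; rewrite lerD2l -scaleN1r cnormZ.
  by rewrite normcN normc1 mul1r.
apply: IH => [y yzs|n|n]; first by apply: zs1; rewrite inE yzs orbT.
- by rewrite /b {1}aB -!mulmxA; congr (_ *m _); rewrite mulmxBl mulmxBr scalar_mxC.
- have := a0 n; rewrite big_cons rmorphM /= Bz -[RHS]/(0 : 'rV_d.+1) => <-.
  by rewrite /b -mulmxA.
Qed.

(** In complexified coordinates the characteristic polynomial kills the orbit by Cayley-Hamilton,
    and its roots are eigenvalues, of modulus greater than 1; [backward_orbit_cvg0] then peels off
    one linear factor at a time. *)
Lemma expansive_backward (V : normedVectType R) (f : 'End(V)) (a : nat -> V) :
  expansive f -> (forall n, a n = f (a n.+1)) ->
  forall e, 0 < e -> exists N, forall n, (N <= n)%N -> `|a n| < e.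
Proof.
move=> fexp af e e0.
set bs := vbasis {:V}; have bb : basis_of {:V} bs := vbasisP _.
have [d dE] : exists d, d = \dim {:V} by eexists.
case: d dE => [|d] dE.
  exists 0%N => n _; have -> : a n = 0; last by rewrite normr0.
  by apply/eqP; rewrite -memv0; suff /eqP <- : {:V}%VS == 0%VS; rewrite ?memvf// -dimv_eq0 -dE.
pose A := passmx.mxof bs bs f.
rewrite /expansive -/bs -/A in fexp.
pose c n : 'rV[R]_(\dim {:V}) := passmx.rVof bs (a n).
have cA n : c n = c n.+1 *m A by rewrite /c {1}af (passmx.rVof_app bs bb).
have H : forall e', 0 < e' -> exists N, forall n, (N <= n)%N ->
    forall j, `|c n 0 j| < e'.
  move: (\dim {:V}) A c cA fexp dE => k A c cA fexp kE; subst k => e' e'0.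
  pose B := map_mx (real_complex R) A.
  have [zs zsE] := closed_field_poly_normal (char_poly B).
  have [] := @backward_orbit_cvg0 _ B zs (fun n => map_mx (real_complex R) (c n)) _ _ _ e' e'0.
  - move=> z zz; apply: fexp; rewrite eigenvalue_root_char zsE rootZ ?lead_coef_eq0//.
      by rewrite root_prod_XsubC.
    by rewrite monic_neq0// char_poly_monic.
  - by move=> n; rewrite -map_mxM -cA.
  - move=> n; have := Cayley_Hamilton B; rewrite zsE.
    by rewrite (monicP (char_poly_monic B)) scale1r => ->; rewrite mulmx0.
  move=> N NP; exists N => n /NP nP j; apply: le_lt_trans nP.
  rewrite /cnorm (bigD1 j)//= mxE /normc /= expr0n addr0 sqrtr_sqr lerDl.
  by apply: sumr_ge0 => i _; exact: normc_ge0.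
set K := 1 + \sum_(j < \dim {:V}) `|bs`_j|.
have K0 : 0 < K by rewrite ltr_pwDl// sumr_ge0.
have [N NP] := H (e / K) (divr_gt0 e0 K0).
exists N => n /NP nP.
rewrite (coord_vbasis (memvf (a n))); apply: le_lt_trans (ler_norm_sum _ _ _) _.
apply: le_lt_trans (_ : e / K * \sum_(j < \dim {:V}) `|bs`_j| < e).
  rewrite mulr_sumr; apply: ler_sum => j _; rewrite normrZ ler_wpM2r//.
  by apply: le_trans (ltW (nP j)); rewrite /c mxE.
by rewrite mulrAC ltr_pdivrMr// ltr_pM2l// /K ltrDr.
Qed.

(** The backward orbits of the finitely many basis vectors tend to 0, and the coordinates of [f^n x]
    are bounded by its norm; this makes the exponent uniform in [x]. *)
Lemma expansive_iter (V : normedVectType R) (f : 'End(V)) :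
  expansive f -> lker f == 0%VS ->
  exists N, forall n, (N <= n)%N -> forall x, `|x| <= 2^-1 * `|iter n f x|.
Proof.
move=> fexp f0; set g := (f^-1)%VF.
have fK : cancel g f by exact: lker0_lfunVK.
have gK : cancel f g by exact: lker0_lfunK.
set bs := vbasis {:V}.
have [D D0 DP] : exists2 D : R, 0 < D & forall (i : 'I_(\dim {:V})) x, `|coord bs i x| <= D * `|x|.
  have H (i : 'I_(\dim {:V})) : exists D, forall x, `|coord bs i x| <= D * `|x|.
    by have [C _ CP] := lin_bound (coord bs i : {linear V -> R^o}); exists C.
  have Qm (i : 'I_(\dim {:V})) (c c' : R) : c <= c' ->
      (forall x, `|coord bs i x| <= c * `|x|) -> forall x, `|coord bs i x| <= c' * `|x|.
    by move=> cc h x; apply: le_trans (h x) _; rewrite ler_wpM2r.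
  have [D DP] := common_bound (t := index_enum _) Qm (fun i _ => H i).
  exists (`|D| + 1) => [|i x]; first by rewrite ltr_wpDl.
  apply: le_trans (DP i _ x) _; first by rewrite mem_index_enum.
  by rewrite ler_wpM2r// (le_trans (ler_norm D))// lerDl.
(* Being larger than the dimension, [d] makes all coordinate terms of size [D |y| / (2 D d)] sum to
   at most [|y| / 2], and it is nonzero even in dimension 0. *)
set d := (\dim {:V}).+1%:R : R.
have d0 : 0 < d by rewrite ltr0n.
have H (i : 'I_(\dim {:V})) : exists N, forall n, (N <= n)%N -> `|iter n g bs`_i| < (2 * D * d)^-1.
  apply: (expansive_backward (a := fun n => iter n g bs`_i) fexp) => [n|]; first by rewrite /= fK.
  by rewrite invr_gt0 !mulr_gt0.
have [N NP] := choice H.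
exists (\max_i N i) => n nN x.
set y := iter n f x; rewrite -(iter_cancel n gK x) -/y.
rewrite {1}(coord_vbasis (memvf y)) iter_lfun_sum.
apply: le_trans (ler_norm_sum _ _ _) _.
apply: le_trans (_ : \sum_(i < \dim {:V}) (D * `|y|) * (2 * D * d)^-1 <= _).
  apply: ler_sum => i _; rewrite normrZ ler_pM//.
  apply/ltW/NP; apply: leq_trans nN; exact: leq_bigmax.
rewrite sumr_const card_ord -[_ *+ \dim {:V}]mulr_natr.
rewrite [leLHS](_ : _ = 2^-1 * `|y| * ((\dim {:V})%:R / d)); last by field; rewrite !gt_eqF.
rewrite ler_piMr ?mulr_ge0 ?invr_ge0// ler_pdivrMr// mul1r ler_nat; lia.
Qed.

End Expansive.

(** * Supporting hyperplanes and vertices *)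

Section Hyperplanes.
Context (R : realType) (F : normedVectType R).
Implicit Types (X : set F) (phi psi : 'Hom(F, R^o)).

(** Functional form of [supporting], which also records the orientation and the contact point;
    [supportingP] converts between the two. *)
Definition supp_at X phi (c : R) w := [/\ phi != 0, phi w = c &
  exists2 e : R, 0 < e & forall x, `|w - x| < e -> X x <-> c <= phi x].

Lemma functional_bound phi : exists2 C : R, 0 < C & forall x, `|phi x : R| <= C * `|x|.
Proof. by have [C C0 CP] := @lin_bound R F R^o phi; exists C. Qed.

Lemma functional_neq0 phi : phi != 0 -> exists z, phi z = 1.
Proof.
move=> phi0; have [z zP] : exists z, phi z != 0.
  apply: contrapT => h; case/eqP: phi0; apply/lfunP => z; rewrite zero_lfunE.
  by apply/eqP; apply: contrapT => /negP hz; apply: h; exists z.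
by exists ((phi z)^-1 *: z); rewrite linearZ /= /GRing.scale /= mulVf.
Qed.

Lemma functionalD phi x y : phi (x + y) = phi x + phi y :> R.
Proof. exact: linearD. Qed.
Lemma functionalB phi x y : phi (x - y) = phi x - phi y :> R.
Proof. exact: linearB. Qed.
Lemma functionalZ phi (a : R) x : phi (a *: x) = a * phi x :> R.
Proof. exact: linearZ. Qed.

Lemma hyperplane_affine phi c : phi != 0 -> affine_hyperplane [set x | phi x = c].
Proof.
move=> phi0; have [z z1] := functional_neq0 phi0.
exists (lker phi), (c *: z); split.
  have := limg_ker_dim phi fullv; rewrite capfv => <-.
  suff -> : limg phi = fullv by rewrite dimvf /= addn1.
  apply/vspaceP => a; rewrite memvf; apply/memv_imgP; exists ((a : R) *: z) => //.
    exact: memvf.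
  by rewrite functionalZ z1 mulr1.
apply/seteqP; split=> x /= => [phix|[v /= vk <-]].
  exists (x - c *: z) => /=; last by rewrite addrC subrK.
  by rewrite memv_ker functionalB functionalZ z1 mulr1 phix subrr.
by move: vk; rewrite memv_ker => /eqP v0; rewrite functionalD functionalZ z1 v0 mulr1 addr0.
Qed.

Lemma supportingP X H : supporting X H <->
  exists phi c w, H = [set x | phi x = c] /\ supp_at X phi c w.
Proof.
split=> [[_ [w [U [Hp [[Hw Xw] [oU Uw] [phi [c [phi0 HE HpE]]] XU]]]]]|].
  exists phi, c, w; split=> //; split=> //; first by rewrite HE in Hw.
  have [e e0 eU] := iffLR (open_distP _) oU _ Uw.
  exists e => // x /eU Ux; have /seteqP[h1 h2] := XU.
  split=> hx; first by have [] := h1 _ (conj hx Ux); rewrite HpE.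
  by apply: (h2 x _).1; split=> //; rewrite HpE.
move=> [phi [c [w [-> [phi0 phiw [e e0 eP]]]]]]; split; first exact: hyperplane_affine.
exists w, [set x | `|w - x| < e], [set x | c <= phi x]; split.
- by split=> //; apply/eP; rewrite ?subrr ?normr0 ?phiw.
- split=> /=; last by rewrite subrr normr0.
  apply/open_distP => x /= xe; exists (e - `|w - x|); first by rewrite subr_gt0.
  by move=> y yx; have := ler_distD x w y; lra.
- by exists phi, c.
- by apply/seteqP; split=> x /= [hx xe]; split=> //; apply/eP.
Qed.

(** Each further hyperplane is avoided by a small step towards one of its outside points [z], short
    enough to stay off the hyperplanes already avoided. This is how generic points of a facet are
    found. *)
Lemma functional_dense_off (s : seq ('Hom(F, R^o) * R)) phi0 (c0 : R) y (e : R) :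
  phi0 y = c0 -> 0 < e ->
  (forall j, j \in s -> exists2 z, phi0 z = c0 & j.1 z != j.2) ->
  exists2 y', phi0 y' = c0 /\ `|y - y'| < e & forall j, j \in s -> j.1 y' != j.2.
Proof.
move=> phiy e0; elim: s => [|[psi d] s IH] h.
  by exists y => //; rewrite subrr normr0.
have [|y1 [phiy1 yy1] y1s] := IH; first by move=> j js; apply: h; rewrite inE js orbT.
have [psiy1|psiy1] := eqVneq (psi y1 : R) d; last first.
  by exists y1 => // j; rewrite inE => /orP[/eqP->//|/y1s].
have [z phiz psiz] := h _ (mem_head _ _); rewrite /= in psiz.
have [C C0 CP] : exists2 C : R, 0 < C & forall j, j \in s -> forall x, `|j.1 x : R| <= C * `|x|.
  have [||C CP] := @common_bound R _ s (fun j C => forall x, `|j.1 x : R| <= C * `|x|).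
  - by move=> j c c' cc hc x; apply: le_trans (hc x) _; rewrite ler_wpM2r.
  - by move=> j _; have [C _ CP] := functional_bound j.1; exists C.
  exists (`|C| + 1) => [|j js x]; first by rewrite ltr_wpDl.
  apply: le_trans (CP j js x) _; rewrite ler_wpM2r//.
  by rewrite (le_trans (ler_norm C))// lerDl.
have [r r0 rP] : exists2 r : R, 0 < r & forall j, j \in s -> forall x, `|y1 - x| < r -> j.1 x != j.2.
  apply: common_radius => [j r r' rr hr x xr|j js]; first by apply: hr; exact: lt_le_trans xr rr.
  exists (`|j.1 y1 - j.2| / C); first by rewrite divr_gt0// normr_gt0 subr_eq0 y1s.
  move=> x; rewrite ltr_pdivlMr// mulrC => xr.
  apply: contraTneq xr => <-; rewrite -leNgt -functionalB; exact: CP.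
set m := Num.min r (e - `|y - y1|).
have m0 : 0 < m by rewrite lt_min r0 subr_gt0.
set t := m / (1 + `|y1 - z|).
have t0 : 0 < t by rewrite divr_gt0// ltr_pwDl.
have tm : `|y1 - (y1 + t *: (z - y1))| < m.
  rewrite opprD addrA subrr sub0r normrN normrZ gtr0_norm// distrC.
  rewrite /t mulrAC ltr_pdivrMr ?ltr_pwDl// ltr_pM2l//; lra.
exists (y1 + t *: (z - y1)).
  split.
    by rewrite functionalD functionalZ functionalB phiz phiy1 subrr mulr0 addr0.
  apply: le_lt_trans (ler_distD y1 _ _) _.
  by move: tm; rewrite lt_min => /andP[_]; lra.
move=> j; rewrite inE => /orP[/eqP->/=|js]; last first.
  by apply: (rP j js); move: tm; rewrite lt_min => /andP[].
rewrite functionalD functionalZ functionalB psiy1.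
rewrite -subr_eq0 addrAC subrr add0r; apply: mulf_neq0; first by rewrite gt_eqF.
by rewrite subr_eq0.
Qed.

Lemma supp_at_open X phi c w : supp_at X phi c w ->
  exists2 e : R, 0 < e & forall x, phi x = c -> `|w - x| < e -> supp_at X phi c x.
Proof.
move=> [phi0 phiw [e e0 eP]]; exists (e / 2) => [|x phix xe]; first by rewrite divr_gt0.
split=> //; exists (e / 2) => [|y ye]; first by rewrite divr_gt0.
by apply: eP; have := ler_distD x w y; lra.
Qed.

Lemma supp_at_mem X phi c w : supp_at X phi c w -> X w.
Proof. by move=> [_ phiw [e e0 eP]]; apply/eP; rewrite ?phiw// subrr normr0. Qed.

Lemma supp_at_outside X phi c w (e : R) : 0 < e -> supp_at X phi c w ->
  exists2 x, `|w - x| < e & ~ X x.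
Proof.
move=> e0 [phi0 phiw [r r0 rP]]; have [z z1] := functional_neq0 phi0.
set m := Num.min e r; have m0 : 0 < m by rewrite lt_min e0.
set t := m / (1 + `|z|); have t0 : 0 < t by rewrite divr_gt0// ltr_pwDl.
have tm : `|w - (w - t *: z)| < m.
  rewrite opprB addrC subrK normrZ gtr0_norm// /t mulrAC ltr_pdivrMr ?ltr_pwDl//.
  by rewrite ltr_pM2l//; lra.
move: tm; rewrite lt_min => /andP[te tr].
exists (w - t *: z) => //; rewrite rP// functionalB functionalZ phiw z1; lra.
Qed.

Lemma supp_at_boundary X phi c w : supp_at X phi c w -> boundary X w.
Proof.
move=> sw; split; first exact/subset_closure/(supp_at_mem sw).
by move=> /interior_distP[e e0 eX]; have [x /eX] := supp_at_outside e0 sw.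
Qed.

(** On such a segment [X] and its interior have the same trace, which is therefore open and closed
    in a connected set. *)
Lemma segment_avoiding_boundary X a b : closed X ->
  (forall t : R, 0 <= t <= 1 -> ~ boundary X (a + t *: (b - a))) -> X a -> X b.
Proof.
move=> cX nb Xa; pose f (t : R) := a + t *: (b - a).
have cf : continuous f.
  by move=> t; apply: cvgD; [exact: cvg_cst|apply: cvgZr_tmp; exact: cvg_id].
have f0 : f 0 = a by rewrite /f scale0r addr0.
have f1 : f 1 = b by rewrite /f scale1r addrC subrK.
have cS := connected_continuous_connected (@segment_connected R 0 1) (continuous_subspaceT cf).
have Sa : (f @` `[0, 1]) a by exists 0 => //=; rewrite in_itv /= lexx ler01.
have Sb : (f @` `[0, 1]) b by exists 1 => //=; rewrite in_itv /= lexx ler01.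
have XE : f @` `[0, 1] `&` X = f @` `[0, 1] `&` X°.
  apply/seteqP; split=> x [Sx Xx]; split=> //; last exact: interior_subset.
  apply: contrapT => nX; case: Sx => t; rewrite /= in_itv /= => /nb nt xE.
  by apply: nt; rewrite -/(f t) xE; split=> //; exact: subset_closure.
have := cS (f @` `[0, 1] `&` X) _ _ _.
move=> H; suff : (f @` `[0, 1] `&` X) b by case.
rewrite H //; first by exists a.
  by exists X° => //; exact: open_interior.
by exists X.
Qed.

End Hyperplanes.

Section LocalStructure.
Context (R : realType) (F : normedVectType R) (J : finType).
Context (phi : J -> 'Hom(F, R^o)) (c : J -> R) (X : set F).
Hypothesis phi0 : forall j, phi j != 0.
Hypothesis Xclosed : closed X.
Hypothesis bX : forall x, boundary X x -> exists j, phi j x = c j.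

Lemma functional_local_neq (psi : 'Hom(F, R^o)) (d : R) v : psi v != d ->
  exists2 e : R, 0 < e & forall x, `|v - x| < e -> psi x != d.
Proof.
move=> psiv; have [C C0 CP] := functional_bound psi.
exists (`|psi v - d| / C); first by rewrite divr_gt0// normr_gt0 subr_eq0.
move=> x; rewrite ltr_pdivlMr// mulrC; apply: contraTneq => <-.
by rewrite -leNgt -functionalB.
Qed.

Definition same_side v x y := forall j, phi j v = c j -> 0 < (phi j x - c j) * (phi j y - c j).

(** Close to [v] only the hyperplanes through [v] can meet the segment from [x] to [y], and those
    are excluded by [same_side]; so the segment avoids the boundary. *)
Lemma local_same_side v : exists2 e : R, 0 < e &
  forall x y, `|v - x| < e -> `|v - y| < e -> same_side v x y -> X x -> X y.
Proof.
have [e e0 eP] : exists2 e : R, 0 < e & forall j, j \in enum J ->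
    phi j v != c j -> forall x, `|v - x| < e -> phi j x != c j.
  apply: common_radius => [j e e' ee' h n x xe|j _].
    by apply: h => //; exact: lt_le_trans xe ee'.
  have [e|e] := eqVneq (phi j v : R) (c j); first by exists 1.
  by have [r r0 rP] := functional_local_neq e; exists r.
exists e => // x y vx vy xy; apply: segment_avoiding_boundary => // t /andP[t0 t1].
set z := x + t *: (y - x) => /bX[j zj].
have vz : `|v - z| < e.
  have -> : v - z = (1 - t) *: (v - x) + t *: (v - y).
    rewrite scalerBl scale1r -addrA [- _ + _]addrC -scalerBr opprB [v - y + _]addrC.
    by rewrite addrA subrK /z opprD addrA -scalerN opprB.
  have := ler_normD ((1 - t) *: (v - x)) (t *: (v - y)).
  rewrite !normrZ !ger0_norm// ?subr_ge0//; move: vx vy.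
  set a := `|v - x|; set b := `|v - y|; set d := `|_ + _| => ae be.
  by have [t2|t2] := lerP t (1 / 2); nra.
have vj : phi j v = c j by apply/eqP; apply: contraT => /(eP j (mem_enum _ _)) /(_ _ vz); rewrite zj eqxx.
have := xy j vj; have : phi j z = phi j x + t * (phi j y - phi j x) :> R.
  by rewrite functionalD functionalZ functionalB.
rewrite zj; set a : R := phi j x; set b : R := phi j y => zc.
(* The product of the two differences is [- t (1 - t) (a - b)^2], which is not positive. *)
have -> : a - c j = t * (a - b) by rewrite zc; ring.
have -> : b - c j = - ((1 - t) * (a - b)) by rewrite zc; ring.
rewrite mulrN oppr_gt0 ltNge mulrACA mulr_ge0//; first by rewrite mulr_ge0 ?subr_ge0.
by rewrite -expr2 sqr_ge0.
Qed.

Hypothesis Xreg : regclosed X.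

Lemma regclosed_approx x (e : R) : X x -> 0 < e -> exists2 y, X° y & `|x - y| < e.
Proof. by rewrite -{1}Xreg => /closure_distP; exact. Qed.

Lemma generic_near x (e : R) : 0 < e -> exists2 y, `|x - y| < e & forall j, phi j y != c j.
Proof.
move=> e0.
(* With the zero functional the constraint is void, so the density holds in the whole space. *)
have [|y [_ xy] yP] := @functional_dense_off _ _ [seq (phi j, c j) | j <- enum J] 0 0 x e ltac:(by rewrite zero_lfunE) e0.
  move=> _ /mapP[j _ ->] /=; have [z z1] := functional_neq0 (phi0 j).
  exists ((c j + 1) *: z); first by rewrite zero_lfunE.
  by rewrite functionalZ z1 mulr1 -subr_eq0 addrAC subrr add0r oner_eq0.
exists y => // j; have := yP (phi j, c j); apply.
by apply: map_f; rewrite mem_enum.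
Qed.

(** The sides of [x] are undefined when it lies on a hyperplane, so [x] is first approximated by
    generic interior points, which exist since [X] is regularly closed; the Lipschitz bound carries
    the approximation over to [T x]. The radius does not depend on [T], so it serves all homotheties
    centred at [v] and all translations along the hyperplanes through [v]. *)
Lemma local_transport v : exists2 e : R, 0 < e & forall (T : F -> F) (K : R),
  (forall x y, `|T x - T y| <= K * `|x - y|) ->
  (forall x, (forall j, phi j x != c j) -> same_side v x (T x)) ->
  forall x, `|v - x| < e -> `|v - T x| < e -> X x -> X (T x).
Proof.
have [e e0 eP] := local_same_side v; exists e => // T K TK Ts x vx vTx Xx.
apply: closed_dist => // r r0.
set K' := `|K| + 1; have K'0 : 0 < K' by rewrite ltr_wpDl.
have TK' y z : `|T y - T z| <= K' * `|y - z|.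
  apply: le_trans (TK y z) _; rewrite ler_wpM2r//.
  by rewrite (le_trans (ler_norm K))// lerDl.
set m := Num.min (e - `|v - x|) (Num.min (r / K') ((e - `|v - T x|) / K')).
have m0 : 0 < m by rewrite !lt_min subr_gt0 vx !divr_gt0 ?subr_gt0.
have [y Xy xy] := regclosed_approx Xx (divr_gt0 m0 (ltr0n _ 2)).
have /interior_distP[d d0 dP] := Xy.
have [z yz zj] := generic_near y (e := Num.min d (m / 2)) ltac:(by rewrite lt_min d0 divr_gt0).
have xz : `|x - z| < m.
  by move: yz; rewrite lt_min => /andP[_ yz]; have := ler_distD y x z; lra.
have Xz : X z by apply: dP; move: yz; rewrite lt_min => /andP[].
have Tm : `|T x - T z| < K' * m by apply: le_lt_trans (TK' _ _) _; rewrite ltr_pM2l.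
have [mr me] : K' * m <= r /\ K' * m <= e - `|v - T x|.
  split; rewrite mulrC -ler_pdivlMr//.
    by rewrite /m !ge_min lexx !orbT.
  by rewrite /m !ge_min lexx !orbT.
have me' : m <= e - `|v - x| by rewrite /m ge_min lexx.
exists (T z); last exact: lt_le_trans Tm mr.
apply: (eP z (T z)) => //; last exact: Ts.
  by have := ler_distD x v z; lra.
by have := ler_distD (T x) v (T z); lra.
Qed.

(** Homotheties centred at [v] preserve the sides of the hyperplanes through [v], so the germ of [X]
    at [v] is a cone. *)
Lemma tangent_cone_local v : X v -> exists2 e : R, 0 < e &
  forall u, `|u| < e -> X (v + u) <-> tangent_cone X v u.
Proof.
move=> Xv; have [e e0 eP] := local_transport v.
have scaleP (s : R) u : 0 < s -> `|u| < e -> `|s *: u| < e -> X (v + u) -> X (v + s *: u).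
  move=> s0 ue sue Xu; pose T x := v + s *: (x - v).
  have -> : v + s *: u = T (v + u) by rewrite /T addrAC subrr add0r.
  apply: (eP T s) => //.
  - move=> x y; rewrite /T opprD addrACA subrr add0r -scalerBr opprB addrA subrK.
    by rewrite normrZ gtr0_norm.
  - move=> x xj j vj; rewrite /T functionalD functionalZ functionalB vj.
    rewrite addrAC subrr add0r mulrCA mulr_gt0//.
    by rewrite -expr2 exprn_even_gt0//= subr_eq0 xj.
  - by rewrite opprD addrA subrr sub0r normrN.
  - by rewrite /T addrAC subrr add0r opprD addrA subrr sub0r normrN.
exists e => // u ue; split=> [Xu|[d d0 dP]].
  exists 1 => // t /andP[t0 t1]; move: t0; rewrite le_eqVlt => /orP[/eqP<-|t0].
    by rewrite scale0r addr0.
  by apply: scaleP => //; rewrite normrZ gtr0_norm//; apply: le_lt_trans ue; rewrite ler_piMl.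
set t := Num.min 1 d; have t0 : 0 < t by rewrite lt_min d0 ltr01.
have Xt : X (v + t *: u) by apply: dP; rewrite ltW//= ge_min lexx orbT.
have -> : u = t^-1 *: (t *: u) by rewrite scalerA mulVf ?scale1r// gt_eqF.
apply: scaleP => //; first by rewrite invr_gt0.
  rewrite normrZ gtr0_norm//; apply: le_lt_trans ue; rewrite ler_piMl//.
  by rewrite /t ge_min lexx.
by rewrite scalerA mulVf ?scale1r// gt_eqF.
Qed.

Lemma tangent_coneZ v u (s : R) : 0 < s -> tangent_cone X v u -> tangent_cone X v (s *: u).
Proof.
move=> s0 [e e0 eP]; exists (e / s) => [|t /andP[t0 te]]; first by rewrite divr_gt0.
by rewrite scalerA; apply: eP; rewrite mulr_ge0 ?(ltW s0)//= -ler_pdivlMr.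
Qed.

Lemma polytope_vertex_mem v : polytope_vertex X v -> X v.
Proof. by move=> [[Xv _] _]; exact: Xclosed. Qed.

(** Translation along a direction [w] common to all hyperplanes through [v] preserves their sides,
    hence the tangent cone; at a vertex this forces [w = 0]. The functionals active at a vertex thus
    separate points. *)
Lemma polytope_vertex_kernel v w : polytope_vertex X v ->
  (forall j, phi j v = c j -> phi j w = 0) -> w = 0.
Proof.
move=> vX; have Xv := polytope_vertex_mem vX; case: vX => _ vX wj.
apply/eqP; apply: contrapT => /negP /vX; apply.
suff H (t : R) u : tangent_cone X v u -> tangent_cone X v (u + t *: w).
  move=> t; apply/seteqP; split=> [_ [u Tu <-]|u Tu]; first exact: H.
  by exists (u + (- t) *: w); [exact: H | rewrite scaleNr subrK].
move=> Tu; have [e e0 eP] := tangent_cone_local Xv.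
have [e' e'0 e'P] := local_transport v.
set m := Num.min e e'; have m0 : 0 < m by rewrite lt_min e0.
set K := 1 + `|u| + `|t *: w|; have K0 : 0 < K by rewrite ltr_pwDl// addr_ge0.
set s := m / K; have s0 : 0 < s by rewrite divr_gt0.
have small x : `|x| < K -> `|s *: x| < m.
  move=> xK; rewrite normrZ gtr0_norm// /s mulrAC ltr_pdivrMr// ltr_pM2l//.
have su : `|s *: u| < m by apply: small; rewrite /K; have := normr_ge0 (t *: w); lra.
have sut : `|s *: (u + t *: w)| < m.
  by apply: small; have := ler_normD u (t *: w); rewrite /K; lra.
have [me me'] : m <= e /\ m <= e' by rewrite /m !ge_min !lexx orbT.
have Xsu : X (v + s *: u).
  by apply/eP; [exact: lt_le_trans su me | exact: tangent_coneZ].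
have -> : u + t *: w = s^-1 *: (s *: (u + t *: w)).
  by rewrite scalerA mulVf ?scale1r// gt_eqF.
apply: tangent_coneZ; first by rewrite invr_gt0.
apply/eP; first exact: lt_le_trans sut me.
rewrite scalerDr addrA; pose T x := x + s *: (t *: w).
apply: (e'P T 1).
- by move=> x y; rewrite /T opprD addrACA subrr addr0 mul1r.
- move=> x xj j vj; rewrite /T functionalD !functionalZ (wj _ vj) !mulr0 addr0.
  by rewrite -expr2 exprn_even_gt0//= subr_eq0 xj.
- by rewrite opprD addrA subrr sub0r normrN; exact: lt_le_trans su me'.
- rewrite /T -addrA -scalerDr opprD addrA subrr sub0r normrN; exact: lt_le_trans sut me'.
- exact: Xsu.
Qed.

(* Near [v] the boundary is one hyperplane, so each of the two open half balls
   lies in [X] or avoids it; [v] being a boundary point, exactly one lies in [X]. *)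
Lemma supp_at_of_boundary v j0 : boundary X v ->
  (forall j, phi j v = c j -> exists2 k : R, k != 0 & phi j = k *: phi j0 /\ c j = k * c j0) ->
  exists2 sg : bool, supp_at X ((-1) ^+ sg *: phi j0) ((-1) ^+ sg * c j0) v & phi j0 v = c j0.
Proof.
move=> bv hj.
have vj0 : phi j0 v = c j0.
  have [j vj] := bX bv; have [k k0 [phijE cjE]] := hj j vj.
  move: vj; rewrite phijE cjE scale_lfunE; exact: mulfI.
have [e e0 eP] := local_same_side v.
pose f x : R := phi j0 x - c j0.
have ss x y : `|v - x| < e -> `|v - y| < e -> 0 < f x * f y -> X x -> X y.
  move=> vx vy fxy; apply: eP => // j /hj[k k0 [-> ->]]; rewrite !scale_lfunE.
  rewrite -![k *: (phi j0 _ : R^o)]/(k * phi j0 _) -!mulrBr mulrACA mulr_gt0//.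
  by rewrite -expr2 exprn_even_gt0//= k0.
have fB x y : f x - f y = phi j0 (x - y) by rewrite /f functionalB; ring.
have [z z1] := functional_neq0 (phi0 j0).
have [C C0 CP] := functional_bound (phi j0).
have approx (b : R) x r : 0 < r -> `|v - x| < e -> 0 <= b * f x -> b != 0 ->
    exists2 y, `|x - y| < r & `|v - y| < e /\ 0 < b * f y.
  move=> r0 vx bfx b0; set m := Num.min r (e - `|v - x|).
  have m0 : 0 < m by rewrite lt_min r0 subr_gt0.
  set t := m / (1 + `|b *: z|); have t0 : 0 < t by rewrite divr_gt0// ltr_pwDl.
  have tm : `|x - (x + t *: (b *: z))| < m.
    rewrite opprD addrA subrr sub0r normrN normrZ gtr0_norm// /t mulrAC ltr_pdivrMr ?ltr_pwDl//.
    by rewrite ltr_pM2l//; lra.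
  exists (x + t *: (b *: z)); first by apply: lt_le_trans tm _; rewrite /m ge_min lexx.
  split.
    have : m <= e - `|v - x| by rewrite /m ge_min lexx orbT.
    by have := ler_distD x v (x + t *: (b *: z)); lra.
  rewrite /f functionalD !functionalZ z1 mulr1 -addrA [t * b + _]addrC addrA mulrDr.
  rewrite -/(f x) ltr_wpDl// mulrCA mulr_gt0//.
  by rewrite -expr2 exprn_even_gt0//= b0.
have half (b : R) : b != 0 -> (exists2 x, `|v - x| < e & X x /\ 0 < b * f x) ->
    forall y, `|v - y| < e -> 0 <= b * f y -> X y.
  move=> b0 [x vx [Xx fx]] y vy fy; apply: closed_dist => // r r0.
  have [y' yy' [vy' fy']] := approx b y r r0 vy fy b0.
  exists y' => //; apply: ss Xx => //.
  have : 0 < (b * f x) * (b * f y') by exact: mulr_gt0.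
  by rewrite mulrACA -expr2 pmulr_rgt0// exprn_even_gt0//= b0.
have [u Xu vu] := regclosed_approx (Xclosed bv.1) e0.
have [u' uu' [fu' Xu']] : exists2 u', `|v - u'| < e & f u' != 0 /\ X u'.
  have /interior_distP[d d0 dP] := Xu.
  set m := Num.min d (e - `|v - u|).
  have [|y uy yj] := generic_near u (e := m); first by rewrite lt_min d0 subr_gt0.
  move: uy; rewrite lt_min => /andP[uy1 uy2].
  exists y; first by have := ler_distD u v y; lra.
  by split; [rewrite subr_eq0 yj | exact: dP].
set sg := f u' < 0; exists sg => //; set b : R := (-1) ^+ sg.
have b0 : b != 0 by rewrite signr_eq0.
have bfu' : 0 < b * f u'.
  rewrite /b /sg; case: (ltrgt0P (f u')) fu' => //= h _; first by rewrite expr0 mul1r.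
  by rewrite expr1 mulN1r oppr_gt0.
have hb := half b b0 (ex_intro2 _ _ u' uu' (conj Xu' bfu')).
split.
- by rewrite scaler_eq0 (negPf b0) (negPf (phi0 _)).
- by rewrite scale_lfunE vj0.
- exists e => // x vx; rewrite scale_lfunE -[b *: (phi j0 x : R^o)]/(b * phi j0 x).
  rewrite -subr_ge0 -mulrBr -/(f x); split=> [Xx|]; last exact: hb.
  rewrite leNgt; apply/negP => bfx; case: bv => _; apply; apply/interior_distP.
  exists e => // y vy; have [|ny] := lerP 0 (b * f y); first exact: hb.
  apply: (half (- b)) => //; rewrite ?oppr_eq0//; last by rewrite mulNr oppr_ge0 ltW.
  by exists x => //; split=> //; rewrite mulNr oppr_gt0.
Qed.

End LocalStructure.

Section VertexExistence.
Context (R : realType) (F : normedVectType R) (J : finType).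
Context (phi : J -> 'Hom(F, R^o)) (c : J -> R) (X : set F).
Hypothesis phi0 : forall j, phi j != 0.
Hypothesis Xcompact : compact X.
Hypothesis bX : forall x, boundary X x -> exists j, phi j x = c j.
Hypothesis Xreg : regclosed X.

(** The given norm need not be strictly convex; this quadratic form is, through the parallelogram
    identity, and serves to single out extreme points. *)
Let euclid (x : F) : R := \sum_i coord (vbasis {:F}) i x ^+ 2.

Let euclid_parallelogram x y :
  euclid (x + y) + euclid (x - y) = 2 * euclid x + 2 * euclid y.
Proof.
rewrite /euclid !mulr_sumr -!big_split; apply: eq_bigr => i _ /=.
by rewrite linearD linearB /=; ring.
Qed.

Let euclid_gt0 x : x != 0 -> 0 < euclid x.
Proof.
move=> x0; rewrite lt_neqAle sumr_ge0 ?andbT; last by move=> i _; exact: sqr_ge0.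
apply: contra_neq x0 => /esym/eqP.
rewrite psumr_eq0 => [/allP h|i _]; last exact: sqr_ge0.
rewrite (coord_vbasis (memvf x)); apply: big1 => i _.
by have := h i (mem_index_enum _); rewrite sqrf_eq0 => /eqP ->; rewrite scale0r.
Qed.

Let euclid_continuous : continuous euclid.
Proof.
rewrite /euclid; elim: (index_enum _) => [|i s IH].
  rewrite (_ : (fun x => _) = cst 0); first exact: cst_continuous.
  by apply/funext => x; rewrite big_nil.
rewrite (_ : (fun x => _) = (fun x => coord (vbasis {:F}) i x ^+ 2 +
  \sum_(j <- s) coord (vbasis {:F}) j x ^+ 2)); last by apply/funext => x; rewrite big_cons.
move=> x; apply: cvgD; last exact: IH.
have cx := @lin_continuous R F R^o (coord (vbasis {:F}) i) x.
exact: (cvgM cx cx).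
Qed.

(** On the closure of the facet, [v] maximises first [psi] and then [euclid]. If the tangent cone at
    [v] were invariant along [w], then for small [t] both [v + t w] and [v - t w] would be
    competitors, and the parallelogram identity would contradict the second maximality. *)
Lemma vertex_exists (psi0 : 'Hom(F, R^o)) (c0 : R) w0 (psi : 'Hom(F, R^o)) :
  supp_at X psi0 c0 w0 -> exists v, [/\ polytope_vertex X v, psi0 v = c0 &
    forall w, supp_at X psi0 c0 w -> psi w <= psi v].
Proof.
move=> sw0; pose S := supp_at X psi0 c0.
have Xcl : closed X by rewrite -Xreg; exact: closed_closure.
have KX : closure S `<=` X.
  rewrite [X in _ `<=` X](closure_id _).1//.
  by apply: closureS => x; exact: supp_at_mem.
have Kphi : closure S `<=` [set x | psi0 x = c0].
  have cl : closed [set x | psi0 x = c0].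
    apply: (@preimage_closed _ _ psi0 [set c0]); last exact: closed_eq.
    by move=> x _; exact: lin_continuous.
  rewrite [X in _ `<=` X](closure_id _).1//.
  by apply: closureS => x [].
have Kc : compact (closure S) by apply: subclosed_compact Xcompact KX; exact: closed_closure.
have psic : continuous (psi : F -> R) by exact: (@lin_continuous R F R^o).
have [||k0 /set_mem Kk0 k0P] := compact_EVT_max _ Kc (f := psi : F -> R).
- by exists w0; apply: subset_closure.
- exact: continuous_subspaceT.
pose K' := closure S `&` [set x | psi x = psi k0].
have K'c : compact K'.
  apply: subclosed_compact Kc (@subIsetl _ _ _); apply: closedI; first exact: closed_closure.
  by apply: (@preimage_closed _ _ (psi : F -> R) [set psi k0 : R]) => [x _|]; [exact: psic|exact: closed_eq].
have [||v /set_mem [Kv psiv] vP] := compact_EVT_max _ K'c (f := euclid).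
- by exists k0.
- exact: (continuous_subspaceT euclid_continuous).
have Xv : X v := KX _ Kv.
exists v; split; last 2 first.
- exact: (Kphi _ Kv).
- move=> w Sw; rewrite psiv; apply: k0P; apply/mem_set; exact: subset_closure.
split.
  split; first exact: subset_closure.
  move=> /interior_distP[e e0 eX].
  have [y Sy vy] := iffLR (closure_distP _ _) Kv _ e0.
  have [x yx] := supp_at_outside (e := e - `|v - y|) ltac:(by rewrite subr_gt0) Sy.
  by apply; apply: eX; have := ler_distD y v x; lra.
move=> w w0' wT.
have [e e0 eP] := tangent_cone_local phi0 Xcl bX Xreg Xv.
have shift (t : R) y : `|v - y| < e -> `|v - (y + t *: w)| < e -> X y -> X (y + t *: w).
  move=> vy vyt Xy; have yE z : z = v + (z - v) by rewrite addrC subrK.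
  rewrite (yE (y + _)); apply/eP; first by rewrite distrC.
  rewrite addrAC -(wT t) /=; exists (y - v) => //; apply/eP; first by rewrite distrC.
  by rewrite -yE.
have shiftE (t : R) y : `|v - y| < e -> `|v - (y + t *: w)| < e -> X y <-> X (y + t *: w).
  move=> vy vyt; split; first exact: shift.
  move=> /(shift (- t) _ vyt); rewrite scaleNr addrK; exact.
have small (r : R) : 0 < r -> exists2 t : R, 0 < t & `|t *: w| < r.
  move=> r0; exists (r / (1 + `|w|)); first by rewrite divr_gt0// ltr_pwDl.
  rewrite normrZ gtr0_norm ?divr_gt0 ?ltr_pwDl// mulrAC ltr_pdivrMr ?ltr_pwDl//.
  by rewrite ltr_pM2l//; lra.
have e20 : 0 < e / 2 by rewrite divr_gt0.
(* Otherwise a small move along [w], in the direction that lowers [psi0], would keep a facet point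
   inside [X] and yet leave its half-space. *)
have phiw : psi0 w = 0.
  apply/eqP; apply: contrapT => /negP phiw.
  have [y Sy vy] := iffLR (closure_distP _ _) Kv _ e20.
  have [_ phiy [r r0 rP]] := Sy.
  have [t t0 tw] := small (Num.min r (e / 2)) ltac:(by rewrite lt_min r0).
  move: tw; rewrite lt_min => /andP[twr twe].
  have [sg [sg1 sgw]] : exists sg : R, `|sg| = 1 /\ 0 < sg * psi0 w.
    case: (ltrgt0P (psi0 w : R)) => [h|h|h]; last by rewrite h eqxx in phiw.
      by exists 1; rewrite normr1 mul1r.
    by exists (-1); rewrite normrN1 mulN1r oppr_gt0.
  pose b : R := - sg * t.
  have bw : `|b *: w| = `|t *: w|.
    by rewrite !normrZ normrN sg1 mul1r.
  have Xyb : X (y + b *: w).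
    apply: shift; last exact: supp_at_mem Sy; first lra.
    by rewrite opprD addrA; have := ler_normB (v - y) (b *: w); rewrite bw; lra.
  have : c0 <= psi0 (y + b *: w).
    by apply/rP => //; rewrite opprD addrA subrr sub0r normrN bw.
  rewrite functionalD functionalZ phiy /b.
  have : 0 < sg * psi0 w * t by exact: mulr_gt0.
  set a : R := psi0 w; lra.
(* Invariance shifts a full neighbourhood of a facet point, so the shifted point sees the same
   half-space. *)
have Sshift (t : R) y : S y -> `|v - y| < e / 2 -> `|t *: w| < e / 2 -> S (y + t *: w).
  move=> [psi00 phiy [r r0 rP]] vy tw.
  split=> //; first by rewrite functionalD functionalZ phiw mulr0 addr0.
  have d1 : `|v - (y + t *: w)| < e.
    by rewrite opprD addrA; have := ler_normB (v - y) (t *: w); lra.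
  exists (Num.min r (e - (`|v - y| + `|t *: w|))) => [|x]; first by rewrite lt_min r0 subr_gt0; lra.
  rewrite lt_min => /andP[xr xe].
  have xE : x = (x - t *: w) + t *: w by rewrite subrK.
  have xy : `|y - (x - t *: w)| = `|y + t *: w - x| by rewrite opprB addrA.
  have vx : `|v - (x - t *: w)| < e.
    by have := ler_distD y v (x - t *: w); have := normr_ge0 (t *: w); lra.
  have vx' : `|v - x| < e.
    have := ler_distD (y + t *: w) v x; have : `|v - (y + t *: w)| <= `|v - y| + `|t *: w|.
      by rewrite opprD addrA; exact: ler_normB.
    by lra.
  by rewrite {1}xE -shiftE -?xE// rP ?xy// functionalB functionalZ phiw mulr0 subr0.
have Kshift (t : R) : `|t *: w| < e / 2 -> closure S (v + t *: w).
  move=> tw; apply/closure_distP => r r0.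
  have m0 : 0 < Num.min r (e / 2) by rewrite lt_min r0.
  have [y Sy] := iffLR (closure_distP _ _) Kv _ m0.
  rewrite lt_min => /andP[vyr vye].
  exists (y + t *: w); first exact: Sshift.
  by rewrite opprD addrACA subrr addr0.
have [t t0 tw] := small _ e20.
have Kp := Kshift t tw.
have Km : closure S (v - t *: w) by rewrite -scaleNr; apply: Kshift; rewrite scaleNr normrN.
have := k0P _ (mem_set Kp); have := k0P _ (mem_set Km); rewrite -psiv.
rewrite functionalB functionalD => h1 h2.
have ptw : psi (t *: w) = 0 by apply/eqP; rewrite eq_le; apply/andP; split; lra.
have K'p : K' (v + t *: w) by split; rewrite //= functionalD ptw addr0.
have K'm : K' (v - t *: w) by split; rewrite //= functionalB ptw subr0.
have := euclid_parallelogram v (t *: w).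
have := vP _ (mem_set K'p); have := vP _ (mem_set K'm).
have : 0 < euclid (t *: w) by apply: euclid_gt0; rewrite scaler_eq0 negb_or gt_eqF.
lra.
Qed.

End VertexExistence.

(** * The hull as a space of ultrafilter limits *)

(** On finitely many sets an ultrafilter is indistinguishable from a point: for each [B i], either
    it or its complement is large, and these choices are intersected with [A]. *)
Lemma ultra_realize (T : Type) (U : set_system T) (A : set T) (I : eqType)
    (t : seq I) (B : I -> set T) : UltraFilter U -> U A ->
  exists2 u, A u & forall i, i \in t -> B i u <-> U (B i).
Proof.
move=> UU UA; have UF : ProperFilter U by exact: ultra_proper.
suff [C UC CP] : exists2 C, U C & forall u, C u -> forall i, i \in t -> B i u <-> U (B i).
  by have [u [Au Cu]] := filter_ex (filterI UA UC); exists u => //; exact: CP.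
elim: t => [|i t [C UC CP]]; first by exists setT => //; exact: filterT.
have [UB|UB] := in_ultra_setVsetC (B i) UU.
  exists (B i `&` C) => [|u [Bu Cu] j]; first exact: filterI.
  by rewrite inE => /orP[/eqP->//|/(CP _ Cu)].
exists (~` B i `&` C) => [|u [Bu Cu] j]; first exact: filterI.
rewrite inE => /orP[/eqP->|/(CP _ Cu)//]; split=> // UB'.
by have [v []] := filter_ex (filterI UB UB').
Qed.

(** * Cut and project sets over a lattice with two linear projections *)

Section CutProject.
Context (R : realType) (E V F : normedVectType R) (l : nat).
Context (p : {linear E -> V}) (q : {linear E -> F}) (jv : {linear V -> E}) (jf : {linear F -> E}).
Context (G : set E) (W : 'I_l -> set F).
Hypothesis pjv : forall a, p (jv a) = a.
Hypothesis qjv : forall a, q (jv a) = 0.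
Hypothesis pqE : forall x, x = jv (p x) + jf (q x).
Hypothesis hG : lattice_set G.
Hypothesis p_inj : forall g, G g -> p g = 0 -> g = 0.
Hypothesis q_dense : forall x (e : R), 0 < e -> exists2 g, G g & `|x - q g| < e.
Hypothesis Wc : forall i, compact (W i).

Lemma pq_bound : exists2 K : R, 0 < K & forall x, `|x| <= K * (`|p x| + `|q x|).
Proof.
have [C1 C10 C1P] := lin_bound jv; have [C2 C20 C2P] := lin_bound jf.
exists (C1 + C2) => [|x]; first exact: addr_gt0.
rewrite {1}(pqE x); apply: le_trans (ler_normD _ _) _.
have := C1P (p x); have := C2P (q x).
have := mulr_ge0 (ltW C10) (normr_ge0 (q x)); have := mulr_ge0 (ltW C20) (normr_ge0 (p x)).
by rewrite mulrDl !mulrDr; lra.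
Qed.

Lemma strip_finite (C1 C2 : R) : exists s : seq E, (forall g, g \in s -> G g) /\
  forall g, G g -> `|p g| <= C1 -> `|q g| <= C2 -> g \in s.
Proof.
have [K K0 KP] := pq_bound; have [s sP] := lattice_finite hG (K * (C1 + C2)).
exists [seq g <- s | `[< G g >]]; split=> [g|g Gg pg qg].
  by rewrite mem_filter => /andP[/asboolP].
rewrite mem_filter sP ?andbT//; first by apply/asboolP.
by apply: le_trans (KP g) _; rewrite ler_pM2l// lerD.
Qed.

(** A lattice point near [jv x] has its internal part in a fixed compact ball; a second lattice
    vector, bounded by compactness, then corrects the internal part towards [b]. *)
Lemma strip_cover b (e : R) : 0 < e -> exists C : R, forall x,
  exists g, [/\ G g, `|x - p g| <= C & `|b - q g| < e].
Proof.
move=> e0; have [R0 R0P] := lattice_cover hG.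
have [Cp Cp0 CpP] := lin_bound p; have [Cq Cq0 CqP] := lin_bound q.
pose K := [set a : F | `|0 - a| <= Cq * `|R0|].
have Kc : compact K.
  apply: (@bounded_closed_compactV _ _ _ (Cq * `|R0|)); last exact: closed_ballP.
  by move=> x; rewrite /K /= sub0r normrN.
have [||c cP] := @compact_cover_scale R F K
  (fun c a => exists g, [/\ G g, `|g| <= c & `|b - (a + q g)| < e]) Kc.
- by move=> c c' x cc [g [Gg gc gb]]; exists g; split=> //; exact: le_trans cc.
- move=> a _; have [g Gg ge] := q_dense (b - a) e0.
  exists (e - `|b - a - q g|); first by rewrite subr_gt0.
  exists `|g| => y ay; exists g; split=> //.
  have -> : b - (y + q g) = (b - a - q g) + (a - y) by module.
  by apply: le_lt_trans (ler_normD _ _) _; lra.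
exists (Cp * `|R0| + Cp * c) => x; have [g0 Gg0 g0P] := R0P (jv x).
have g0R : `|jv x - g0| <= `|R0| := le_trans g0P (ler_norm _).
have [|g1 [Gg1 g1c g1b]] := cP (q g0).
  rewrite /K /= sub0r normrN; have := CqP (jv x - g0).
  rewrite linearB qjv sub0r normrN => h; apply: le_trans h _.
  by rewrite ler_pM2l.
exists (g0 + g1); split; [exact: latticeD| |by rewrite linearD].
rewrite linearD opprD addrA; apply: le_trans (ler_normB _ _) _; apply: lerD.
  have := CpP (jv x - g0); rewrite linearB pjv => h; apply: le_trans h _.
  by rewrite ler_pM2l.
by apply: le_trans (CpP _) _; rewrite ler_pM2l.
Qed.

Definition nonsingular_at u := forall g i, G g -> ~ boundary (W i) (q g + u).

(* The hull consists of the limits of the model sets with nonsingular parameter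
   [u]. A limit parameter [uh] may be singular: the ultrafilter [U] on the
   nonsingular parameters near [uh] decides on which side of the windows the
   lattice points on their boundaries lie. *)
Definition good_ultra (U : set_system F) (uh : F) := [/\ UltraFilter U, U nonsingular_at &
  forall e : R, 0 < e -> U [set u | `|uh - u| < e]].

Definition Lam (U : set_system F) (p0 : V) : 'I_l -> set V :=
  fun i => [set x | exists g, [/\ G g, x = p0 + p g & U [set u | W i (q g + u)]]].

Lemma W_bound : exists2 C : R, 0 < C & forall i x, W i x -> `|x| <= C.
Proof.
have [||C CP] := @common_bound R _ (enum 'I_l) (fun i C => forall x, W i x -> `|x| <= C).
- by move=> i c c' cc h x /h xc; exact: le_trans cc.
- by move=> i _; have [C _ CP] := compact_dist_bounded (@Wc i); exists C.
exists (`|C| + 1) => [|i x Wx]; first by rewrite ltr_wpDl.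
by apply: le_trans (CP i (mem_enum _ _) x Wx) _; apply: le_trans (ler_norm _) _; rewrite lerDl.
Qed.

Lemma p_inj2 g g' : G g -> G g' -> p g = p g' -> g = g'.
Proof.
move=> Gg Gg' pp; apply/eqP; rewrite -subr_eq0; apply/eqP/p_inj; first exact: latticeB.
by rewrite linearB /= pp subrr.
Qed.

Lemma W_closed i : closed (W i).
Proof. by apply: compact_closed => //; exact: norm_hausdorff. Qed.

Lemma window_status_open i x : ~ boundary (W i) x -> exists2 e : R, 0 < e &
  forall y, `|x - y| < e -> W i x <-> W i y.
Proof.
have [Wx|nWx] := pselect (W i x) => nb; last first.
  by have [e e0 eP] := not_closed_dist (@W_closed i) nWx; exists e => // y /eP ny; split.
have /interior_distP[e e0 eP] : (W i)° x.
  by apply: contrapT => nx; apply: nb; split=> //; exact: subset_closure.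
by exists e => // y /eP.
Qed.

Lemma ultra_ex2 (U : set_system F) (A B : set F) : UltraFilter U -> U A -> U B ->
  exists u, A u /\ B u.
Proof.
move=> UU UA UB; have UF : ProperFilter U by exact: ultra_proper.
exact: filter_ex (filterI UA UB).
Qed.

(** A bounded patch involves finitely many lattice points. Their statuses under [U'] are realised at
    a nonsingular [u'], around which they are locally constant; a lattice vector [h] with [uh + q h]
    close to [u'] then reproduces the patch under [U]. *)
Lemma Lam_LI U uh U' uh' p0 p' : good_ultra U uh -> good_ultra U' uh' ->
  LI (Lam U' p') (Lam U p0).
Proof.
move=> [UU UN Uc] [UU' UN' Uc'] B [M0 [_ BM0]].
set M := M0 + 1; have BM x : B x -> `|x| <= M by apply: BM0; rewrite ltrDl.
have UF : ProperFilter U by exact: ultra_proper.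
have UF' : ProperFilter U' by exact: ultra_proper.
have [C C0 CP] := W_bound.
(* A larger internal part puts the point outside every window for all parameters within 2 of [uh']:
   one unit is spent between [uh'] and [u'], the other between [u'] and [q h + u]. *)
have [s [sG sP]] := strip_finite (M + `|p'|) (C + `|uh'| + 2).
have [u' [Nu' u'uh] u'P] := @ultra_realize _ U' _ _
  (allpairs pair s (enum 'I_l)) (fun z => [set u | W z.2 (q z.1 + u)]) UU'
  (filterI UN' (Uc' 1 ltr01)).
have {}u'P g i : g \in s -> W i (q g + u') <-> U' [set u | W i (q g + u)].
  move=> gs; apply: (u'P (g, i)); apply/allpairsP; exists (g, i).
  by rewrite /= mem_enum.
have [e e0 eP] : exists2 e : R, 0 < e & forall z, z \in allpairs pair s (enum 'I_l) ->
    forall y, `|u' - y| < e -> W z.2 (q z.1 + u') <-> W z.2 (q z.1 + y).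
  apply: common_radius => [z r r' rr h y yr|[g i] /allpairsP[[g' i'] [/= gs _ [-> ->]]]].
    by apply: h; exact: lt_le_trans yr rr.
  have [r r0 rP] := window_status_open (Nu' g' i' (sG _ gs)).
  by exists r => // y yr; apply: rP; rewrite opprD addrACA subrr add0r.
have {}eP g i y : g \in s -> `|u' - y| < e -> W i (q g + u') <-> W i (q g + y).
  move=> gs; apply: (eP (g, i)); apply/allpairsP; exists (g, i).
  by rewrite /= mem_enum.
set e' := Num.min (e / 2) 2^-1; have e'0 : 0 < e' by rewrite lt_min divr_gt0// invr_gt0 ltr0n.
have [h Gh hP] := q_dense (u' - uh) e'0.
have near : U [set u | `|u' - (q h + u)| < Num.min e 1].
  apply: filterS (Uc _ e'0) => u /= uu.
  have -> : u' - (q h + u) = (u' - uh - q h) + (uh - u) by module.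
  apply: le_lt_trans (ler_normD _ _) _; move: hP uu.
  rewrite /e' !lt_min => /andP[h1 h2] /andP[h3 h4]; apply/andP; split; lra.
have key g i : G g -> `|p g| <= M + `|p'| ->
    U [set u | W i (q (g + h) + u)] <-> U' [set u | W i (q g + u)].
  move=> Gg pg; have [gs|gs] := boolP (g \in s).
    rewrite -u'P//; split=> [Uw|Ww].
      have [u [Wu /= ue]] := ultra_ex2 UU Uw near.
      apply/(eP _ _ (q h + u) gs); first by move: ue; rewrite lt_min => /andP[].
      by move: Wu; rewrite /= linearD -addrA.
    apply: filterS near => u /=; rewrite lt_min => /andP[ue _].
    by rewrite linearD -addrA; apply/(eP _ _ (q h + u) gs).
  have qg : C + `|uh'| + 2 < `|q g|.
    by rewrite ltNge; apply: contra gs => qg; exact: sP.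
  split=> [Uw|Uw].
    have [u [/CP Wu /= ]] := ultra_ex2 UU Uw near; rewrite lt_min => /andP[_ ue].
    exfalso; rewrite linearD -addrA in Wu.
    have := ler_normB (q g + (q h + u)) (q h + u); rewrite addrK.
    have := ler_normB (uh' - (uh' - u')) (u' - (q h + u)).
    have -> : uh' - (uh' - u') - (u' - (q h + u)) = q h + u by module.
    by have := ler_normB uh' (uh' - u'); move: u'uh => /=; lra.
  have [u [/CP Wu /= ue]] := ultra_ex2 UU' Uw (Uc' 1 ltr01).
  exfalso; have := ler_normB (q g + u) u; rewrite addrK.
  by have := ler_normB uh' (uh' - u); rewrite subKr; lra.
exists (p0 - p' + p h) => i; apply/seteqP; split=> x /=.
  move=> [_ [[g [Gg -> Ug] Bx]] <-]; split; last by exists (p' + p g).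
  exists (g + h); split; first exact: latticeD.
    by rewrite linearD; module.
  apply/key => //; have := BM _ Bx; have := ler_normB (p' + p g) p'.
  by rewrite addrAC subrr add0r; lra.
move=> [[g [Gg -> Ug]] [y By yE]].
have Gd : G (g - h) by exact: latticeB.
have yE' : y = p' + p (g - h).
  rewrite linearB -[y](addrK (p0 - p' + p h)) yE; module.
exists y => //; split=> //; exists (g - h); split=> //.
apply/key => //; last by rewrite subrK.
have := BM _ By; rewrite yE' => h1.
by have := ler_normB (p' + p (g - h)) p'; rewrite addrAC subrr add0r; lra.
Qed.

(** Differences of two points have internal part at most [2 C], so only finitely many of them are
    physically short; relative density is [strip_cover] around an interior point of a window. *)
Lemma Lam_Delone U uh p0 : (exists i x, (W i)° x) -> good_ultra U uh ->
  Delone_multiset (Lam U p0).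
Proof.
move=> [i0 [b Wb]] [UU UN Uc].
have UF : ProperFilter U by exact: ultra_proper.
have [C C0 CP] := W_bound; split.
  have [s [sG sP]] := strip_finite 1 (2 * C).
  have [e e0 eP] : exists2 e : R, 0 < e & forall g, g \in s -> p g != 0 -> e <= `|p g|.
    apply: common_radius => [g r r' rr h /h|g gs]; first exact: le_trans.
    have [->|pg] := eqVneq (p g) 0; first by exists 1.
    by exists `|p g|; rewrite ?normr_gt0.
  exists (Num.min e 1); first by rewrite lt_min e0 ltr01.
  move=> _ _ [i _ [g [Gg -> Ug]]] [j _ [h [Gh -> Uh]]] gh.
  have gh' : p0 + p g - (p0 + p h) = p (g - h) by rewrite linearB; module.
  rewrite gh' leNgt; apply/negP; rewrite lt_min => /andP[ge g1].
  have [u [/CP Wgu /CP Whu]] := ultra_ex2 UU Ug Uh.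
  have gs : g - h \in s.
    apply: sP (ltW g1) _; first exact: latticeB.
    have -> : q (g - h) = (q g + u) - (q h + u) by rewrite linearB; module.
    by apply: le_trans (ler_normB _ _) _; lra.
  have pgh : p (g - h) != 0 by rewrite -gh' subr_eq0.
  by have := eP _ gs pgh; rewrite leNgt ge.
have /interior_distP[e e0 eW] := Wb.
have e20 : 0 < e / 2 by rewrite divr_gt0.
have [D DP] := strip_cover (b - uh) e20.
exists (`|D| + 1) => [|x]; first by rewrite ltr_wpDl.
have [g [Gg gD gb]] := DP (x - p0).
exists (p0 + p g); last first.
  by rewrite opprD addrA; apply: le_trans gD _; apply: le_trans (ler_norm _) _; rewrite lerDl.
exists i0 => //; exists g; split=> //.
apply: filterS (Uc _ e20) => u /= ue; apply: eW.
have -> : b - (q g + u) = (b - uh - q g) + (uh - u) by module.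
by apply: le_lt_trans (ler_normD _ _) _; lra.
Qed.

Lemma principal_good s : nonsingular_at s -> good_ultra (principal_filter s) s.
Proof.
move=> ns; split; first exact: principal_filter_ultra.
  exact/principal_filterP.
by move=> e e0; apply/principal_filterP; rewrite /= subrr normr0.
Qed.

Lemma Lam_principal s p0 : Lam (principal_filter s) p0 =
  fun i => [set x | exists g, [/\ G g, x = p0 + p g & W i (q g + s)]].
Proof.
apply/funext => i; apply/seteqP; split=> x [g [Gg xE Wg]]; exists g; split=> //.
  by move/principal_filterP: Wg.
exact/principal_filterP.
Qed.

(* The ultrafilter refines the sequence of internal coordinates of larger and
   larger patches of [Q] found in the model set. *)
Lemma LI_Lam s Q : nonsingular_at s -> (\bigcup_i Q i) !=set0 ->
  LI Q (Lam (principal_filter s) 0) ->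
  exists p0 U uh, good_ultra U uh /\ Q = Lam U p0.
Proof.
rewrite Lam_principal => ns [p0 [i0 _ Qp0]] QLI.
have H (n : nat) : exists gt : E * V, [/\ G gt.1, p0 + gt.2 = p gt.1, W i0 (q gt.1 + s) &
    forall i, [set x + gt.2 | x in Q i `&` [set x | `|p0 - x| <= n%:R]] =
      [set x | exists g, [/\ G g, x = 0 + p g & W i (q g + s)]] `&`
        [set x + gt.2 | x in [set x | `|p0 - x| <= n%:R]]].
  have [|t tP] := QLI [set x | `|p0 - x| <= n%:R].
    exists (`|p0| + n%:R); split; first exact: num_real.
    move=> M MP x /= px; have := ler_normB p0 (p0 - x); rewrite subKr.
    by move: MP; lra.
  have : [set x + t | x in Q i0 `&` [set x | `|p0 - x| <= n%:R]] (p0 + t).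
    by exists p0 => //; split=> //=; rewrite subrr normr0.
  rewrite tP => -[[g [Gg gE Wg]] _].
  by exists (g, t); split=> //=; rewrite gE add0r.
have [gt gtP] := choice H.
(* Seen from the point of the model set that matches [p0], the internal parameter is [u n]; it lies
   in the compact window [W i0], so the ultrafilter has a limit. *)
pose u n := q (gt n).1 + s.
have [U [UU UP]] := @ultraFilterLemma _ (u @ \oo) _.
have UF : ProperFilter U by exact: ultra_proper.
have Wu n : W i0 (u n) by have [] := gtP n.
have UW : U (W i0) by apply: UP; exists 0%N => // n _ /=.
have [uh [Wuh Uuh]] : exists uh, W i0 uh /\ U --> uh.
  have cW : compact (W i0) := @Wc i0.
  rewrite compact_ultra in cW; have [uh [Wuh Uuh]] := cW U UU UW.
  by exists uh.
have Uev (A : set F) N : (forall n, (N <= n)%N -> A (u n)) -> U A.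
  by move=> h; apply: UP; exists N => // n /= Nn; exact: h.
have Uex (A : set F) N : U A -> exists n, (N <= n)%N /\ A (u n).
  move=> UA; have U1 : U [set x | exists n, (N <= n)%N /\ x = u n].
    by apply: (Uev _ N) => n Nn; exists n.
  have [x [Ax [n [Nn xE]]]] := ultra_ex2 UU UA U1.
  by exists n; rewrite -xE.
exists p0, U, uh; split.
  split=> //; last by move=> e e0; apply: Uuh; apply/nbhs_distP; exists e.
  apply: (Uev _ 0%N) => n _ g i Gg; rewrite /u addrA -linearD.
  by apply: ns; apply: latticeD => //; have [] := gtP n.
apply/funext => i; apply/seteqP; split=> x.
  move=> Qx; pose N := (Num.truncn `|p0 - x|).+1.
  have xN n : (N <= n)%N -> `|p0 - x| <= n%:R.
    by move=> Nn; apply: le_trans (ltW (truncnS_gt _)) _; rewrite ler_nat.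
  have st n : (N <= n)%N -> exists g, [/\ G g, x = p0 + p g & W i (q g + u n)].
    move=> Nn; have [Gn pn _ /(_ i)/seteqP[h _]] := gtP n.
    have [|[g [Gg gE Wg]] _] := h (x + (gt n).2); first by exists x => //; split=> //; exact: xN.
    exists (g - (gt n).1); split; first exact: latticeB.
      by rewrite linearB -pn -[x in LHS](addrK (gt n).2) gE; module.
    by rewrite linearB /u addrA subrK.
  have [g [Gg xg _]] := st N (leqnn _).
  exists g; split=> //; apply: (Uev _ N) => n /st[h [Gh xh Wh]] /=.
  suff -> : g = h by [].
  by apply: p_inj2 => //; apply: (addrI p0); rewrite -xg -xh.
move=> [g [Gg xg Ug]].
have [n [Nn Wn]] := Uex _ (Num.truncn `|p g|).+1 Ug.
have [Gn pn _ /(_ i)/seteqP[_ h]] := gtP n.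
have [|y [Qy _] yE] := h (x + (gt n).2).
  split.
    exists (g + (gt n).1); split; first exact: latticeD.
      by rewrite linearD -pn xg; module.
    by move: Wn; rewrite /u /= linearD addrA.
  exists x => //=; rewrite xg opprD addrA subrr sub0r normrN.
  by apply: le_trans (ltW (truncnS_gt _)) _; rewrite ler_nat.
by have <- : y = x by apply: (addIr (gt n).2).
Qed.

End CutProject.

(** * Stable subspaces, eigenfunctionals and dual coordinates *)

Section Stable.
Context (R : fieldType) (V : vectType R).

Lemma stable_inj (f : 'End(V)) (U : {vspace V}) : (forall x, f x = 0 -> x = 0) ->
  (forall x, x \in U -> f x \in U) -> forall x, f x \in U -> x \in U.
Proof.
move=> f0 fU x fx.
have kf : lker f == 0%VS.
  rewrite -subv0; apply/subvP => y; rewrite memv_ker => /eqP/f0 ->; exact: mem0v.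
have UU : (f @: U)%VS = U.
  apply/eqP; rewrite eqEdim limg_dim_eq ?(eqP kf) ?capv0// leqnn andbT.
  by apply/subvP => _ /memv_imgP[y /fU yU ->].
by move: fx; rewrite -{1}UU => /memv_imgP[y yU /(lker0P kf) ->].
Qed.

End Stable.

Section Flags.
Context (R : realType) (F : normedVectType R).

Lemma functional_eigen (phi : 'Hom(F, R^o)) (B : 'End(F)) :
  phi != 0 -> (forall x, phi x = 0 -> phi (B x) = 0) ->
  exists nu : R, forall x, phi (B x) = nu * phi x.
Proof.
move=> /functional_neq0[z z1] h; exists (phi (B z)) => x.
have /h : phi (x - (phi x : R) *: z) = 0 by rewrite functionalB functionalZ z1 mulr1 subrr.
rewrite linearB linearZ /= functionalB functionalZ => /eqP; rewrite subr_eq0 => /eqP ->.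
by rewrite mulrC.
Qed.

(** Redundant functionals are discarded one by one; when none is redundant, each has a vector on
    which it alone is nonzero. *)
Lemma dual_basis (J : Type) (phi : J -> 'Hom(F, R^o)) n (k : 'I_n -> J) :
  (forall w, (forall i, phi (k i) w = 0) -> w = 0) ->
  exists m (k' : 'I_m -> 'I_n) (u : 'I_m -> F),
    (forall i j, phi (k (k' i)) (u j) = (i == j)%:R) /\
    forall x, x = \sum_i (phi (k (k' i)) x : R) *: u i.
Proof.
elim: n k => [|n IH] k k0.
  exists 0%N, id, (fun=> 0); split=> [[]//|x].
  by rewrite big_ord0; apply: k0 => -[].
have [[i ki]|h] := pselect (exists i, forall w, (forall j, phi (k (lift i j)) w = 0) -> w = 0).
  by have [m [k' [u [h1 h2]]]] := IH _ ki; exists m, (lift i \o k'), u.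
have H i : exists u, phi (k i) u = 1 /\ forall j, j != i -> phi (k j) u = 0.
  have [w wP w0] : exists2 w, (forall j, phi (k (lift i j)) w = 0) & w <> 0.
    apply: contrapT => h'; apply: h; exists i => w wP; apply: contrapT => w0.
    by apply: h'; exists w.
  have wP' j : j != i -> phi (k j) w = 0.
    by case: (unliftP i j) => [j' ->|->]; rewrite ?eqxx// => _; exact: wP.
  have phiw : phi (k i) w != 0.
    apply/eqP => phiw; apply: w0; apply: k0 => j.
    by have [->|/wP'] := eqVneq j i.
  exists ((phi (k i) w : R)^-1 *: w); split; first by rewrite functionalZ mulVf.
  by move=> j /wP' e; rewrite functionalZ e mulr0.
have [u uP] := choice H.
exists n.+1, id, u; split=> [i j|x].
  have [<-|ij] := eqVneq i j; first by have [] := uP i.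
  by have [_ ->] := uP j.
apply/eqP; rewrite -subr_eq0; apply/eqP/k0 => i.
rewrite functionalB linear_sum (bigD1 i)//= [X in _ - (_ + X)]big1 => [|j ji].
  by rewrite addr0 functionalZ (uP i).1 mulr1 subrr.
by rewrite functionalZ (uP j).2 ?mulr0// eq_sym.
Qed.

End Flags.

(** * Discreteness against density under a physical contraction *)

Section Contraction.
Context (R : realType) (E V F : normedVectType R).
Context (p : {linear E -> V}) (q : {linear E -> F}) (jv : {linear V -> E}) (jf : {linear F -> E}).
Context (G : set E).
Hypothesis pqE : forall x, x = jv (p x) + jf (q x).
Hypothesis hG : lattice_set G.
Hypothesis q_dense : forall x (e : R), 0 < e -> exists2 g, G g & `|x - q g| < e.
Context (N : 'End(E)) (La : 'End(V)) (B : 'End(F)).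
Hypothesis pN : forall x, p (N x) = La (p x).
Hypothesis qN : forall x, q (N x) = B (q x).
Hypothesis NG : forall g, G g -> G (N g).
Hypothesis N0 : forall x, N x = 0 -> x = 0.
Hypothesis half : forall x, `|La x| <= 2^-1 * `|x|.
Context (n : nat) (f : 'I_n -> 'Hom(F, R^o)) (u : 'I_n -> F) (nu : 'I_n -> R).
Hypothesis fuE : forall x, x = \sum_i (f i x : R) *: u i.
Hypothesis fu : forall i j, f i (u j) = (i == j)%:R.
Hypothesis fB : forall i x, f i (B x) = nu i * f i x.

Lemma half_iter k x : `|iter k La x| <= 2^-1 ^+ k * `|x|.
Proof.
elim: k => [|k IH]; first by rewrite expr0 mul1r.
rewrite iterS exprS -mulrA; apply: le_trans (half _) _.
by rewrite ler_pM2l ?invr_gt0.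
Qed.

Lemma half_iter_small (e : R) x : 0 < e -> exists k, `|iter k La x| < e.
Proof.
move=> e0; have [|K KP] := @geometric_small R 2^-1 `|x| e _ e0.
  by rewrite invr_ge0 ler0n /= invf_lt1// ltr1n.
by exists K; apply: le_lt_trans (half_iter _ _) (KP _ (leqnn _)).
Qed.

Lemma functional_iter i k x : f i (iter k B x) = nu i ^+ k * f i x.
Proof. by elim: k => [|k IH]; rewrite ?expr0 ?mul1r// iterS fB IH exprS mulrA. Qed.

(* Iterating [N] moves [g] arbitrarily close to the span of [s], where
   discreteness of the lattice modulo that span applies. *)
Lemma near_invariant_span (Q : pred 'I_n) (s : seq E) :
  (forall x, x \in s -> G x) ->
  (forall x, x \in << s >>%VS -> N x \in << s >>%VS) ->
  (forall i, Q i -> `|nu i| <= 1) ->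
  (forall i, ~~ Q i -> exists2 y, y \in << s >>%VS & q y = u i) ->
  exists2 e : R, 0 < e & forall g, G g -> (forall i, Q i -> `|f i (q g) : R| < e) ->
    g \in << s >>%VS.
Proof.
move=> sG sN Qnu Qs; have [e0 e00 eP] := lattice_discrete_mod hG sG.
have [K K0 KP] := pq_bound pqE.
have H i : exists y, y \in << s >>%VS /\ (~~ Q i -> q y = u i).
  by have [Qi|/Qs[y ys yE]] := boolP (Q i); [exists 0; rewrite mem0v|exists y].
have [y yP] := choice H.
set D := 1 + \sum_i `|u i|; have D0 : 0 < D by rewrite ltr_pwDl// sumr_ge0.
exists (e0 / (2 * K * D)) => [|g Gg gQ]; first by rewrite divr_gt0// !mulr_gt0.
pose y0 := \sum_(i | ~~ Q i) (f i (q g) : R) *: y i.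
have y0s : y0 \in << s >>%VS by apply: memv_suml => i _; rewrite memvZ// (yP i).1.
have iterS_ k x : x \in << s >>%VS -> iter k N x \in << s >>%VS.
  by elim: k => // k IH xs; rewrite iterS sN// IH.
have fr i : f i (q (g - y0)) = if Q i then f i (q g) else 0.
  have -> : f i (q (g - y0)) = f i (q g) - f i (q y0) :> R.
    by rewrite [q _]linearB functionalB.
  have -> : f i (q y0) = \sum_(j | ~~ Q j) (f j (q g) : R) * (i == j)%:R.
    rewrite /y0 !linear_sum; apply: eq_bigr => j Qj.
    by rewrite linearZ /= (yP j).2// functionalZ fu.
  case: ifPn => Qi.
    rewrite big1 ?subr0// => j Qj.
    by have [ij|_] := eqVneq i j; [rewrite -ij Qi in Qj|rewrite mulr0].
  rewrite (bigD1 i)//= eqxx mulr1 big1 ?addr0 ?subrr// => j /andP[_ ji].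
  by rewrite eq_sym (negPf ji) mulr0.
have [k kP] := @half_iter_small (e0 / (2 * K)) (p (g - y0)) ltac:(by rewrite divr_gt0// mulr_gt0).
have iN m x x' : iter m N (x - x') = iter m N x - iter m N x'.
  by elim: m => // m IH; rewrite !iterS IH linearB.
have close : `|iter k N g - iter k N y0| < e0.
  rewrite -iN; apply: le_lt_trans (KP _) _.
  rewrite (iter_intertwine k pN) (iter_intertwine k qN).
  rewrite -ltr_pdivlMl//; set a := `|_|; set b := `|_|.
  have -> : K^-1 * e0 = e0 / (2 * K) + e0 / (2 * K) by field; rewrite gt_eqF.
  apply: ltr_leD; first exact: kP.
  rewrite /b (fuE (iter k B _)); apply: le_trans (ler_norm_sum _ _ _) _.
  apply: le_trans (_ : e0 / (2 * K * D) * D <= _); last first.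
    by rewrite le_eqVlt; apply/orP; left; apply/eqP; field; rewrite !gt_eqF.
  rewrite [in leRHS]/D mulrDr mulr1 -[leLHS]add0r lerD//.
    by rewrite divr_ge0 ?(ltW e00)// !mulr_ge0// ltW.
  rewrite mulr_sumr; apply: ler_sum => i _; rewrite normrZ ler_wpM2r//.
  rewrite functional_iter fr; case: ifPn => Qi; last first.
    by rewrite mulr0 normr0 divr_ge0 ?(ltW e00)// !mulr_ge0// ltW.
  rewrite normrM normrX; apply: le_trans (ltW (gQ i Qi)); rewrite ler_piMl//.
  by rewrite exprn_ile1// Qnu.
have Ik m x : G x -> G (iter m N x) by elim: m => // m IH Gx; rewrite iterS; apply/NG/IH.
have := eP _ _ (Ik k g Gg) (iterS_ k _ y0s) close.
by elim: (k) => // m IH; rewrite iterS => /(stable_inj N0 sN)/IH.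
Qed.

(** By [near_invariant_span], lattice points whose [Q]-coordinates are small lie in the span, where
    these coordinates vanish; density of the projected lattice provides a point for which one of
    them is small but nonzero. *)
Lemma noncontracting_empty (Q : pred 'I_n) (s : seq E) :
  (forall x, x \in s -> G x) ->
  (forall x, x \in << s >>%VS -> N x \in << s >>%VS) ->
  (forall i, Q i -> `|nu i| <= 1) ->
  (forall i, ~~ Q i -> exists2 y, y \in << s >>%VS & q y = u i) ->
  (forall i y, Q i -> y \in << s >>%VS -> f i (q y) = 0) ->
  forall i, ~~ Q i.
Proof.
move=> sG sN Qnu Qs Q0 i0; apply/negP => Qi0.
have [e e0 eP] := near_invariant_span sG sN Qnu Qs.
have [C C0 CP] : exists2 C : R, 0 < C & forall i x, `|f i x : R| <= C * `|x|.
  have [||C CP] := @common_bound R _ (enum 'I_n) (fun i C => forall x, `|f i x : R| <= C * `|x|).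
  - by move=> j c c' cc hc x; apply: le_trans (hc x) _; rewrite ler_wpM2r.
  - by move=> j _; have [C _ CP] := functional_bound (f j); exists C.
  exists (`|C| + 1) => [|j x]; first by rewrite ltr_wpDl.
  apply: le_trans (CP j (mem_enum _ _) x) _; rewrite ler_wpM2r//.
  by rewrite (le_trans (ler_norm C))// lerDl.
have d0 : 0 < e / 4 / C by rewrite !divr_gt0.
(* With error below [e / 4], the coordinate [i0] lies strictly between [e / 4] and [3 e / 4], and
   the other coordinates stay below [e / 4]. *)
have [g Gg gP] := q_dense ((e / 2) *: u i0) d0.
have fg i : `|e / 2 * (i == i0)%:R - f i (q g)| < e / 4.
  rewrite -fu -functionalZ -functionalB; apply: le_lt_trans (CP _ _) _.
  by rewrite mulrC -ltr_pdivlMr.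
have : g \in << s >>%VS.
  apply: eP => // i _; have := fg i; set a : R := f i (q g).
  have [_|_] := eqVneq i i0; rewrite ?mulr1 ?mulr0 ?sub0r ?normrN; last by lra.
  by rewrite !ltr_norml => /andP[h1 h2]; apply/andP; split; lra.
move=> /(Q0 i0 _ Qi0) h; have := fg i0; rewrite h eqxx mulr1 subr0 gtr0_norm; lra.
Qed.

End Contraction.

Section LatticePowers.
Context (R : realType) (E : normedVectType R) (G : set E) (hG : lattice_set G).
Context (N M : 'End(E)).
Hypothesis NG : forall g, G g -> G (N g).
Hypothesis MG : forall g, G g -> G (M g).
Hypothesis MK : forall x, M (N x) = x.

Lemma lattice_iter (f : 'End(E)) k g : (forall g, G g -> G (f g)) -> G g -> G (iter k f g).
Proof. by move=> fG Gg; elim: k => // k IH; rewrite iterS; exact: fG. Qed.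

(* Pigeonhole on the action of the powers of [N] on the finite group [G / d G]. *)
Lemma lattice_power_congr (d : nat) : (0 < d)%N ->
  exists2 a : nat, (0 < a)%N &
    forall g, G g -> exists2 h, G h & iter a N g - g = d%:R *: h.
Proof.
move=> d0; have [s [sG sP]] := lattice_mod_finite hG d0.
have iN k (x y : E) (r : R) : iter k N (x - r *: y) = iter k N x - r *: iter k N y.
  by rewrite iter_lfunB iter_lfunZ.
have H (k : nat) (i : 'I_(size s)) : exists j : 'I_(size s), exists2 h, G h & iter k N s`_i - s`_j = d%:R *: h.
  have [g' g's [h Gh hE]] := sP _ (lattice_iter k NG (sG _ (mem_nth 0 (ltn_ord i)))).
  have g'i : (index g' s < size s)%N by rewrite index_mem.
  by exists (Ordinal g'i), h => //=; rewrite nth_index.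
have /choice[F FP] : forall k, exists F : {ffun 'I_(size s) -> 'I_(size s)},
    forall i : 'I_(size s), exists2 h, G h & iter k N s`_i - s`_(F i) = d%:R *: h.
  move=> k; have [F0 F0P] := choice (H k).
  by exists [ffun i => F0 i] => i; rewrite ffunE.
pose f (k : 'I_(#|{: {ffun 'I_(size s) -> 'I_(size s)}}|).+1) := F k.
have /injectivePn [i [j ij fij]] : ~~ injectiveb f.
  by apply/negP => /injectiveP /leq_card; rewrite card_ord ltnn.
wlog lij : i j ij fij / (i < j)%N => [Hw|].
  have [/Hw|ji|/ord_inj] := ltngtP i j; [exact| |by move/eqP: ij].
  by apply: (Hw j i); rewrite // eq_sym.
exists (j - i)%N; first by rewrite subn_gt0.
move=> g Gg; have [g' g's [h Gh hE]] := sP g Gg.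
have g'i : (index g' s < size s)%N by rewrite index_mem.
have [hi Ghi hiE] := FP i (Ordinal g'i); have [hj Ghj hjE] := FP j (Ordinal g'i).
rewrite /= nth_index// in hiE hjE; rewrite -/(f i) -/(f j) fij in hiE hjE.
have gE : g' = g - d%:R *: h by rewrite -hE subKr.
set z := s`_(f j _) in hiE hjE.
have eqn : iter j N g - iter i N g =
    d%:R *: (iter j N h - iter i N h + (hj - hi)).
  have e1 : iter j N g = d%:R *: iter j N h + d%:R *: hj + z.
    by rewrite -hjE gE iN; module.
  have e2 : iter i N g = d%:R *: iter i N h + d%:R *: hi + z.
    by rewrite -hiE gE iN; module.
  by rewrite e1 e2; module.
set w := iter j N h - iter i N h + (hj - hi) in eqn.
have Gw : G w.
  by apply: (latticeD hG); apply: (latticeB hG) => //; exact: lattice_iter.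
have MKi k x : iter k M (iter k N x) = x.
  by elim: k x => [//|k IH] x; rewrite iterSr iterS MK IH.
have iM k (x y : E) : iter k M (x - y) = iter k M x - iter k M y.
  by elim: k => // k IH; rewrite !iterS IH linearB.
have iMZ k (x : E) (r : R) : iter k M (r *: x) = r *: iter k M x.
  by elim: k => // k IH; rewrite !iterS IH linearZ.
(* Applying [M^i] cancels the common factor [N^i] and turns a coincidence of two powers into a power
   that is trivial modulo [d]. *)
exists (iter i M w); first exact: lattice_iter.
by rewrite -iMZ -eqn iM MKi -[in RHS](subnKC (ltnW lij)) iterD MKi.
Qed.

End LatticePowers.

(** * Rational FD-invariant windows *)

Section RationalWindow.
Context (R : realType) (E V F : normedVectType R) (l : nat).
Context (p : {linear E -> V}) (q : {linear E -> F}) (jv : {linear V -> E}) (jf : {linear F -> E}).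
Context (G : set E) (W : 'I_l -> set F).
Hypothesis pqE : forall x, x = jv (p x) + jf (q x).
Hypothesis hG : lattice_set G.
Hypothesis q_dense : forall x (e : R), 0 < e -> exists2 g, G g & `|x - q g| < e.
Hypothesis Wc : forall i, compact (W i).
Hypothesis Wreg : forall i, regclosed (W i).
Context (J : finType) (phi : J -> 'Hom(F, R^o)) (c : J -> R).
Hypothesis phi0 : forall j, phi j != 0.
Hypothesis bW : forall i x, boundary (W i) x -> exists j, phi j x = c j.
Hypothesis suppW : forall j, exists i w, supp_at (W i) (phi j) (c j) w.
Context (M N : 'End(E)) (La : 'End(V)) (A B : 'End(F)).
Hypothesis MK : forall x, M (N x) = x.
Hypothesis BK : forall x, A (B x) = x.
Hypothesis pN : forall x, p (N x) = La (p x).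
Hypothesis qN : forall x, q (N x) = B (q x).
Hypothesis NG : forall g, G g -> G (N g).
Hypothesis MG : forall g, G g -> G (M g).
Hypothesis half : forall x, `|La x| <= 2^-1 * `|x|.
Hypothesis BV : forall j x, phi j x = 0 -> phi j (B x) = 0.
Hypothesis AV : forall j x, phi j x = 0 -> phi j (A x) = 0.
Context (d : nat).
Hypothesis d0 : (0 < d)%N.
Hypothesis rat : forall v v', Ver W v -> Ver W v' ->
  exists2 g, G g & v - v' = d%:R^-1 *: q g.

Let dR0 : (d%:R : R) != 0. Proof. by rewrite pnatr_eq0 -lt0n. Qed.

Lemma vertex_on j (psi : 'Hom(F, R^o)) : exists i v, [/\ Ver W v, phi j v = c j &
  (exists w, supp_at (W i) (phi j) (c j) w) /\
  forall w, supp_at (W i) (phi j) (c j) w -> psi w <= psi v].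
Proof.
have [i [w sw]] := suppW j.
have [v [vV vj vmax]] := vertex_exists phi0 (@Wc i) (@bW i) (Wreg i) psi sw.
exists i, v; split=> //; first by exists i.
by split=> //; exists w.
Qed.

(** The vertices that maximise and minimise [psi] over a facet differ by a rational lattice vector
    along the facet, so [psi] takes the same value at both and is constant on the facet; an open
    piece of the hyperplane then forces [psi] to vanish along it. *)
Lemma lattice_functional j (psi : 'Hom(F, R^o)) :
  (forall g, G g -> phi j (q g) = 0 -> psi (q g) = 0) ->
  forall x, phi j x = 0 -> psi x = 0.
Proof.
move=> psi0 x phix; apply/eqP; apply: contrapT => /negP psix.
have [i [w sw]] := suppW j.
have [v [vV vj vmax]] := vertex_exists phi0 (@Wc i) (@bW i) (Wreg i) psi sw.
have [v' [vV' vj' vmin]] := vertex_exists phi0 (@Wc i) (@bW i) (Wreg i) (- psi) sw.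
have [e e0 eP] := supp_at_open sw.
set t := e / (1 + `|x|); have t0 : 0 < t by rewrite divr_gt0// ltr_pwDl.
have tx : `|t *: x| < e.
  by rewrite normrZ gtr0_norm// /t mulrAC ltr_pdivrMr ?ltr_pwDl// ltr_pM2l//; lra.
have phiw : phi j w = c j by case: sw.
have s1 : supp_at (W i) (phi j) (c j) (w + t *: x).
  apply: eP; first by rewrite functionalD functionalZ phix mulr0 addr0.
  by rewrite opprD addrA subrr sub0r normrN.
have s2 : supp_at (W i) (phi j) (c j) (w - t *: x).
  apply: eP; first by rewrite functionalB functionalZ phix mulr0 subr0.
  by rewrite opprB addrC subrK.
have := vmax _ s1; have := vmax _ s2; have := vmin _ s1; have := vmin _ s2.
rewrite !opp_lfunE !functionalB !functionalD !functionalZ.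
have [g Gg gE] := rat (ex_intro2 _ _ i I vV) (ex_intro2 _ _ i I vV').
have qg : q g = d%:R *: (v - v') by rewrite gE scalerA mulfV// scale1r.
have /(psi0 g Gg) : phi j (q g) = 0 by rewrite qg functionalZ functionalB vj vj' subrr mulr0.
rewrite qg functionalZ functionalB => /eqP; rewrite mulf_eq0 (negPf dR0)/= subr_eq0 => /eqP ->.
set a : R := psi v'; set b : R := psi w; move: psix; set z : R := psi x => z0.
rewrite -![- (_ : R^o)]/(- (_ : R)) => h1 h2 h3 h4.
have tz : t * z = 0 by lra.
by move/eqP: tz; rewrite mulf_eq0 (negPf z0) gt_eqF.
Qed.

(** A direction of the hyperplane outside the image of the span would be detected by a functional
    vanishing on all its lattice vectors, against [lattice_functional]. *)
Lemma hyperplane_span j : exists s : seq E,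
  [/\ forall x, x \in s -> G x /\ phi j (q x) = 0,
      forall g, G g -> phi j (q g) = 0 -> g \in << s >>%VS,
      forall y, y \in << s >>%VS -> phi j (q y) = 0 &
      forall x, phi j x = 0 -> exists2 y, y \in << s >>%VS & q y = x].
Proof.
have [s [_ sD sE]] := span_set [set g | G g /\ phi j (q g) = 0].
have s0 y : y \in << s >>%VS -> phi j (q y) = 0.
  move=> /span_coef[r ->]; rewrite linear_sum linear_sum; apply: big1 => i _.
  by rewrite linearZ /= functionalZ (sD _ (mem_nth _ (ltn_ord i))).2 mulr0.
exists s; split=> // [g Gg gj|x phix]; first exact: sE.
have [/memv_imgP[y ys ->]|xU] := boolP (x \in (linfun q @: << s >>)%VS).
  by exists y => //; rewrite lfunE.
have [psi [psix psiU]] := separating_functional xU.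
case/eqP: psix; apply: (@lattice_functional j) phix => g Gg gj.
apply: psiU; rewrite -[q g](lfunE q); apply: memv_img; exact: sE.
Qed.

Lemma N_inj0 x : N x = 0 -> x = 0.
Proof. by move=> /(congr1 M); rewrite MK linear0. Qed.

(** The hyperplanes through a vertex give coordinates that diagonalise [B]. If one eigenvalue had
    modulus at most 1, the lattice vectors spanning the corresponding hyperplane would meet the
    hypotheses of [noncontracting_empty]. *)
Lemma window_flag (j0 : J) : exists n (k : 'I_n -> J) (u : 'I_n -> F) (nu : 'I_n -> R),
  [/\ forall i j, phi (k i) (u j) = (i == j)%:R,
      forall x, x = \sum_i (phi (k i) x : R) *: u i,
      forall i x, phi (k i) (B x) = nu i * phi (k i) x &
      forall i, 1 < `|nu i|].
Proof.
have [i0 [v0 [[i _ vV] _ _]]] := vertex_on j0 0.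
pose k0 (a : 'I_#|[set j | phi j v0 == c j :> R]%SET|) := enum_val a.
have Wcl : closed (W i) by rewrite -(Wreg i); exact: closed_closure.
have k00 w : (forall a, phi (k0 a) w = 0) -> w = 0.
  move=> h; apply: (polytope_vertex_kernel phi0 Wcl (@bW i) (Wreg i) vV) => j vj.
  have jS : j \in [set j | phi j v0 == c j :> R]%SET by rewrite inE; apply/eqP.
  by rewrite -(enum_rankK_in jS jS); exact: h.
have [n [k' [u [fu fuE]]]] := dual_basis k00.
pose k a := k0 (k' a).
have H a : exists nu : R, forall x, phi (k a) (B x) = nu * phi (k a) x.
  exact: functional_eigen (phi0 _) (BV (j := k a)).
have [nu nuP] := choice H.
exists n, k, u, nu; split=> // a; rewrite ltNge; apply/negP => nua.
have [s [sG sD s0 sE]] := hyperplane_span (k a).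
have := @noncontracting_empty R E V F p q jv jf G pqE hG q_dense N La B pN qN NG N_inj0 half
  n (fun b => phi (k b)) u nu fuE fu nuP (pred1 a) s _ _ _ _ _ a.
rewrite /= eqxx => h; suff : ~~ true by []; apply: h => //.
- by move=> x /sG[].
- apply: span_stable => x /sG[Gs sj].
  by apply: sD; [exact: NG|rewrite qN; exact: BV].
- by move=> b /eqP ->.
- move=> b ba; apply: sE; rewrite fu.
  by rewrite eq_sym (negPf ba).
- by move=> b y /eqP -> /s0.
Qed.

Hypothesis AK : forall x, B (A x) = x.
Hypothesis qM : forall x, q (M x) = A (q x).

Lemma internal_contraction (j0 : J) x (e : R) : 0 < e ->
  exists K, forall k, (K <= k)%N -> `|iter k A x| < e.
Proof.
move=> e0; have [n [k [u [nu [fu fuE fB nu1]]]]] := window_flag j0.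
have fA i m y : phi (k i) (iter m A y) = (nu i)^-1 ^+ m * phi (k i) y.
  elim: m => [|m IH]; first by rewrite expr0 mul1r.
  have nu0 : nu i != 0 by rewrite -normr_gt0 (lt_trans ltr01).
  by rewrite iterS -{1}[iter m A y]AK -[A _]BK exprS -mulrA -IH -{2}[iter m A y]AK fB mulKf ?BK.
set D := 1 + \sum_i `|u i|; have D0 : 0 < D by rewrite ltr_pwDl// sumr_ge0.
have [||K KP] := @common_bound R _ (enum 'I_n)
  (fun i K => forall m : nat, K <= m%:R -> `|phi (k i) (iter m A x) : R| < e / D).
- by move=> i K K' KK' h m Km; apply: h; exact: le_trans Km.
- move=> i _; have [||K KP] := @geometric_small R `|(nu i)^-1| `|phi (k i) x : R| (e / D) _ _.
  + by rewrite normr_ge0 normfV invf_lt1 ?nu1// (lt_trans ltr01).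
  + by rewrite divr_gt0.
  exists K%:R => m; rewrite ler_nat fA normrM normrX; exact: KP.
exists (Num.truncn `|K|).+1 => m mK.
have Km : K <= m%:R.
  apply: le_trans (ler_norm K) _; apply: le_trans (ltW (truncnS_gt _)) _.
  by rewrite ler_nat.
rewrite (fuE (iter m A x)); apply: le_lt_trans (ler_norm_sum _ _ _) _.
apply: le_lt_trans (_ : e / D * \sum_i `|u i| < e).
  rewrite mulr_sumr; apply: ler_sum => i _; rewrite normrZ ler_wpM2r//.
  by apply/ltW/KP; rewrite ?mem_enum.
by rewrite mulrAC ltr_pdivrMr// ltr_pM2l// /D ltrDr.
Qed.

(** Lattice vectors span the hyperplane direction, and [A^k] shrinks them to arbitrarily short
    vectors that are still in the projected lattice; rounding coefficients with respect to these
    gives density. *)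
Lemma hyperplane_dense j x (e : R) : phi j x = 0 -> 0 < e ->
  exists g, [/\ G g, phi j (q g) = 0 & `|x - q g| < e].
Proof.
move=> phix e0; have [s [sG sD s0 sE]] := hyperplane_span j.
set n := size s; set e' := e / n.+1%:R.
have e'0 : 0 < e' by rewrite divr_gt0.
have [k kP] : exists k, forall i : 'I_n, `|iter k A (q s`_i)| < e'.
  have H (i : 'I_n) := internal_contraction j (q s`_i) e'0.
  have [K KP] := choice H; exists (\max_i K i) => i; apply: KP; exact: leq_bigmax.
have BVk y m : phi j y = 0 -> phi j (iter m B y) = 0 by elim: m => // m IH /IH; exact: BV.
have AVk y m : phi j y = 0 -> phi j (iter m A y) = 0 by elim: m => // m IH /IH; exact: AV.
have [y ys yE] := sE _ (BVk x k phix).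
have [r rE] := span_coef ys.
have xE : x = \sum_(i < n) r i *: iter k A (q s`_i).
  rewrite -iter_lfun_sum -(iter_cancel k BK x) -yE rE linear_sum; congr (iter _ _ _).
  by apply: eq_bigr => i _; rewrite linearZ.
have qMk m z : q (iter m M z) = iter m A (q z) by elim: m => // m IH; rewrite !iterS qM IH.
have sGk (i : 'I_n) : G (iter k M s`_i).
  by apply: lattice_iter => //; apply: (sG _ (mem_nth 0 (ltn_ord i))).1.
exists (\sum_(i < n) iter k M s`_i *~ Num.floor (r i)); split.
- by apply: (lattice_sum hG) => i _; exact/(latticeMz hG).
- rewrite linear_sum linear_sum; apply: big1 => i _.
  rewrite -scaler_int linearZ /= functionalZ qMk AVk ?mulr0//.
  by apply: (sG _ (mem_nth 0 (ltn_ord i))).2.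
rewrite {1}xE linear_sum -sumrB; apply: le_lt_trans (ler_norm_sum _ _ _) _.
apply: le_lt_trans (_ : \sum_(i < n) e' < e).
  apply: ler_sum => i _; rewrite -scaler_int linearZ /= qMk -scalerBl normrZ.
  apply: le_trans (ltW (kP i)); rewrite ger0_norm ?subr_ge0 ?ge_floor// ler_piMl//.
  by have := floorD1_gt (r i); rewrite intrD1; lra.
rewrite sumr_const card_ord -mulr_natr /e' mulrAC ltr_pdivrMr// ltr_pM2l//.
by rewrite ltr_nat.
Qed.

(* The affine map [x |-> B^a (x - v0) + v0] fixes a vertex and, since the
   vertices differ by elements of [d^-1 G_<], maps every hyperplane of the
   window to a [G_<]-translate of itself. *)
Lemma window_similarity (j0 : J) : exists2 a : nat, (0 < a)%N & exists t0 : F,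
  forall j, exists kappa nu, [/\ G kappa, nu != 0 &
    forall x, phi j (iter a B x + t0 + q kappa) - c j = nu * (phi j x - c j)].
Proof.
have [i0 [v0 [vV0 _ _]]] := vertex_on j0 0.
have [a a0 aP] := lattice_power_congr hG NG MG MK d0.
exists a => //; exists (v0 - iter a B v0) => j.
have [i [v [vV vj _]]] := vertex_on j 0.
have [g Gg gE] := rat vV vV0.
have [h Gh hE] := aP g Gg.
have [nu nuP] := functional_eigen (phi0 j) (BV (j := j)).
have nu0 : nu != 0.
  have [z z1] := functional_neq0 (phi0 j).
  apply/eqP => nu0; have := nuP (A z); rewrite AK z1 nu0 mul0r.
  by move/eqP; rewrite oner_eq0.
(* By the choice of [a], [q h] is [(B^a - 1) (v - v0)]; subtracting it moves the fixed point from
   [v0] to [v], a point of the hyperplane [j]. *)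
exists (- h), (nu ^+ a); split; [exact: latticeN|exact: expf_neq0|].
move=> x.
have qh : q h = iter a B (v - v0) - (v - v0).
  have : q (d%:R *: h) = q (iter a N g - g) by rewrite hE.
  rewrite linearZ linearB /= (iter_intertwine _ qN) => e; rewrite gE iter_lfunZ -scalerBr -e scalerA mulVf ?scale1r//.
have -> : iter a B x + (v0 - iter a B v0) + q (- h) = iter a B (x - v) + v.
  by rewrite linearN /= qh !iter_lfunB; module.
have nuk m y : phi j (iter m B y) = nu ^+ m * phi j y.
  by elim: m => [|m IH]; rewrite ?expr0 ?mul1r// iterS nuP IH exprS mulrA.
by rewrite functionalD nuk vj functionalB vj addrK.
Qed.

End RationalWindow.

Lemma ultra_fmap (T T' : Type) (f : T -> T') (U : set_system T) :
  UltraFilter U -> UltraFilter (f @ U).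
Proof.
move=> UU; have UF : ProperFilter U by exact: ultra_proper.
apply: Build_UltraFilter => H HF UH; apply/seteqP; split=> A; last exact: UH.
move=> HA; have [//|UA] := in_ultra_setVsetC (f @^-1` A) UU.
have HnA : H (~` A) by apply: UH.
by have [x []] := filter_ex (filterI HA HnA).
Qed.

Section Clusters.
Context (R : realType) (V : normedVectType R) (l : nat).
Implicit Types P : 'I_l -> set V.

Lemma cluster_atE P x c i z : cluster_at P x c i z <-> P i (x + z) /\ `|z| <= c.
Proof.
split=> [[y [Py yc] <-]|[Px zc]].
  by rewrite addrC subrK -normrN opprB.
exists (x + z); last by rewrite addrAC subrr add0r.
by split=> //=; rewrite /closed_ball_ /= opprD addrA subrr sub0r normrN.
Qed.

Lemma cluster_at0 P x y :
  (forall i, P i x <-> P i y) <-> cluster_at P x 0 = cluster_at P y 0.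
Proof.
split=> [h|h i].
  apply/funext => i; apply/seteqP; split=> z /cluster_atE[].
    by rewrite normr_le0 => Pz /eqP z0; move: Pz; rewrite z0 addr0 => /h Pz; apply/cluster_atE; rewrite addr0 normr0.
  by rewrite normr_le0 => Pz /eqP z0; move: Pz; rewrite z0 addr0 => /h Pz; apply/cluster_atE; rewrite addr0 normr0.
have e z : P i z <-> cluster_at P z 0 i 0 by rewrite cluster_atE addr0 normr0; split=> [//|[]].
by rewrite !e h.
Qed.

End Clusters.

(** * Local derivability from the substituted pattern *)

Section Substitution.
Context (R : realType) (E V F : normedVectType R) (l : nat).
Context (p : {linear E -> V}) (q : {linear E -> F}) (jv : {linear V -> E}) (jf : {linear F -> E}).
Context (G : set E) (W : 'I_l -> set F).
Hypothesis pqE : forall x, x = jv (p x) + jf (q x).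
Hypothesis pjv : forall a, p (jv a) = a.
Hypothesis qjv : forall a, q (jv a) = 0.
Hypothesis hG : lattice_set G.
Hypothesis p_inj : forall g, G g -> p g = 0 -> g = 0.
Hypothesis q_dense : forall x (e : R), 0 < e -> exists2 g, G g & `|x - q g| < e.
Hypothesis Wc : forall i, compact (W i).
Hypothesis Wreg : forall i, regclosed (W i).
Hypothesis Wint : exists i x, (W i)° x.
Context (J : finType) (phi : J -> 'Hom(F, R^o)) (c : J -> R).
Hypothesis bW : forall i x, boundary (W i) x -> exists j, phi j x = c j.
Hypothesis suppW : forall j, exists i w, supp_at (W i) (phi j) (c j) w.
Hypothesis phi_dense : forall j x (e : R), phi j x = 0 -> 0 < e ->
  exists g, [/\ G g, phi j (q g) = 0 & `|x - q g| < e].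
Context (M N : 'End(E)) (L La : 'End(V)) (A B : 'End(F)).
Hypothesis MK : forall x, M (N x) = x.
Hypothesis NK : forall x, N (M x) = x.
Hypothesis LK : forall x, L (La x) = x.
Hypothesis BK : forall x, A (B x) = x.
Hypothesis AK : forall x, B (A x) = x.
Hypothesis pM : forall x, p (M x) = L (p x).
Hypothesis qN : forall x, q (N x) = B (q x).
Hypothesis NG : forall g, G g -> G (N g).
Hypothesis MG : forall g, G g -> G (M g).
Context (t0 : F).
Hypothesis similar : forall j, exists kappa nu, [/\ G kappa, nu != 0 &
    forall x, phi j (B x + t0 + q kappa) - c j = nu * (phi j x - c j)].

Let tau x := B x + t0.
Let ns := @nonsingular_at R E F l q G W.

(** Density of lattice vectors along the hyperplane would move a point of it onto a facet, that is,
    onto a window boundary. Nonsingular parameters thus avoid the whole hyperplanes. *)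
Lemma nonsingular_off g u j : ns u -> G g -> phi j (q g + u) != c j.
Proof.
move=> nsu Gg; apply/eqP => phig.
have [i [w sw]] := suppW j; have [e e0 eP] := supp_at_open sw.
have phiw : phi j w = c j by case: sw.
have [|g' [Gg' phig' g'w]] := @phi_dense j (w - (q g + u)) e _ e0.
  by rewrite functionalB phiw phig subrr.
apply: (nsu (g' + g) i); first exact: latticeD.
have -> : q (g' + g) + u = q g' + (q g + u) by rewrite linearD; module.
apply: supp_at_boundary (eP _ _ _).
  by rewrite functionalD phig' phig add0r.
by have -> : w - (q g' + (q g + u)) = w - (q g + u) - q g' by module.
Qed.

Lemma nonsingular_tau u : ns u -> ns (tau u).
Proof.
move=> nsu g i Gg /bW[j phig].
have [kappa [nu [Gk nu0 kE]]] := similar j.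
have := kE (q (M g) - q (M kappa) + u).
have -> : B (q (M g) - q (M kappa) + u) + t0 + q kappa = q g + tau u.
  by rewrite linearD linearB /= -!qN !NK /tau; module.
rewrite phig subrr => /esym/eqP; rewrite mulf_eq0 (negPf nu0)/= subr_eq0.
by rewrite -linearB; apply/negP; apply: nonsingular_off => //; apply: latticeB => //; exact: MG.
Qed.

Let Cb : exists2 C : R, 0 < C & forall x, `|B x| <= C * `|x|.
Proof. exact: lin_bound. Qed.

Let tauB x y : tau x - tau y = B (x - y).
Proof. by rewrite linearB /tau; module. Qed.

Let tau_surj y : exists x, tau x = y.
Proof. by exists (A (y - t0)); rewrite /tau AK subrK. Qed.

(** Every point of the pattern has a point of the substituted pattern at bounded distance; this is
    what later locates [y] on the projected lattice. *)
Lemma approach_bounded i : exists c1 : R, forall z, W i z ->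
  exists g j, [/\ G g, `|g| <= c1 & W j (tau (z + q g))].
Proof.
have [j [b /interior_distP[e e0 eW]]] := Wint.
have [C C0 CP] := Cb; have [x xb] := tau_surj b.
apply: (@compact_cover_scale R F (W i) (fun c1 z => exists g j, [/\ G g, `|g| <= c1 & W j (tau (z + q g))])).
- exact: Wc.
- by move=> c1 c1' z cc [g [j' [Gg gc Wg]]]; exists g, j'; split=> //; exact: le_trans cc.
move=> a _; have d0 : 0 < e / (2 * C) by rewrite divr_gt0// mulr_gt0.
have [g Gg gP] := q_dense (x - a) d0.
exists (e / (2 * C)) => //; exists `|g| => z az; exists g, j; split=> //.
apply: eW; rewrite -xb tauB; apply: le_lt_trans (CP _) _.
rewrite mulrC -ltr_pdivlMr//.
have -> : x - (z + q g) = (x - a - q g) + (a - z) by module.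
apply: le_lt_trans (ler_normD _ _) _.
have -> : e / C = e / (2 * C) + e / (2 * C) by field; rewrite gt_eqF.
exact: ltrD.
Qed.

(** Take [psi] positive on [B (a' - a)] and an interior point [y] of a window where [psi] is almost
    maximal: then [y + B (a' - a)] leaves the window. A lattice vector brings [tau a] close to
    [y]. *)
Lemma separate_translates a a' : a != a' -> exists g j, G g /\ exists2 r : R, 0 < r &
  forall z z', `|a - z| < r -> `|a' - z'| < r ->
    W j (tau (z + q g)) /\ ~ W j (tau (z' + q g)).
Proof.
move=> aa'; have [j [b0 Wb0]] := Wint; have [C C0 CP] := Cb.
set w := B (a' - a).
have w0 : w \notin 0%VS.
  rewrite memv0; apply/eqP => /(congr1 A); rewrite BK linear0 => /eqP.
  by rewrite subr_eq0 eq_sym; exact/negP.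
have [psi [psiw _]] := separating_functional w0.
wlog psi_gt0 : psi psiw / 0 < (psi w : R) => [Hw|].
  have [h|h|h] := ltrgt0P (psi w : R); [exact: (Hw psi)| |by rewrite h eqxx in psiw].
  by apply: (Hw (- psi)); rewrite opp_lfunE ?oppr_eq0// oppr_gt0.
have psic : continuous (psi : F -> R) by exact: (@lin_continuous R F R^o).
have [||y0 /set_mem Wy0 y0P] := compact_EVT_max _ (@Wc j) (f := psi : F -> R).
- by exists b0; exact: interior_subset.
- exact: continuous_subspaceT.
have [D D0 DP] := functional_bound psi.
have dpos : 0 < psi w / D by rewrite divr_gt0.
have [y Wy y0y] := regclosed_approx (Wreg j) Wy0 dpos.
have nWy : ~ W j (y + w).
  move=> /mem_set /y0P; rewrite functionalD => h.
  have := DP (y0 - y); rewrite functionalB => h1.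
  have : D * `|y0 - y| < psi w by rewrite mulrC -ltr_pdivlMr.
  have := ler_norm (psi y0 - psi y : R).
  by move: h h1; set t1 : R := psi y; set t2 : R := psi w; set t3 : R := psi y0; lra.
have Wcl : closed (W j) by rewrite -(Wreg j); exact: closed_closure.
have /interior_distP[e1 e10 e1P] := Wy.
have [e2 e20 e2P] := not_closed_dist Wcl nWy.
set e := Num.min e1 e2; have e0 : 0 < e by rewrite lt_min e10.
have [x xy] := tau_surj y.
have d0 : 0 < e / (2 * C) by rewrite divr_gt0// mulr_gt0.
have [g Gg gP] := q_dense (x - a) d0.
exists g, j; split=> //; exists (e / (2 * C)) => // z z' az az'.
have small v : `|v| < e / (2 * C) -> `|B (x - a - q g + v)| < e.
  move=> vd; apply: le_lt_trans (CP _) _; rewrite mulrC -ltr_pdivlMr//.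
  apply: le_lt_trans (ler_normD _ _) _.
  have -> : e / C = e / (2 * C) + e / (2 * C) by field; rewrite gt_eqF.
  exact: ltrD.
split.
  apply: e1P; rewrite -xy tauB.
  have -> : x - (z + q g) = (x - a - q g) + (a - z) by module.
  by apply: lt_le_trans (small _ az) _; rewrite /e ge_min lexx.
apply: e2P.
have -> : y + w - tau (z' + q g) = B (x - a - q g + (a' - z')).
  rewrite -xy addrAC tauB /w -linearD; congr (B _); module.
by apply: lt_le_trans (small _ az') _; rewrite /e ge_min lexx orbT.
Qed.

Let same_status (c1 : R) z z' := forall g j, G g -> `|g| <= c1 ->
  W j (tau (z + q g)) <-> W j (tau (z' + q g)).
Let off z := forall j, phi j z != c j.

(** For a hyperplane through [a], the lattice vector [M (kappa + g)] makes [tau] carry [a] next to a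
    facet point [w] of the same hyperplane, where membership in the window is exactly the sign of
    [nu (phi j z - c j)]. *)
Lemma separate_sides a : exists2 r : R, 0 < r & exists c1 : R, forall z z',
  `|a - z| < r -> `|a - z'| < r -> off z -> off z' -> same_status c1 z z' ->
  same_side phi c a z z'.
Proof.
have H j : exists gr : E * R, [/\ 0 < gr.2, G gr.1 & phi j a = c j ->
    forall z z', `|a - z| < gr.2 -> `|a - z'| < gr.2 -> off z -> off z' ->
    (forall i, W i (tau (z + q gr.1)) <-> W i (tau (z' + q gr.1))) ->
    0 < (phi j z - c j) * (phi j z' - c j)].
  have [phia|phia] := eqVneq (phi j a : R) (c j); last first.
    exists (0, 1); split=> //; first exact: lattice0.
    by move=> h; rewrite h eqxx in phia.
  have [kappa [nu [Gk nu0 kE]]] := similar j.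
  have [i [w [_ phiw [e e0 eP]]]] := suppW j.
  have [C C0 CP] := Cb.
  have phik : phi j (tau a + q kappa) = c j.
    by apply/eqP; rewrite -subr_eq0 kE phia subrr mulr0.
  have [||g [Gg phig gw]] := @phi_dense j (w - (tau a + q kappa)) (e / 2) _ _.
  - by rewrite functionalB phiw phik subrr.
  - by rewrite divr_gt0.
  exists (M (kappa + g), e / (2 * C)); split=> //=.
  - by rewrite divr_gt0// mulr_gt0.
  - by apply: MG; exact: latticeD.
  have tauE z : tau (z + q (M (kappa + g))) = tau z + q kappa + q g.
    by rewrite /tau linearD /= -qN NK linearD; module.
  have st z : `|a - z| < e / (2 * C) ->
      W i (tau (z + q (M (kappa + g)))) <-> 0 <= nu * (phi j z - c j).
    move=> az; rewrite tauE eP.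
      rewrite functionalD phig addr0 -kE subr_ge0.
      by rewrite /tau.
    have -> : w - (tau z + q kappa + q g) =
        (w - (tau a + q kappa) - q g) + (tau a - tau z) by module.
    apply: le_lt_trans (ler_normD _ _) _; rewrite tauB.
    have : `|B (a - z)| < e / 2.
      apply: le_lt_trans (CP _) _; rewrite mulrC -ltr_pdivlMr//.
      by rewrite -mulrA -invfM.
    lra.
  move=> _ z z' az az' oz oz' /(_ i); rewrite !st//.
  have h1 : phi j z - c j != 0 by rewrite subr_eq0 oz.
  have h2 : phi j z' - c j != 0 by rewrite subr_eq0 oz'.
  set x1 := phi j z - c j in h1 *; set x2 := phi j z' - c j in h2 *.
  move=> h; suff : 0 < (nu * x1) * (nu * x2).
    by rewrite mulrACA pmulr_rgt0// -expr2 exprn_even_gt0//= nu0.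
  have [h3|h3|h3] := ltrgt0P (nu * x1).
  - by rewrite pmulr_rgt0// lt_neqAle eq_sym mulf_neq0//=; apply/h/ltW.
  - rewrite nmulr_rgt0// ltNge; apply/negP => /h; rewrite leNgt h3//.
  - by move/eqP: h3; rewrite mulf_eq0 (negPf nu0) (negPf h1).
have [gr grP] := choice H.
have [||r r0 rP] := @common_radius R _ (enum J) (fun j r => r <= (gr j).2).
- by move=> j e e' ee; exact: le_trans.
- by move=> j _; exists (gr j).2 => //; have [] := grP j.
have [||c1 c1P] := @common_bound R _ (enum J) (fun j c1 => `|(gr j).1| <= c1).
- by move=> j e e' ee h; exact: le_trans ee.
- by move=> j _; exists `|(gr j).1|.
exists r => //; exists c1 => z z' az az' oz oz' st j phia.
have [_ Gg grj] := grP j; apply: grj => //.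
- by apply: lt_le_trans az _; apply: rP; rewrite mem_enum.
- by apply: lt_le_trans az' _; apply: rP; rewrite mem_enum.
- by move=> i; apply: st => //; apply: c1P; rewrite mem_enum.
Qed.

(* Compactness: a failure of the conclusion would accumulate at a pair of points
   [(a, a')]; if [a != a'] some translate of the window separates them, and if
   [a = a'] the translated hyperplanes through [a] do. *)
Lemma window_decoding i (R1 : R) : exists c1 : R, forall z z', W i z -> `|z'| <= R1 ->
  off z -> off z' -> same_status c1 z z' -> W i z'.
Proof.
have Kc : compact (W i `*` [set z' : F | `|0 - z'| <= R1]).
  apply: compact_setX; first exact: Wc.
  apply: (@bounded_closed_compactV _ _ _ R1); last exact: closed_ballP.
  by move=> x /=; rewrite sub0r normrN.
have [||c1 c1P] := @compact_cover_scale R (F * F)%type _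
   (fun c1 zz => off zz.1 -> off zz.2 -> same_status c1 zz.1 zz.2 -> W i zz.1 -> W i zz.2) Kc.
- move=> c1 c1' zz cc h o1 o2 st; apply: h => // g j Gg gc.
  by apply: st => //; exact: le_trans cc.
- move=> [a a'] _.
  have norm1 b (zz : F * F) (e : R) : `|(a, b) - zz| < e -> `|a - zz.1| < e /\ `|b - zz.2| < e.
    by rewrite prod_normE /= gt_max => /andP[].
  have [<-|aa'] := eqVneq a a'; last first.
    have [g [j [Gg [r r0 rP]]]] := separate_translates aa'.
    exists r => //; exists `|g| => zz /norm1[z1 z2] _ _ st.
    by have [h1 h2] := rP _ _ z1 z2; move/(st g j Gg (lexx _)) : h1.
  have [r r0 [c1 rP]] := separate_sides a.
  have Wcl : closed (W i) by rewrite -(Wreg i); exact: closed_closure.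
  have [e e0 eP] := local_same_side Wcl (@bW i) a.
  exists (Num.min r e); first by rewrite lt_min r0.
  exists c1 => zz /norm1[]; rewrite !lt_min => /andP[z1 z1'] /andP[z2 z2'] o1 o2 st.
  by apply: eP => //; apply: rP.
exists c1 => z z' Wz z'R o1 o2 st.
by apply: (c1P (z, z')) => //; split=> //=; rewrite sub0r normrN.
Qed.

(** Pushing the ultrafilter forward by [tau] and the base point by [La] gives the predecessor. Its
    [L]-image lives on the same physical points [p0 + p g], with windows tested at
    [tau (q g + u)]. *)
Lemma Lam_substitution U uh p0 : @good_ultra R E F l q G W U uh ->
  exists P', [/\ Delone_multiset P', LI P' (Lam p q G W U p0) &
                 LD (fun i => L @` P' i) (Lam p q G W U p0)].
Proof.
move=> Ugood; have [UU UN Uc] := Ugood.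
have UF : ProperFilter U by exact: ultra_proper.
pose U' := tau @ U; have UU' : UltraFilter U' by exact: ultra_fmap.
have [C C0 CP] := Cb.
have U'good : @good_ultra R E F l q G W U' (tau uh).
  split=> //.
    suff : U (tau @^-1` ns) by [].
    by apply: filterS UN => u; exact: nonsingular_tau.
  move=> e e0; have d0 : 0 < e / C by rewrite divr_gt0.
  suff : U (tau @^-1` [set u | `|tau uh - u| < e]) by [].
  apply: filterS (Uc _ d0) => u /= ue; rewrite tauB; apply: le_lt_trans (CP _) _.
  by rewrite mulrC -ltr_pdivlMr.
set P := Lam p q G W U p0; pose P' := Lam p q G W U' (La p0).
have P'E i y : (L @` P' i) y <->
    exists g, [/\ G g, y = p0 + p g & U [set u | W i (tau (q g + u))]].
  have tE g u : q g + tau u = tau (q (M g) + u).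
    by rewrite /tau linearD /= -qN NK; module.
  split=> [[_ [g [Gg -> Ug]] <-]|[g [Gg -> Ug]]].
    exists (M g); split; [exact: MG|by rewrite [L _]linearD /= LK pM|].
    have {}Ug : U [set u | W i (q g + tau u)] by [].
    by apply: filterS Ug => u /=; rewrite tE.
  exists (La p0 + p (N g)); last by rewrite [L _]linearD /= LK -pM MK.
  exists (N g); split=> //; first exact: NG.
  suff : U [set u | W i (q (N g) + tau u)] by [].
  by apply: filterS Ug => u /=; rewrite tE MK.
exists P'; split.
- exact: (Lam_Delone pjv qjv pqE hG q_dense Wc _ Wint U'good).
- exact: (Lam_LI pqE hG q_dense Wc _ _ Ugood U'good).
have [c1 c1P] : exists c1 : R, forall i z, W i z ->
    exists g j, [/\ G g, `|g| <= c1 & W j (tau (z + q g))].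
  have [||c1 c1P] := @common_bound R _ (enum 'I_l) (fun i c1 => forall z, W i z ->
    exists g j, [/\ G g, `|g| <= c1 & W j (tau (z + q g))]).
  - move=> i c1 c1' cc h z /h[g [j [Gg gc Wg]]]; exists g, j; split=> //.
    exact: le_trans cc.
  - by move=> i _; exact: approach_bounded.
  by exists c1 => i; apply: c1P; rewrite mem_enum.
have [D D0 DP] := W_bound Wc.
have [Cq Cq0 CqP] := lin_bound q; have [Cp Cp0 CpP] := lin_bound p.
have [CA CA0 CAP] := lin_bound A.
(* Decoding by compactness needs the second point in a bounded region; it is there as soon as one
   [tau (z' + q h)] with [h] bounded by [c1] lies in a window. *)
pose R1 := CA * (D + `|t0|) + Cq * `|c1|.
have R1P z g j : `|g| <= c1 -> W j (tau (z + q g)) -> `|z| <= R1.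
  move=> gc /DP h.
  have zE : z = A (tau (z + q g) - t0) - q g by rewrite /tau addrK BK addrK.
  rewrite zE; apply: le_trans (ler_normB _ _) _; apply: lerD.
    apply: le_trans (CAP _) _; rewrite ler_pM2l//.
    by apply: le_trans (ler_normB _ _) _; rewrite lerD2r.
  apply: le_trans (CqP _) _; rewrite ler_pM2l//.
  exact: le_trans gc (ler_norm _).
have [c2 c2P] : exists c2 : R, forall i z z', W i z -> `|z'| <= R1 ->
    off z -> off z' -> same_status c2 z z' -> W i z'.
  have [||c2 c2P] := @common_bound R _ (enum 'I_l) (fun i c2 => forall z z',
    W i z -> `|z'| <= R1 -> off z -> off z' -> same_status c2 z z' -> W i z').
  - move=> i c2 c2' cc h z z' Wz zR o1 o2 st; apply: (h z) => // g j Gg gc.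
    by apply: st => //; exact: le_trans cc.
  - by move=> i _; exact: window_decoding.
  by exists c2 => i; apply: c2P; rewrite mem_enum.
set cm := `|c1| + `|c2|.
have cm0 : 0 <= cm by rewrite addr_ge0.
have [s sP] := lattice_finite hG cm.
(* Lattice vectors of norm at most [cm] have their physical part within this radius, so the cluster
   records all statuses used for decoding. *)
exists (Cp * cm); first by rewrite mulr_ge0// ltW.
suff key x y : cluster_at (fun i => L @` P' i) x (Cp * cm) =
    cluster_at (fun i => L @` P' i) y (Cp * cm) -> forall i, P i x -> P i y.
  by move=> x y xy; apply/cluster_at0 => i; split; apply: key.
move=> xy i [g [Gg xE Ug]].
have st h j : G h -> `|h| <= cm ->
    (L @` P' j) (x + p h) <-> (L @` P' j) (y + p h).
  move=> Gh hc; have hp : `|p h| <= Cp * cm by apply: le_trans (CpP _) _; rewrite ler_pM2l.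
  have e z : (L @` P' j) (z + p h) <->
      cluster_at (fun i => L @` P' i) z (Cp * cm) j (p h).
    by rewrite cluster_atE; split=> [|[]].
  by rewrite !e xy.
have P'x g0 h j : G g0 -> G h ->
    (L @` P' j) (p0 + p g0 + p h) <-> U [set u | W j (tau (q g0 + u + q h))].
  move=> Gg0 Gh; rewrite P'E.
  have e u : q g0 + u + q h = q (g0 + h) + u by rewrite linearD; module.
  split=> [[g' [Gg' gE Ug']]|Ug'].
    have gg' : g0 + h = g'.
      apply: (p_inj2 hG p_inj) => //; first exact: latticeD.
      by apply: (addrI p0); rewrite linearD addrA.
    by apply: filterS Ug' => u /=; rewrite e gg'.
  exists (g0 + h); split; [exact: latticeD|by rewrite linearD addrA|].
  by apply: filterS Ug' => u /=; rewrite e.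
have UP g0 j : G g0 -> P j (p0 + p g0) -> U [set u | W j (q g0 + u)].
  move=> Gg0 [g' [Gg' gE Ug']].
  have -> // : g0 = g' by apply: (p_inj2 hG p_inj) => //; exact: (addrI p0).
have offU g0 u : ns u -> G g0 -> off (q g0 + u) by move=> nsu Gg0 j; exact: nonsingular_off.
have sc (h : E) : `|h| <= c1 -> `|h| <= cm.
  by move=> hc; rewrite /cm; apply: le_trans hc _; apply: le_trans (ler_norm _) _; rewrite lerDl.
have [u1 [nsu1 Wu1] u1P] := @ultra_realize _ U _ _ (allpairs pair s (enum 'I_l))
  (fun z => [set u | W z.2 (tau (q g + u + q z.1))]) UU (filterI UN Ug).
have [h1 [j1 [Gh1 h1c Wh1]]] := c1P _ _ Wu1.
have h1s : h1 \in s by apply: sP => //; exact: sc.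
have Uh1 : U [set u | W j1 (tau (q g + u + q h1))].
  apply/(u1P (h1, j1)) => //=.
  by apply/allpairsP; exists (h1, j1); rewrite /= mem_enum.
(* This nearby point of the substituted pattern also occurs at [y], which places [y] in
   [p0 + p G]. *)
have Lx1 : (L @` P' j1) (x + p h1) by rewrite xE; apply/P'x.
have Ly1 := (iffLR (st h1 j1 Gh1 (sc _ h1c)) Lx1).
have [g' Gg' yg'] : exists2 g', G g' & y = p0 + p g'.
  move/P'E : (Ly1) => [g2 [Gg2 yE _]]; exists (g2 - h1); first exact: latticeB.
  by rewrite linearB -[y](addrK (p h1)) yE; module.
suff Ug'W : U [set u | W i (q g' + u)] by exists g'.
(* If membership failed at [g'], a single nonsingular [u] would realise this failure, the membership
   at [g] and all the recorded statuses, against decoding. *)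
have [//|nUg'] := in_ultra_setVsetC [set u | W i (q g' + u)] UU; exfalso.
have [u [nsu [Wu nWu]] uP] := @ultra_realize _ U _ _
  (allpairs pair (allpairs pair s [:: g; g']) (enum 'I_l))
  (fun z => [set u | W z.2 (tau (q z.1.2 + u + q z.1.1))]) UU (filterI UN (filterI Ug nUg')).
have {}uP h g0 j : G h -> `|h| <= cm -> g0 \in [:: g; g'] ->
    W j (tau (q g0 + u + q h)) <-> (L @` P' j) (p0 + p g0 + p h).
  move=> Gh hc g0g.
  have Gg0 : G g0 by move: g0g; rewrite !inE => /orP[] /eqP ->.
  rewrite P'x//; apply: (uP (h, g0, j)); apply: allpairs_f; last by rewrite mem_enum.
  by apply: allpairs_f => //; exact: sP.
apply: nWu; apply: (c2P i (q g + u)) => //.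
- apply: (R1P _ h1 j1 h1c); apply/uP => //; [exact: sc|by rewrite !inE eqxx orbT|].
  by rewrite -yg'.
- exact: offU.
- exact: offU.
move=> h j Gh hc; have hcm : `|h| <= cm.
  by apply: le_trans hc _; apply: le_trans (ler_norm _) _; rewrite /cm lerDr.
rewrite !uP ?inE ?eqxx ?orbT// -xE -yg'; exact: st.
Qed.

End Substitution.

(** * Hyperplane coverings and rationality *)

Lemma idempotent_iter (J : finType) (h : J -> J) :
  exists2 e : nat, (0 < e)%N & forall j, iter e h (iter e h j) = iter e h j.
Proof.
pose f (k : 'I_(#|{: {ffun J -> J}}|).+1) := [ffun j => iter k h j].
have /injectivePn [a [b ab fab]] : ~~ injectiveb f.
  by apply/negP => /injectiveP /leq_card; rewrite card_ord ltnn.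
wlog lab : a b ab fab / (a < b)%N => [Hw|].
  have [/Hw|ba|/ord_inj] := ltngtP a b; [exact| |by move/eqP: ab].
  by apply: (Hw b a); rewrite // eq_sym.
have per m j : (a <= m)%N -> iter (m + (b - a)) h j = iter m h j.
  move=> am; have -> : (m + (b - a) = (m - a) + b)%N by lia.
  rewrite iterD; have := congr1 (fun F : {ffun J -> J} => F j) fab.
  rewrite !ffunE => <-; rewrite -iterD; congr (iter _ _ _); lia.
have perk k m j : (a <= m)%N -> iter (m + k * (b - a)) h j = iter m h j.
  move=> am; elim: k => [|k IH]; first by rewrite addn0.
  have -> : (m + k.+1 * (b - a) = m + k * (b - a) + (b - a))%N by rewrite mulSn addnCA addnC.
  by rewrite per ?IH//; exact: leq_trans am (leq_addr _ _).
(* A positive multiple of the period [b - a] that exceeds the preperiod [a]. *)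
exists (a.+1 * (b - a))%N; first by rewrite muln_gt0 subn_gt0.
by move=> j; rewrite -iterD perk//; nia.
Qed.

Section Coverings.
Context (R : realType) (E V F : normedVectType R).
Context (p : {linear E -> V}) (q : {linear E -> F}) (G : set E).
Hypothesis hG : lattice_set G.
Context (M N : 'End(E)) (La : 'End(V)) (A B : 'End(F)).
Hypothesis NK : forall x, N (M x) = x.
Hypothesis BK : forall x, A (B x) = x.
Hypothesis AK : forall x, B (A x) = x.
Hypothesis pN : forall x, p (N x) = La (p x).
Hypothesis qN : forall x, q (N x) = B (q x).
Hypothesis NG : forall g, G g -> G (N g).
Hypothesis MG : forall g, G g -> G (M g).
Context (J : finType) (phi : J -> 'Hom(F, R^o)) (c : J -> R) (Supp : J -> set F).
Hypothesis Supp_hyp : forall j y, Supp j y -> phi j y = c j.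
Hypothesis Supp_open : forall j y, Supp j y ->
  exists2 e : R, 0 < e & forall x, phi j x = c j -> `|y - x| < e -> Supp j x.

(* Up to small perturbation, the map [y |-> B^n y + beta] sends facet points of
   the window, modulo lattice translations [theta] with uniformly bounded
   physical part, to facet points, compatibly with the supporting hyperplanes. *)
Definition facet_covering n (C : R) := exists beta : F, forall j y (e : R), Supp j y -> 0 < e ->
  exists y' theta j', [/\ `|y - y'| < e, Supp j y', G theta /\ `|p theta| <= C,
    Supp j' (iter n B y' + beta + q theta) &
    forall x, phi j x = c j <-> phi j' (iter n B x + beta + q theta) = c j'].

Definition hyperplane_image n beta j j' := exists2 theta, G theta &
  forall x, phi j x = c j <-> phi j' (iter n B x + beta + q theta) = c j'.

(** The second perturbation is pulled back through [A^a]; as facets are relatively open and the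
    hyperplanes correspond exactly, the pulled-back point is still a facet point. The first
    translate is carried along by [N^b], which gives the factor [K]. *)
Lemma facet_coveringD a b (C C' K : R) : (forall x, `|iter b La x| <= K * `|x|) -> 0 <= K ->
  facet_covering a C -> facet_covering b C' -> facet_covering (a + b) (K * C + C').
Proof.
move=> LaK K0 [beta betaP] [beta' betaP']; exists (iter b B beta + beta') => j y e sy e0.
have e20 : 0 < e / 2 by rewrite divr_gt0.
have [y1 [th [j1 [yy1 sy1 [Gth thC] sz HH]]]] := betaP j y (e / 2) sy e20.
have [r r0 rP] := Supp_open sy1.
have [D D0 DP] := lin_bound (lfpow A a).
set m := Num.min r (e / 2); have m0 : 0 < m by rewrite lt_min r0.
have mD : 0 < m / D by rewrite divr_gt0.
have [z1 [th' [j2 [zz1 sz1 [Gth' thC'] sz2 HH']]]] := betaP' j1 _ _ sz mD.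
set z := iter a B y1 + beta + q th in zz1 sz.
pose y2 := iter a A (z1 - beta - q th).
have By2 : iter a B y2 + beta + q th = z1 by rewrite (iter_cancel _ AK); module.
have y12 : `|y1 - y2| < m.
  have -> : y1 - y2 = lfpow A a (z - z1).
    rewrite lfpowE /y2 -{1}(iter_cancel a BK y1) -iter_lfunB; congr (iter _ _ _).
    by rewrite /z; module.
  by apply: le_lt_trans (DP _) _; rewrite mulrC -ltr_pdivlMr.
have [y12r y12e] : `|y1 - y2| < r /\ `|y1 - y2| < e / 2.
  by move: y12; rewrite lt_min => /andP[].
have Sz1 x : iter (a + b) B x + (iter b B beta + beta') + q (iter b N th + th') =
    iter b B (iter a B x + beta + q th) + beta' + q th'.
  by rewrite addnC iterD !iter_lfunD linearD /= (iter_intertwine _ qN); module.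
exists y2, (iter b N th + th'), j2; split.
- by have := ler_distD y1 y y2; lra.
- by apply: rP => //; apply/HH; rewrite By2; exact: Supp_hyp.
- split; first by apply: (latticeD hG) => //; exact: lattice_iter.
  rewrite linearD /= (iter_intertwine _ pN); apply: le_trans (ler_normD _ _) _; apply: lerD => //.
  by apply: le_trans (LaK _) _; rewrite ler_wpM2l.
- by rewrite Sz1 By2.
- by move=> x; rewrite Sz1 -HH'; exact: HH.
Qed.

Lemma facet_covering_le n (C C' : R) : C <= C' -> facet_covering n C -> facet_covering n C'.
Proof.
move=> CC' [beta H]; exists beta => j y e sy e0.
have [y' [th [j' [yy' sy' [Gth thC] sz HH]]]] := H j y e sy e0.
by exists y', th, j'; split=> //; split=> //; exact: le_trans CC'.
Qed.

Lemma facet_covering_mul n (C K : R) : (forall x, `|iter n La x| <= K * `|x|) -> 0 <= K ->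
  facet_covering n C -> forall k, exists C', facet_covering (k.+1 * n)%N C'.
Proof.
move=> LaK K0 H; elim=> [|k [C' H']]; first by exists C; rewrite mul1n.
by exists (K * C' + C); rewrite mulSn addnC; exact: facet_coveringD.
Qed.

(** The geometric series: [2 |C|] is reproduced by halving and adding [|C|], so the bound no longer
    depends on the number of iterations. *)
Lemma facet_covering_uniform n (C : R) : (forall x, `|iter n La x| <= 2^-1 * `|x|) ->
  facet_covering n C -> forall k, facet_covering (k.+1 * n)%N (2 * `|C|).
Proof.
move=> half H; have {}H : facet_covering n `|C| by apply: facet_covering_le H; exact: ler_norm.
elim=> [|k IH]; first by rewrite mul1n; apply: facet_covering_le H; have := normr_ge0 C; lra.
rewrite mulSn addnC; have -> : 2 * `|C| = 2^-1 * (2 * `|C|) + `|C| by field.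
by apply: facet_coveringD => //; rewrite invr_ge0.
Qed.

Lemma hyperplane_imageD a b beta beta' j j' j'' :
  hyperplane_image a beta j j' -> hyperplane_image b beta' j' j'' ->
  hyperplane_image (a + b) (iter b B beta + beta') j j''.
Proof.
move=> [th Gth H] [th' Gth' H']; exists (iter b N th + th').
  by apply: (latticeD hG) => //; exact: lattice_iter.
move=> x; rewrite H H'.
have -> // : iter b B (iter a B x + beta + q th) + beta' + q th' =
    iter (a + b) B x + (iter b B beta + beta') + q (iter b N th + th').
by rewrite addnC iterD !iter_lfunD [q (_ + _)]linearD /= (iter_intertwine _ qN); module.
Qed.

Hypothesis Supp_ex : forall j, exists y, Supp j y.

(* Some power of the induced map [j |-> j'] on hyperplanes is idempotent, so
   every hyperplane is a lattice translate of one that returns to itself. *)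
Lemma hyperplane_image_self n (C : R) : facet_covering n C ->
  exists2 e, (0 < e)%N & exists beta, forall j, hyperplane_image (e * n)%N beta j j.
Proof.
move=> [beta betaP].
have H j : exists j', hyperplane_image n beta j j'.
  have [y sy] := Supp_ex j; have [_ [th [j' [_ _ [Gth _] _ HH]]]] := betaP j y 1 sy ltr01.
  by exists j', th.
have [h hP] := choice H.
have [e e0 eP] := idempotent_iter h.
exists e => //.
have [be beP] : exists be, forall j, hyperplane_image (e * n)%N be j (iter e h j).
  elim: e e0 {eP} => // -[|e] IH _.
    by exists beta => j; rewrite mul1n; exact: hP.
  have [be beP] := IH isT; exists (iter n B be + beta) => j.
  rewrite mulSn addnC iterS; exact: hyperplane_imageD.
exists be => j; have [th Gth H1] := beP j; have := beP (iter e h j); rewrite eP => -[th' Gth' H2].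
(* The hyperplanes [j] and [iter e h j] have images that are lattice translates of each other, hence
   already differ by the lattice vector [d]; correcting by [d] makes [j] return to itself. *)
pose d := iter (e * n) M (th - th').
have Gd : G d by apply: lattice_iter => //; exact: latticeB.
have Bd : iter (e * n) B (q d) = q (th - th').
  have NMk k z : iter k N (iter k M z) = z.
    by elim: k z => // k IH z; rewrite iterSr iterS NK IH.
  by rewrite -(iter_intertwine _ qN) NMk.
have shift x : phi j x = c j <-> phi (iter e h j) (x + q d) = c (iter e h j).
  apply: iff_trans (H1 x) _; apply: iff_sym; apply: iff_trans (H2 _) _.
  rewrite iter_lfunD Bd linearB.
  by have -> : iter (e * n) B x + (q th - q th') + be + q th' = iter (e * n) B x + be + q th by module.
exists (th - d); first exact: latticeB.
move=> x; rewrite H1 shift [q (th - d)]linearB.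
by have -> : iter (e * n) B x + be + (q th - q d) + q d = iter (e * n) B x + be + q th by module.
Qed.

End Coverings.

Section Rationality.
Context (R : realType) (E V F : normedVectType R).
Context (p : {linear E -> V}) (q : {linear E -> F}) (jv : {linear V -> E}) (jf : {linear F -> E}).
Context (G : set E).
Hypothesis pqE : forall x, x = jv (p x) + jf (q x).
Hypothesis hG : lattice_set G.
Hypothesis q_inj : forall g, G g -> q g = 0 -> g = 0.
Hypothesis q_dense : forall x (e : R), 0 < e -> exists2 g, G g & `|x - q g| < e.
Context (M N : 'End(E)) (La : 'End(V)) (A B : 'End(F)).
Hypothesis MK : forall x, M (N x) = x.
Hypothesis AK : forall x, B (A x) = x.
Hypothesis pN : forall x, p (N x) = La (p x).
Hypothesis qN : forall x, q (N x) = B (q x).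
Hypothesis NG : forall g, G g -> G (N g).
Hypothesis half : forall x, `|La x| <= 2^-1 * `|x|.
Context (J : finType) (phi : J -> 'Hom(F, R^o)) (c : J -> R) (Supp : J -> set F).
Hypothesis phi0 : forall j, phi j != 0.
Hypothesis Supp_hyp : forall j y, Supp j y -> phi j y = c j.
Hypothesis Supp_open : forall j y, Supp j y ->
  exists2 e : R, 0 < e & forall x, phi j x = c j -> `|y - x| < e -> Supp j x.
Hypothesis Supp_ex : forall j, exists y, Supp j y.
Context (D : R).
Hypothesis Supp_bound : forall j y, Supp j y -> `|y| <= D.
Context (C : R).
Hypothesis covering : forall k, facet_covering p q G B phi c Supp k.+1 C.
Context (beta : F).
Hypothesis self_image : forall j, hyperplane_image q G B phi c 1 beta j j.

Lemma self_image_linear j x : phi j x = 0 -> phi j (B x) = 0.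
Proof.
have [y sy] := Supp_ex j; have phiy := Supp_hyp sy.
have [th _ H] := self_image j; move=> phix.
have := iffLR (H y) phiy; have := iffLR (H (x + y)) _.
rewrite functionalD phix add0r => /(_ phiy) /= h1 h2; move: h1.
have -> : B (x + y) + beta + q th = B x + (B y + beta + q th) by rewrite linearD; module.
by rewrite functionalD h2 => /eqP; rewrite -subr_eq0 addrK => /eqP.
Qed.

Let flag_eigen n (k : 'I_n -> J) : exists nu : 'I_n -> R, forall i x,
  phi (k i) (B x) = nu i * phi (k i) x.
Proof.
have H i := functional_eigen (phi0 (k i)) (@self_image_linear (k i)).
by have [nu nuP] := choice H; exists nu.
Qed.

Section Flag.
Context (n : nat) (k : 'I_n -> J) (u : 'I_n -> F) (nu : 'I_n -> R).
Hypothesis fu : forall i j, phi (k i) (u j) = (i == j)%:R.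
Hypothesis fuE : forall x, x = \sum_i (phi (k i) x : R) *: u i.
Hypothesis fB : forall i x, phi (k i) (B x) = nu i * phi (k i) x.

Let u_neq0 i : u i != 0.
Proof.
apply/eqP => ui; have := fu i i; rewrite ui linear0 eqxx => /esym/eqP.
by rewrite oner_eq0.
Qed.

Let iter_u m i : iter m B (u i) = nu i ^+ m *: u i.
Proof.
rewrite (fuE (iter m B (u i))) (bigD1 i)//= big1 => [|j ji].
  by rewrite (functional_iter fB) fu eqxx mulr1 addr0.
by rewrite (functional_iter fB) fu (negPf ji) mulr0 scale0r.
Qed.

(* The translates [theta] needed to cover [T] equally spaced points along the
   line spanned by [u i0] have bounded mutual differences, so for [T] large two
   points get compatible translates on all the hyperplanes [k i], [i != i0]. *)
Lemma line_lattice_point i0 : 1 < `|nu i0| ->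
  exists g, [/\ G g, g != 0 & forall i, i != i0 -> phi (k i) (q g) = 0].
Proof.
(* With a single coordinate the vanishing condition is void and any nonzero lattice vector serves;
   otherwise [r0] is a reference hyperplane. *)
move=> nu1; have [[r0 r0i]|none] := pselect (exists r0, r0 != i0); last first.
  have un0 : 0 < `|u i0| by rewrite normr_gt0 u_neq0.
  have [g Gg gP] := q_dense (u i0) un0; exists g; split=> //.
    by apply: contraTneq gP => ->; rewrite linear0 subr0 ltxx.
  by move=> i ii0; case: none; exists i.
have [w wP] := choice (fun i => Supp_ex (k i)).
have [||r rpos rP] := @common_radius R _ (enum 'I_n) (fun i r => forall x,
    phi (k i) x = c (k i) -> `|w i - x| < r -> Supp (k i) x).
- by move=> i e e' ee h x xk xe; apply: h => //; exact: lt_le_trans ee.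
- by move=> i _; exact: Supp_open.
(* Room for a combination of four translates, plus 1 for the perturbations. *)
have [s [sG sP]] := strip_finite pqE hG (4 * C) (4 * D + 1).
pose T := #|{: {ffun 'I_n -> J * 'I_(size s).+1}}|.+1.
have T0 : 0 < T%:R :> R by rewrite ltr0n.
set un := `|u i0|; have un0 : 0 < un by rewrite normr_gt0 u_neq0.
set rho := r / (2 * un); have rho0 : 0 < rho by rewrite divr_gt0// mulr_gt0.
pose y (t : 'I_T) : F := (t%:R / T%:R * rho) *: u i0.
have ysmall t : `|y t| < r.
  rewrite normrZ ger0_norm; last by rewrite mulr_ge0 ?(ltW rho0)// divr_ge0.
  have tT : t%:R / T%:R <= 1 :> R by rewrite ler_pdivrMr// mul1r ler_nat ltnW.
  apply: le_lt_trans (_ : rho * un < r); first by rewrite ler_pM2r// ler_piMl// ltW.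
  by rewrite /rho invfM mulrA mulfVK ?gt_eqF// ltr_pdivrMr// ltr_pMr// ltr1n.
(* The iterate spreads neighbouring points of the segment further apart than two points of the ball
   of radius [D] can be, with a margin of 1 for the perturbations. *)
have [m mP] : exists m, 2 * D + 1 < `|nu i0| ^+ m.+1 * (rho / T%:R * un).
  set a := rho / T%:R * un; have a0 : 0 < a by rewrite mulr_gt0// divr_gt0.
  have [|m mP] := @geometric_small R `|nu i0|^-1 (`|2 * D + 1| + 1) a _ a0.
    by rewrite invr_ge0 normr_ge0 /= invf_lt1// (lt_trans ltr01).
  exists m; have := mP m.+1 (leqnSn _); rewrite exprVn mulrC ltr_pdivrMr; last first.
    by rewrite exprn_gt0// (lt_trans ltr01).
  move=> h; rewrite [ltRHS]mulrC; apply: le_lt_trans h; apply: le_trans (ler_norm _) _.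
  by rewrite lerDl.
have [b bP] := covering m.
have [Bm BmE] : exists Bm : 'End(F), forall x, Bm x = iter m.+1 B x.
  by exists (lfpow B m.+1) => x; rewrite lfpowE.
have [K K0 KP] := lin_bound Bm.
(* Four perturbations of this size, pushed through [Bm], contribute at most 1. *)
set e := Num.min r (1 / (4 * K)).
have e0 : 0 < e by rewrite lt_min rpos divr_gt0// mulr_gt0.
have H (ti : 'I_T * 'I_n) : exists yj : F * E * J, ti.2 != i0 ->
    [/\ `|w ti.2 + y ti.1 - yj.1.1| < e, G yj.1.2 /\ `|p yj.1.2| <= C,
        `|Bm yj.1.1 + b + q yj.1.2| <= D &
        forall x, phi (k ti.2) x = c (k ti.2) <->
           phi yj.2 (Bm x + b + q yj.1.2) = c yj.2].
  case: ti => t i /=; have [->|ii0] := eqVneq i i0; first by exists (0, 0, k i0).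
  have sy : Supp (k i) (w i + y t).
    apply: (rP i); first by rewrite mem_enum.
      by rewrite functionalD functionalZ fu (negPf ii0) mulr0 addr0; exact: Supp_hyp.
    by rewrite opprD addrA subrr sub0r normrN.
  have [y' [th [j' [yy' sy' Gth sz HH]]]] := bP (k i) _ e sy e0.
  exists (y', th, j') => _; split=> //=; first by rewrite BmE; exact: Supp_bound sz.
  by move=> x; rewrite BmE; exact: HH.
have [dat datP] := choice H.
pose ys t i := (dat (t, i)).1.1; pose th t i := (dat (t, i)).1.2; pose jj t i := (dat (t, i)).2.
have thP t i : i != i0 -> [/\ `|w i + y t - ys t i| < e, G (th t i) /\ `|p (th t i)| <= C,
    `|Bm (ys t i) + b + q (th t i)| <= D &
    forall x, phi (k i) x = c (k i) <-> phi (jj t i) (Bm x + b + q (th t i)) = c (jj t i)].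
  exact: (datP (t, i)).
(* A double difference, in [t] and in [i]: the large terms [Bm (w i + y t)] and the constant [b]
   cancel, so its internal part is bounded independently of [m]. *)
pose dd t i := th t i - th t r0 - th ord0 i + th ord0 r0.
have dds t i : i != i0 -> dd t i \in s.
  move=> ii0.
  have [e1 [G1 p1] z1 _] := thP t i ii0; have [e2 [G2 p2] z2 _] := thP t r0 r0i.
  have [e3 [G3 p3] z3 _] := thP ord0 i ii0; have [e4 [G4 p4] z4 _] := thP ord0 r0 r0i.
  apply: sP.
  - by apply: (latticeD hG) => //; do 2! apply: (latticeB hG) => //.
  - rewrite /dd linearD !linearB /=.
    apply: le_trans (ler_normD _ _) _; have := ler_normB (p (th t i) - p (th t r0)) (p (th ord0 i)).
    by have := ler_normB (p (th t i)) (p (th t r0)); lra.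
  set z := fun t i => Bm (ys t i) + b + q (th t i).
  have -> : q (dd t i) = (z t i - z t r0 - z ord0 i + z ord0 r0) -
      (Bm (ys t i - (w i + y t) - (ys t r0 - (w r0 + y t))
        - (ys ord0 i - (w i + y ord0)) + (ys ord0 r0 - (w r0 + y ord0)))).
    have -> : ys t i - (w i + y t) - (ys t r0 - (w r0 + y t))
        - (ys ord0 i - (w i + y ord0)) + (ys ord0 r0 - (w r0 + y ord0)) =
        ys t i - ys t r0 - ys ord0 i + ys ord0 r0 by module.
    rewrite [Bm _]linearD !linearB /= /dd [q _]linearD !linearB /= /z.
    module.
  have err : `|Bm (ys t i - (w i + y t) - (ys t r0 - (w r0 + y t))
        - (ys ord0 i - (w i + y ord0)) + (ys ord0 r0 - (w r0 + y ord0)))| <= 1.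
    apply: le_trans (KP _) _; rewrite mulrC -ler_pdivlMr//.
    have e4K : 4 * e <= 1 / K.
      have : e <= 1 / (4 * K) by rewrite /e ge_min lexx orbT.
      by rewrite !div1r invfM ler_pdivlMl.
    apply: le_trans e4K; rewrite distrC in e1; rewrite distrC in e2; rewrite distrC in e3; rewrite distrC in e4.
    apply: le_trans (ler_normD _ _) _.
    have := ler_normB (ys t i - (w i + y t) - (ys t r0 - (w r0 + y t))) (ys ord0 i - (w i + y ord0)).
    have := ler_normB (ys t i - (w i + y t)) (ys t r0 - (w r0 + y t)); lra.
  apply: le_trans (ler_normB _ _) _; apply: lerD => //.
  apply: le_trans (ler_normD _ _) _; have := ler_normB (z t i - z t r0) (z ord0 i).
  have := ler_normB (z t i) (z t r0).
  rewrite -/(z t i) in z1; rewrite -/(z t r0) in z2; rewrite -/(z ord0 i) in z3; rewrite -/(z ord0 r0) in z4.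
  lra.
pose code (t : 'I_T) : {ffun 'I_n -> J * 'I_(size s).+1} :=
  [ffun i => (jj t i, inord (index (dd t i) s))].
have /injectivePn [t [t' tt' codeE]] : ~~ injectiveb code.
  by apply/negP => /injectiveP /leq_card; rewrite card_ord ltnn.
have codeP i : i != i0 -> jj t i = jj t' i /\ dd t i = dd t' i.
  move=> ii0; have := congr1 (fun f : {ffun 'I_n -> J * 'I_(size s).+1} => f i) codeE.
  rewrite !ffunE => -[-> /(congr1 val) /=]; rewrite !inordK; last 2 first.
  - by rewrite ltnS ltnW// index_mem dds.
  - by rewrite ltnS ltnW// index_mem dds.
  by move=> /(congr1 (nth 0 s)); rewrite !nth_index ?dds.
pose g := th t r0 - th t' r0.
have thE i : i != i0 -> th t i = th t' i + g.
  move=> /codeP[_]; rewrite /dd /g => h.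
  have -> : th t i = (th t i - th t r0 - th ord0 i + th ord0 r0) + th t r0 + th ord0 i - th ord0 r0 by module.
  by rewrite h; module.
have [e1 [G1 _] z1 _] := thP t r0 r0i; have [e2 [G2 _] z2 _] := thP t' r0 r0i.
exists g; split; first exact: latticeB.
  (* Were [g] zero, both images would use the same translate and lie in the ball of radius [D],
     against the choice of [m]. *)
  apply/eqP => g0; have := thE r0 r0i; rewrite g0 addr0 => the; rewrite the in z1.
  have zz : Bm (ys t r0 - ys t' r0) =
      (Bm (ys t r0) + b + q (th t' r0)) - (Bm (ys t' r0) + b + q (th t' r0)).
    by rewrite linearB; module.
  have B1 : `|Bm (ys t r0 - ys t' r0)| <= 2 * D.
    by rewrite zz; apply: le_trans (ler_normB _ _) _; lra.
  have ee : `|Bm ((w r0 + y t - ys t r0) - (w r0 + y t' - ys t' r0))| <= 1.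
    apply: le_trans (KP _) _; rewrite mulrC -ler_pdivlMr//.
    have : e <= 1 / (4 * K) by rewrite /e ge_min lexx orbT.
    rewrite div1r invfM -div1r => h; apply: le_trans (ler_normB _ _) _.
    have : 0 < 1 / K by rewrite divr_gt0.
    by move: h; rewrite -[_ * K^-1]/(_ / K) !div1r; lra.
  have B2 : `|Bm (y t - y t')| <= 2 * D + 1.
    have -> : y t - y t' = (ys t r0 - ys t' r0) + ((w r0 + y t - ys t r0) - (w r0 + y t' - ys t' r0)) by module.
    by rewrite linearD; apply: le_trans (ler_normD _ _) _; exact: lerD.
  move: B2; rewrite leNgt => /negP; apply; apply: lt_le_trans mP _.
  have -> : y t - y t' = ((t%:R - t'%:R) / T%:R * rho) *: u i0.
    by rewrite /y -scalerBl; congr (_ *: _); ring.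
  rewrite linearZ /= BmE iter_u scalerA normrZ -/un (normrM _ (nu i0 ^+ _)) (normrM _ rho).
  rewrite (gtr0_norm rho0) normrX (normrM (_ - _)) normfV (gtr0_norm T0).
  have tt1 : 1 <= `|t%:R - t'%:R : R|.
    wlog tlt : t t' tt' {codeE codeP g thE e1 G1 z1 e2 G2 z2 g0 the zz B1 ee} / (t' < t)%N => [Hw|].
      have [tlt|tlt|/ord_inj] := ltngtP t t'; [by rewrite distrC; apply: Hw; rewrite // eq_sym|exact: Hw|by move/eqP: tt'].
    by rewrite -natrB ?(ltnW tlt)// normr_nat ler1n subn_gt0.
  set X := `|nu i0| ^+ m.+1 * (rho / T%:R * un).
  have X0 : 0 <= X.
    by apply: mulr_ge0; [exact: exprn_ge0|apply: mulr_ge0; [apply: divr_ge0|]; exact: ltW].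
  have -> : `|t%:R - t'%:R| / T%:R * rho * `|nu i0| ^+ m.+1 * un = `|t%:R - t'%:R| * X.
    by rewrite /X; ring.
  by rewrite ler_peMl.
move=> i ii0.
have [_ _ _ H1] := thP t i ii0; have [_ _ _ H2] := thP t' i ii0.
have [je _] := codeP i ii0; rewrite je (thE i ii0) in H1.
have phiw : phi (k i) (w i) = c (k i) by exact: Supp_hyp.
have h1 := iffLR (H1 _) phiw; have h2 := iffLR (H2 _) phiw.
(* Both indices map the hyperplane [k i] to the same target, with translates differing by [g];
   pulled back, [A^(m+1) (q g)] is a direction of the hyperplane. *)
have : phi (k i) (w i + iter m.+1 A (q g)) = c (k i).
  apply/H2; move: h1; rewrite [q (_ + _)]linearD.
  have -> : Bm (w i + iter m.+1 A (q g)) = Bm (w i) + q g.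
    by rewrite linearD; congr (_ + _); exact: etrans (BmE _) (iter_cancel _ AK _).
  by have -> : Bm (w i) + q g + b + q (th t' i) = Bm (w i) + b + (q (th t' i) + q g) by module.
rewrite functionalD phiw => /eqP; rewrite -subr_eq0 addrAC subrr add0r => /eqP h3.
by rewrite -(iter_cancel m.+1 AK (q g)) (functional_iter fB) h3 mulr0.
Qed.

Lemma line_lattice_vector i : 1 < `|nu i| -> exists g (a : R),
  [/\ G g, forall i', i' != i -> phi (k i') (q g) = 0 & q (a *: g) = u i].
Proof.
move=> /line_lattice_point[g [Gg g0 gi]].
have qg : q g = (phi (k i) (q g) : R) *: u i.
  rewrite {1}(fuE (q g)) (bigD1 i)//= big1 ?addr0// => b bi.
  by rewrite gi// scale0r.
exists g, (phi (k i) (q g) : R)^-1; split=> //.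
rewrite linearZ /= {2}qg scalerA mulVf ?scale1r//.
by apply: contra_neq g0 => h; apply: q_inj => //; rewrite qg h scale0r.
Qed.

(** The axes with eigenvalue of modulus above 1 carry lattice vectors by [line_lattice_vector].
    Their span has zero coordinates in the remaining directions, so [noncontracting_empty] shows
    that none remain. *)
Lemma flag_contracting i : 1 < `|nu i|.
Proof.
pose Q i := `|nu i| <= 1.
have [s [_ sD sE]] := span_set [set g | G g /\ exists2 i, ~~ Q i &
  forall i', i' != i -> phi (k i') (q g) = 0].
have sN x : x \in << s >>%VS -> N x \in << s >>%VS.
  apply: span_stable => {}x /sD[Gs [i' Qi' si']].
  apply: sE; split; first exact: NG.
  by exists i' => // j ji; rewrite qN fB si' ?mulr0.
have := @noncontracting_empty R E V F p q jv jf G pqE hG q_dense N La B pN qN NG _ half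
  n (fun i => phi (k i)) u nu fuE fu fB Q s _ sN _ _ _ i.
rewrite ltNge; apply => //.
- by move=> x /(congr1 M); rewrite MK linear0.
- by move=> x /sD[].
- move=> j Qj; have [|g [a [Gg gj gE]]] := @line_lattice_vector j; first by rewrite ltNge.
  by exists (a *: g) => //; apply/memvZ/sE; split=> //; exists j.
- move=> j y Qj /span_coef[r ->]; rewrite linear_sum linear_sum; apply: big1 => a _.
  have [_ [i' Qi' si']] := sD _ (mem_nth 0 (ltn_ord a)).
  rewrite linearZ /= functionalZ si' ?mulr0//.
  by apply: contraNneq Qi' => <-.
Qed.

Lemma fixed_eq0 y : B y = y -> y = 0.
Proof.
move=> By; rewrite (fuE y); apply: big1 => i _.
have : (nu i - 1) * phi (k i) y = 0 :> R by rewrite mulrBl mul1r -fB By subrr.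
move=> /eqP; rewrite mulf_eq0 subr_eq0 => /orP[/eqP nui|/eqP ->]; last by rewrite scale0r.
by have := flag_contracting i; rewrite nui normr1 ltxx.
Qed.

Definition lattice_torsion x := exists2 m : nat, (0 < m)%N &
  exists2 g, G g & m%:R *: x = q g.

Lemma lattice_torsionD x y : lattice_torsion x -> lattice_torsion y -> lattice_torsion (x + y).
Proof.
move=> [m m0 [g Gg gE]] [m' m'0 [g' Gg' gE']].
exists (m * m')%N; first by rewrite muln_gt0 m0.
exists (m'%:R *: g + m%:R *: g').
  by rewrite !scaler_nat; apply: (latticeD hG); [exact: (latticeMz hG m' Gg)|exact: (latticeMz hG m Gg')].
rewrite [RHS]linearD [X in _ = X + _]linearZ [X in _ = _ + X]linearZ /= -gE -gE' natrM; module.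
Qed.

Lemma lattice_torsionN x : lattice_torsion x -> lattice_torsion (- x).
Proof.
by move=> [m m0 [g Gg gE]]; exists m => //; exists (- g); [exact: latticeN|rewrite scalerN gE linearN].
Qed.

(** All axes now carry lattice vectors, and [near_invariant_span] with no constrained coordinate
    puts every lattice point in their span. A multiple of [g] is then an integer combination of axis
    vectors, whose [i]-th coordinate part keeps those on axis [i]. *)
Lemma coordinate_torsion g i : G g -> lattice_torsion ((phi (k i) (q g) : R) *: u i).
Proof.
move=> Gg; have [s [_ sD sE]] := span_set [set g | G g /\ exists i,
  forall i', i' != i -> phi (k i') (q g) = 0].
have sN x : x \in << s >>%VS -> N x \in << s >>%VS.
  apply: span_stable => {}x /sD[Gs [i' si']].
  apply: sE; split; first exact: NG.
  by exists i' => j ji; rewrite qN fB si' ?mulr0.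
have sG x : x \in s -> G x by move=> /sD[].
have us j : exists2 y, y \in << s >>%VS & q y = u j.
  have [h [a [Gh hj hE]]] := line_lattice_vector (flag_contracting j).
  by exists (a *: h) => //; apply/memvZ/sE; split=> //; exists j.
have N0 x : N x = 0 -> x = 0 by move=> /(congr1 M); rewrite MK linear0.
have [e e0 eP] := @near_invariant_span R E V F p q jv jf G pqE hG N La B pN qN NG N0 half
  n (fun i => phi (k i)) u nu fuE fu fB pred0 s sG sN (fun i => ltac:(by [])) (fun i _ => us i).
have gs : g \in << s >>%VS by exact: eP.
have [m m0 [z zE]] := lattice_span_torsion hG sG Gg gs.
exists m => //.
have proj a : exists2 h, G h & q h = (phi (k i) (q s`_(a : 'I_(size s))) : R) *: u i.
  have [Gs [i' si']] := sD _ (mem_nth 0 (ltn_ord a)).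
  have [ii'|ii'] := eqVneq i i'; last first.
    by exists 0; [exact: lattice0|rewrite si'// scale0r linear0].
  exists s`_a => //; rewrite {1}(fuE (q s`_a)) (bigD1 i)//= big1 ?addr0// => b bi.
  by rewrite si' ?scale0r// -ii'.
have [h hP] : exists h : 'I_(size s) -> E, forall a,
    G (h a) /\ q (h a) = (phi (k i) (q s`_a) : R) *: u i.
  have H a : exists h, G h /\ q h = (phi (k i) (q s`_(a : 'I_(size s))) : R) *: u i.
    by have [h Gh hE] := proj a; exists h.
  by have [h hP] := choice H; exists h.
exists (\sum_a h a *~ z a); first by apply: (lattice_sum hG) => a _; apply: (latticeMz hG); have [] := hP a.
rewrite scalerA -functionalZ -linearZ /= scaler_nat zE linear_sum linear_sum linear_sum scaler_suml.
apply: eq_bigr => a _; rewrite -(scaler_int (z a) s`_a) -(scaler_int (z a) (h a)) [q (_ *: s`_a)]linearZ /= functionalZ.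
by rewrite [q (_ *: h a)]linearZ /= (hP a).2 scalerA.
Qed.

(** Each hyperplane [k i] contains [v] and its image under the affine map plus a lattice vector, so
    every coordinate of the displacement is, up to sign, a coordinate of a lattice vector. *)
Lemma displacement_torsion v : (forall i, phi (k i) v = c (k i)) ->
  lattice_torsion (B v - v + beta).
Proof.
move=> vk; rewrite (fuE (B v - v + beta)); apply: big_ind.
- by exists 1%N => //; exists 0; [exact: lattice0|rewrite scaler0 linear0].
- exact: lattice_torsionD.
move=> i _; have [th Gth H] := self_image (k i).
have := iffLR (H v) (vk i) => /= h.
have -> : phi (k i) (B v - v + beta) = - phi (k i) (q th) :> R.
  have : phi (k i) (B v - v + beta + q th) = 0 :> R.
    have -> : B v - v + beta + q th = (B v + beta + q th) - v by module.
    by rewrite functionalB h vk subrr.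
  by rewrite functionalD => /eqP; rewrite addr_eq0 => /eqP.
by rewrite scaleNr; apply/lattice_torsionN/coordinate_torsion.
Qed.

(** The map [N - 1] is injective: on the physical side by contraction, on the internal side as [B]
    has no eigenvalue 1. It is therefore onto the span of the lattice, and a multiple of [g] is the
    image of a lattice vector. *)
Lemma lattice_torsion_cancel x : lattice_torsion (B x - x) -> lattice_torsion x.
Proof.
move=> [m m0 [g Gg gE]].
pose T : 'End(E) := (N - \1)%VF.
have TE y : T y = N y - y by rewrite /T add_lfunE opp_lfunE id_lfunE.
have T0 y : T y = 0 -> y = 0.
  rewrite TE => /eqP; rewrite subr_eq0 => /eqP Ny.
  have py : p y = 0.
    apply/eqP; rewrite -normr_eq0 eq_le normr_ge0 andbT.
    by have := half (p y); rewrite -pN Ny; have := normr_ge0 (p y); lra.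
  have qy : q y = 0 by apply: fixed_eq0; rewrite -qN Ny.
  by rewrite (pqE y) py qy !linear0 addr0.
have [s [_ sG sE]] := span_set G.
have sN y : y \in << s >>%VS -> T y \in << s >>%VS.
  by apply: span_stable => {}y /sG Gy; apply: sE; rewrite TE; apply: (latticeB hG) => //; exact: NG.
have TU : (T @: << s >>)%VS = << s >>%VS.
  have kT : lker T == 0%VS.
    rewrite -subv0; apply/subvP => y; rewrite memv_ker => /eqP/T0 ->; exact: mem0v.
  apply/eqP; rewrite eqEdim limg_dim_eq ?(eqP kT) ?capv0// leqnn andbT.
  by apply/subvP => _ /memv_imgP[y /sN yU ->].
have TsG y : y \in [seq T y | y <- s] -> G y.
  move=> /mapP[z zs ->]; rewrite TE; apply: latticeB => //; last exact: sG.
  by apply/NG/sG.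
have gT : g \in << [seq T y | y <- s] >>%VS by rewrite -limg_span TU; exact: sE.
have [m' m'0 [z zE]] := lattice_span_torsion hG TsG Gg gT.
rewrite size_map in z zE.
exists (m' * m)%N; first by rewrite muln_gt0 m'0.
exists (\sum_(a < size s) s`_a *~ z a).
  by apply: (lattice_sum hG) => a _; apply/(latticeMz hG)/sG/mem_nth.
set h := \sum_(a < size s) _.
have Th : g *+ m' = T h.
  rewrite zE linear_sum; apply: eq_bigr => a _.
  by rewrite -(scaler_int (z a) s`_a) linearZ /= (nth_map 0)// scaler_int.
apply/eqP; rewrite -subr_eq0; apply/eqP/fixed_eq0/eqP; rewrite -subr_eq0; apply/eqP.
have : q (g *+ m') = q (T h) by rewrite Th.
rewrite TE -scaler_nat linearZ linearB /= -gE qN => e.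
rewrite linearB linearZ /= natrM.
have -> : (m'%:R * m%:R) *: B x - B (q h) - ((m'%:R * m%:R) *: x - q h) =
  m'%:R *: (m%:R *: (B x - x)) - (B (q h) - q h) by module.
by rewrite e subrr.
Qed.

End Flag.

(** Two points of [X] on the same hyperplanes coincide by [Xker], so there are only finitely many of
    them, and torsion of each difference yields a common denominator. *)
Lemma rational_points (X : set F) :
  (forall v w, X v -> (forall j, phi j v = c j -> phi j w = 0) -> w = 0) ->
  exists2 d : nat, (0 < d)%N & forall v v', X v -> X v' ->
    exists2 g, G g & v - v' = d%:R^-1 *: q g.
Proof.
move=> Xker.
have flag v : X v -> exists n (k : 'I_n -> J) (u : 'I_n -> F) (nu : 'I_n -> R),
    [/\ forall i j, phi (k i) (u j) = (i == j)%:R,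
        forall x, x = \sum_i (phi (k i) x : R) *: u i,
        forall i x, phi (k i) (B x) = nu i * phi (k i) x &
        forall i, phi (k i) v = c (k i)].
  move=> Xv; pose k0 (a : 'I_#|[set j | phi j v == c j :> R]%SET|) := enum_val a.
  have k00 w : (forall a, phi (k0 a) w = 0) -> w = 0.
    move=> h; apply: (Xker v) => // j vj.
    have jS : j \in [set j | phi j v == c j :> R]%SET by rewrite inE; apply/eqP.
    by rewrite -(enum_rankK_in jS jS); exact: h.
  have [n [k' [u [fu fuE]]]] := dual_basis k00.
  have [nu nuP] := flag_eigen (k0 \o k').
  exists n, (k0 \o k'), u, nu; split=> // i.
  by have := enum_valP (k' i); rewrite inE => /eqP.
have tors v v' : X v -> X v' -> lattice_torsion (v - v').
  move=> Xv Xv'; have [n [k [u [nu [fu fuE fB vk]]]]] := flag v Xv.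
  have [n' [k' [u' [nu' [fu' fuE' fB' vk']]]]] := flag v' Xv'.
  apply: (lattice_torsion_cancel fu fuE fB).
  have -> : B (v - v') - (v - v') = (B v - v + beta) - (B v' - v' + beta).
    by rewrite linearB; module.
  apply: lattice_torsionD; first exact: (displacement_torsion fu fuE fB).
  by apply: lattice_torsionN; exact: (displacement_torsion fu' fuE' fB').
have [[v0 Xv0]|noX] := pselect (exists v, X v); last first.
  by exists 1%N => // v v' Xv; case: noX; exists v.
pose S v := [set j | phi j v == c j :> R]%SET.
have Sinj v v' : X v -> S v = S v' -> v = v'.
  move=> Xv SE; apply/eqP; rewrite -subr_eq0; apply/eqP; apply: (Xker v) => // j vj.
  have : j \in S v by rewrite inE; apply/eqP.
  rewrite SE inE => /eqP v'j.
  by rewrite functionalB vj v'j subrr.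
have H (a : {set J}) : exists m : nat, (0 < m)%N /\ forall v, X v -> S v = a ->
    exists2 g, G g & m%:R *: (v - v0) = q g.
  have [[v [Xv Sv]]|nov] := pselect (exists v, X v /\ S v = a); last first.
    by exists 1%N; split=> // v Xv Sv; case: nov; exists v.
  have [m m0 mP] := tors v v0 Xv Xv0; exists m; split=> // v' Xv' Sv'.
  by have <- : v = v' by apply: Sinj; rewrite // Sv Sv'.
have [m mP] := choice H.
(* One factor for each set of hyperplanes, hence for each possible point. *)
exists (\prod_a m a)%N; first by apply: prodn_gt0 => a; have [] := mP a.
set d := (\prod_a m a)%N.
have d0 : (d%:R : R) != 0.
  by rewrite pnatr_eq0 -lt0n; apply: prodn_gt0 => a; have [] := mP a.
have one v : X v -> exists2 g, G g & d%:R *: (v - v0) = q g.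
  move=> Xv; have [_ /(_ v Xv erefl)[g Gg gE]] := mP (S v).
  exists (g *+ (\prod_(a | a != S v) m a)%N); first exact: (latticeMz hG _%:Z Gg).
  rewrite /d (bigD1 (S v))//= natrM mulrC -scalerA gE.
  by rewrite [RHS]raddfMn scaler_nat.
move=> v v' /one[g Gg gE] /one[g' Gg' gE'].
exists (g - g'); first exact: latticeB.
rewrite linearB /= -gE -gE' -scalerBr scalerA mulVf// scale1r; module.
Qed.

End Rationality.

Section HyperplaneInclusion.
Context (R : realType) (F : normedVectType R).

Lemma hyperplane_inclusion (psi phi : 'Hom(F, R^o)) (d c : R) : psi != 0 -> phi != 0 ->
  (forall x, psi x = d -> phi x = c) ->
  exists2 k : R, k != 0 & (forall x, phi x = k * psi x) /\ c = k * d.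
Proof.
move=> /functional_neq0[z z1] phi0 h.
have hd : phi (d *: z) = c by apply: h; rewrite functionalZ z1 mulr1.
have ker y : psi y = 0 -> phi y = 0.
  move=> y0; have := h (d *: z + y); rewrite functionalD functionalZ z1 y0 mulr1 addr0.
  by move=> /(_ erefl); rewrite functionalD hd => /eqP; rewrite -subr_eq0 addrAC subrr add0r => /eqP.
have phiE x : phi x = phi z * psi x :> R.
  have /ker : psi (x - (psi x : R) *: z) = 0 by rewrite functionalB functionalZ z1 mulr1 subrr.
  by rewrite functionalB functionalZ => /eqP; rewrite subr_eq0 => /eqP ->; rewrite mulrC.
exists (phi z); last by split=> //; rewrite -hd functionalZ mulrC.
by apply: contra_neq phi0 => z0; apply/lfunP => x; rewrite zero_lfunE phiE z0 mul0r.
Qed.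

End HyperplaneInclusion.

Section Facets.
Context (R : realType) (F : normedVectType R) (l : nat) (W : 'I_l -> set F).
Hypothesis Wc : forall i, compact (W i).
Context (J : finType) (phi : J -> 'Hom(F, R^o)) (c : J -> R).
Hypothesis phi0 : forall j, phi j != 0.
Hypothesis bW : forall i x, boundary (W i) x -> exists j, phi j x = c j.
Hypothesis suppW : forall j, exists i w, supp_at (W i) (phi j) (c j) w.

(** Both signs occur since windows, or parts of one window, may lie on either side of the same
    hyperplane. *)
Definition facet_points j := [set y | exists i (sg : bool),
  supp_at (W i) ((-1) ^+ sg *: phi j) ((-1) ^+ sg * c j) y].

Lemma sign_hyperplane (sg : bool) j x :
  ((-1) ^+ sg *: phi j) x = (-1) ^+ sg * c j <-> phi j x = c j.
Proof.
rewrite scale_lfunE -[(-1) ^+ sg *: (phi j x : R^o)]/((-1) ^+ sg * phi j x).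
by split=> [|->//]; apply: mulfI; rewrite signr_eq0.
Qed.

Lemma facet_points_hyp j y : facet_points j y -> phi j y = c j.
Proof. by move=> [i [sg [_ /sign_hyperplane h _]]]. Qed.

Lemma facet_points_open j y : facet_points j y ->
  exists2 e : R, 0 < e & forall x, phi j x = c j -> `|y - x| < e -> facet_points j x.
Proof.
move=> [i [sg /supp_at_open[e e0 eP]]]; exists e => // x xj xe.
by exists i, sg; apply: eP => //; apply/sign_hyperplane.
Qed.

Lemma facet_points_ex j : exists y, facet_points j y.
Proof.
have [i [w sw]] := suppW j; exists w, i, false.
by rewrite expr0 scale1r mul1r.
Qed.

Lemma facet_points_bound : exists D : R, forall j y, facet_points j y -> `|y| <= D.
Proof.
have [D D0 DP] := W_bound Wc; exists D => j y [i [sg /supp_at_mem]]; exact: DP.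
Qed.

(** Otherwise the contact point could be moved within its hyperplane off all listed hyperplanes,
    while remaining a boundary point. *)
Lemma supporting_listed i psi (d : R) w : supp_at (W i) psi d w ->
  exists j, exists2 k : R, k != 0 & (forall x, phi j x = k * psi x) /\ c j = k * d.
Proof.
move=> sw; have [psi0 psiw _] := sw; have [e e0 eP] := supp_at_open sw.
apply: contrapT => h.
have [|y [psiy wy] yP] := @functional_dense_off _ _ [seq (phi j, c j) | j <- enum J] psi d w e psiw e0.
  move=> _ /mapP[j _ ->] /=; apply: contrapT => h'; apply: h; exists j.
  apply: hyperplane_inclusion => // x xd; apply/eqP; apply: contrapT => /negP xj.
  by apply: h'; exists x.
have [j yj] := bW (supp_at_boundary (eP y psiy wy)).
have := yP (phi j, c j); rewrite /= yj eqxx => /(_ _); apply/not_implyP; split=> //.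
by apply: map_f; rewrite mem_enum.
Qed.

End Facets.

(** * A derivation rule detects the window boundary *)

Section LocalDerivation.
Context (R : realType) (E V F : normedVectType R) (l : nat).
Context (p : {linear E -> V}) (q : {linear E -> F}) (jv : {linear V -> E}) (jf : {linear F -> E}).
Context (G : set E) (W : 'I_l -> set F).
Hypothesis pqE : forall x, x = jv (p x) + jf (q x).
Hypothesis hG : lattice_set G.
Hypothesis p_inj : forall g, G g -> p g = 0 -> g = 0.
Hypothesis q_dense : forall x (e : R), 0 < e -> exists2 g, G g & `|x - q g| < e.
Hypothesis Wc : forall i, compact (W i).
Hypothesis Wreg : forall i, regclosed (W i).
Context (J : finType) (phi : J -> 'Hom(F, R^o)) (c : J -> R).
Hypothesis phi0 : forall j, phi j != 0.
Hypothesis bW : forall i x, boundary (W i) x -> exists j, phi j x = c j.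
Context (M N : 'End(E)) (L La : 'End(V)) (A B : 'End(F)).
Hypothesis MK : forall x, M (N x) = x.
Hypothesis NK : forall x, N (M x) = x.
Hypothesis AK : forall x, B (A x) = x.
Hypothesis pM : forall x, p (M x) = L (p x).
Hypothesis pN : forall x, p (N x) = La (p x).
Hypothesis qN : forall x, q (N x) = B (q x).
Hypothesis NG : forall g, G g -> G (N g).
Context (s uh : F) (U : set_system F) (p1 : V).
Hypothesis Ugood : @good_ultra R E F l q G W U uh.
Hypothesis derivable : LD (fun i => L @` Lam p q G W U p1 i) (Lam p q G W (principal_filter s) 0).

Let Wcl i : closed (W i).
Proof. by rewrite -(Wreg i); exact: closed_closure. Qed.

(** Indexing relative to [N g0] shows that the statuses seen from [p g0] depend on [g0] only through
    [B (q g0)]. *)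
Let imageE i g0 z : (L @` Lam p q G W U p1 i) (p g0 + z) <->
  exists th, [/\ G (th + N g0), z = L p1 + p (M th) & U [set u | W i (B (q g0) + u + q th)]].
Proof.
have [UU _ _] := Ugood; have UF : ProperFilter U by exact: ultra_proper.
split=> [[_ [g [Gg -> Ug]] e]|[th [Gth -> Ut]]].
  exists (g - N g0); split; first by rewrite subrK.
    have -> : p (M (g - N g0)) = L (p g) - p g0 by rewrite linearB /= MK linearB /= pM.
    by rewrite -[z](addKr (p g0)) -e linearD; module.
  by apply: filterS Ug => u /=; congr (W i _); rewrite linearB /= qN; module.
exists (p1 + p (th + N g0)).
  exists (th + N g0); split=> //; apply: filterS Ut => u /=.
  by congr (W i _); rewrite linearD /= qN; module.
by rewrite [L _]linearD /= -pM [M _]linearD /= MK [p (_ + _)]linearD; module.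
Qed.

(** If no boundary passed through [v + q th] for the finitely many visible [th], lattice points with
    internal position near [y] would all have equal clusters, hence equal membership in [W i]; but
    both memberships occur near a facet point. *)
Lemma facet_covering_of_derivation : exists C : R,
  facet_covering p q G B phi c (facet_points W phi c) 1 C.
Proof.
have [UU UN Uc] := Ugood; have UF : ProperFilter U by exact: ultra_proper.
have [cc cc0 ccP] := derivable.
have [K K0 KP] := lin_bound La; have [KB KB0 KBP] := lin_bound B.
have [D D0 DP] := W_bound Wc.
(* A cluster point is [L p1 + p (M th)] within distance [cc], which bounds [p th] by [C]. With this
   [beta], [B (q g) + u] is close to [B y + beta] when [q g + s] is close to [y] and [u] to [uh]. *)
pose C := K * (cc + `|L p1|); pose beta := uh - B s.
have [ths [thsG thsC thsP]] : exists ths : seq E, [/\ forall th, th \in ths -> G th,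
    forall th, th \in ths -> `|p th| <= C &
    forall th, G th -> `|p th| <= C -> `|q th| <= D + (KB * D + `|beta| + 1) -> th \in ths].
  have [ths [thsG thsP]] := strip_finite pqE hG C (D + (KB * D + `|beta| + 1)).
  exists [seq th <- ths | `|p th| <= C]; split=> th.
  - by rewrite mem_filter => /andP[_ /thsG].
  - by rewrite mem_filter => /andP[].
  - by move=> Gth pth qth; rewrite mem_filter pth thsP.
exists C, beta => j y0 e [i [sg sy0]] e0; rewrite /=.
have [r0 r00 r0P] := supp_at_open sy0.
pose pairs := [seq ((phi z.2 \o B)%VF, c z.2 - phi z.2 (beta + q z.1)) | z <- allpairs pair ths (enum J)].
(* Only pulled-back hyperplanes not containing the hyperplane [j] are avoided; a generic [y] then
   lies on no other pulled-back one. *)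
pose bad (z : 'Hom(F, R^o) * R) := `[< exists2 x, phi j x = c j & z.1 x != z.2 >].
have phiy0 : phi j y0 = c j by case: sy0 => _ /sign_hyperplane.
have m0 : 0 < Num.min e r0 by rewrite lt_min e0.
have [|y [phiy y0y] yP] := @functional_dense_off R F [seq z <- pairs | bad z] (phi j) (c j) y0 _ phiy0 m0.
  by move=> z; rewrite mem_filter => /andP[/asboolP].
move: y0y; rewrite lt_min => /andP[y0ye y0yr].
have sy : supp_at (W i) ((-1) ^+ sg *: phi j) ((-1) ^+ sg * c j) y.
  by apply: r0P => //; apply/sign_hyperplane.
have Wy : W i y := supp_at_mem sy.
set v := B y + beta.
have vD : `|v| <= KB * D + `|beta|.
  apply: le_trans (ler_normD _ _) _; rewrite lerD2r; apply: le_trans (KBP _) _.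
  by rewrite ler_pM2l//; exact: DP Wy.
have [th [i' [thth bv]]] : exists th i', th \in ths /\ boundary (W i') (v + q th).
  apply: contrapT => nb.
  have [e1 e10 e1P] : exists2 e1 : R, 0 < e1 & forall z, z \in allpairs pair ths (enum 'I_l) ->
      forall x, `|v - x| < e1 -> W z.2 (v + q z.1) <-> W z.2 (x + q z.1).
    apply: common_radius => [z e1 e1' ee h x xe|[th i'] /allpairsP[[th' i''] [/= ht _ [-> ->]]]].
      by apply: h; exact: lt_le_trans ee.
    have [|e1 e10 e1P] := @window_status_open R F l W Wc i'' (v + q th').
      by move=> b; apply: nb; exists th', i''.
    by exists e1 => // x vx; apply: e1P; rewrite opprD addrACA subrr addr0.
  set e2 := Num.min e1 1; have e20 : 0 < e2 by rewrite lt_min e10 ltr01.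
  have d0 : 0 < e2 / 2 / KB by rewrite !divr_gt0.
  have status g0 th i' : `|y - s - q g0| < e2 / 2 / KB -> G th -> `|p th| <= C ->
      U [set u | W i' (B (q g0) + u + q th)] <-> W i' (v + q th).
    move=> g0y Gth pth.
    have near : U [set u | `|v - (B (q g0) + u)| < e2].
      have e220 : 0 < e2 / 2 by rewrite divr_gt0.
      apply: filterS (Uc _ e220) => u /= uu.
      have -> : v - (B (q g0) + u) = B (y - s - q g0) + (uh - u).
        by rewrite /v /beta !linearB /=; module.
      apply: le_lt_trans (ler_normD _ _) _.
      have : `|B (y - s - q g0)| < e2 / 2.
        by apply: le_lt_trans (KBP _) _; rewrite mulrC -ltr_pdivlMr.
      lra.
    have [tht|tht] := boolP (th \in ths).
      have st x : `|v - x| < e2 -> W i' (v + q th) <-> W i' (x + q th).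
        move=> vx; apply: (e1P (th, i')); last by apply: lt_le_trans vx _; rewrite /e2 ge_min lexx.
        by apply: allpairs_f; rewrite ?mem_enum.
      split=> [Uw|Wv].
        by have [u [Wu /= nu]] := ultra_ex2 UU Uw near; apply/(st _ nu).
      by apply: filterS near => u /= /st <-.
    have qth : D + (KB * D + `|beta| + 1) < `|q th|.
      by rewrite ltNge; apply: contra tht => h; exact: thsP.
    have out x : `|v - x| < 1 -> ~ W i' (x + q th).
      move=> vx /DP h; have := ler_normB (x + q th) x; rewrite addrAC subrr add0r.
      by have := ler_normB v (v - x); rewrite subKr; lra.
    split=> [Uw|/out]; last by case; rewrite subrr normr0.
    have [u [Wu /=]] := ultra_ex2 UU Uw near; rewrite lt_min => /andP[_ /out].
    by case.
  have key g0 g1 : G g0 -> G g1 -> `|y - s - q g0| < e2 / 2 / KB ->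
      `|y - s - q g1| < e2 / 2 / KB -> W i (q g0 + s) -> W i (q g1 + s).
    move=> Gg0 Gg1 g0y g1y Wg0.
    have half ga gb : G ga -> G gb -> `|y - s - q ga| < e2 / 2 / KB -> `|y - s - q gb| < e2 / 2 / KB ->
        forall i' z, cluster_at (fun i => L @` Lam p q G W U p1 i) (p ga) cc i' z ->
                     cluster_at (fun i => L @` Lam p q G W U p1 i) (p gb) cc i' z.
      move=> Gga Ggb ya yb i' z /cluster_atE[/imageE[th [Gt zE Ut]] zc].
      apply/cluster_atE; split=> //; apply/imageE.
      have Gth : G th by rewrite -[th](addrK (N ga)); apply: latticeB => //; exact: NG.
      exists th; split=> //; first by apply: (latticeD hG) => //; exact: NG.
      have pth : `|p th| <= C.
        rewrite -[th]NK pN; apply: le_trans (KP _) _; rewrite ler_pM2l//.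
        have -> : p (M th) = z - L p1 by rewrite zE; module.
        by apply: le_trans (ler_normB _ _) _; rewrite lerD2r.
      by apply/(status gb th i' yb Gth pth)/(status ga th i' ya Gth pth).
    have /ccP/cluster_at0/(_ i)[h _] : cluster_at (fun i => L @` Lam p q G W U p1 i) (p g0) cc =
        cluster_at (fun i => L @` Lam p q G W U p1 i) (p g1) cc.
      by apply/funext => i'; apply/seteqP; split=> z; exact: half.
    rewrite Lam_principal in h.
    have [|g [Gg gE Wg]] := h; first by exists g0; split=> //; rewrite add0r.
    have -> // : g1 = g by apply: (p_inj2 hG p_inj) => //; rewrite gE add0r.
  (* Lattice points close to an interior point and to an exterior point, both near [y], have equal
     clusters but different memberships. *)
  have [x1 /interior_distP[d1 d10 d1P] yx1] := regclosed_approx (Wreg i) Wy (divr_gt0 d0 (ltr0n R 2)).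
  have [x2 yx2 nWx2] := supp_at_outside (divr_gt0 d0 (ltr0n R 2)) sy.
  have [d2 d20 d2P] := not_closed_dist (@Wcl i) nWx2.
  have approx x d : 0 < d -> `|y - x| < e2 / 2 / KB / 2 -> exists g, [/\ G g,
      `|y - s - q g| < e2 / 2 / KB & `|x - (q g + s)| < d].
    move=> d'0 yx; have [|g Gg gP] := @q_dense (x - s) (Num.min d (e2 / 2 / KB / 2)).
      by rewrite lt_min d'0 divr_gt0.
    move: gP; rewrite lt_min => /andP[gd ge].
    exists g; split=> //.
      have -> : y - s - q g = (y - x) + (x - s - q g) by module.
      by apply: le_lt_trans (ler_normD _ _) _; lra.
    by have -> : x - (q g + s) = x - s - q g by module.
  have [g1 [Gg1 g1y g1x]] := approx x1 d1 d10 yx1.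
  have [g2 [Gg2 g2y g2x]] := approx x2 d2 d20 yx2.
  by apply: (d2P _ g2x); apply: (key g1) => //; exact: d1P.
have coincide j1 : phi j1 (v + q th) = c j1 ->
    exists2 k : R, k != 0 & (forall x, phi j1 (B x) = k * phi j x) /\ c j1 - phi j1 (beta + q th) = k * c j.
  move=> vj1.
  have B0 : (phi j1 \o B)%VF != 0.
    apply: contra_neq (phi0 j1) => e'; apply/lfunP => x; rewrite zero_lfunE.
    by rewrite -[x]AK -comp_lfunE e' zero_lfunE.
  have [|k k0 [kE ckE]] := @hyperplane_inclusion R F (phi j) (phi j1 \o B)%VF (c j)
      (c j1 - phi j1 (beta + q th)) (phi0 j) B0.
    move=> x xj; apply/eqP; apply: contrapT => /negP nx.
    have : ((phi j1 \o B)%VF, c j1 - phi j1 (beta + q th)) \in [seq z <- pairs | bad z].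
      rewrite mem_filter; apply/andP; split; first by apply/asboolP; exists x.
      apply/mapP; exists (th, j1) => //.
      by apply: allpairs_f; rewrite ?mem_enum.
    move=> /yP /=; rewrite comp_lfunE -vj1 /v => /eqP; apply.
    by rewrite -functionalB; congr (phi j1 _); module.
  by exists k => //; split=> // x; rewrite -kE comp_lfunE.
have [j1 vj1] := bW bv; have [k k0 [kE ckE]] := coincide j1 vj1.
(* Every hyperplane through [v + q th] is an image of the hyperplane [j]; they all coincide, so this
   boundary point is a facet point. *)
have [|sg' sv _] := @supp_at_of_boundary R F J phi c (W i') phi0 (@Wcl i') (@bW i') (Wreg i') _ j1 bv.
  move=> j2 vj2; have [k2 k20 [k2E ck2E]] := coincide j2 vj2.
  have phi2 x : phi j2 x = k2 / k * phi j1 x by rewrite -[x]AK kE k2E mulrA divfK.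
  exists (k2 / k); first by rewrite mulf_neq0 ?invr_eq0.
  split; first by apply/lfunP => x; rewrite scale_lfunE phi2.
  rewrite -[c j2](subrK (phi j2 (beta + q th) : R)) ck2E phi2.
  by rewrite -[c j1](subrK (phi j1 (beta + q th) : R)) ckE; field.
exists y, th, j1; split=> //.
- by exists i, sg.
- by split; [exact: thsG|exact: thsC].
- by exists i', sg'.
- move=> x; have e1 : phi j1 (B x + beta + q th) - c j1 = k * (phi j x - c j) :> R.
    by rewrite -addrA functionalD kE mulrBr -ckE; ring.
  split=> [xj|/eqP].
    by apply/eqP; rewrite -subr_eq0 e1 xj subrr mulr0.
  by rewrite -subr_eq0 e1 mulf_eq0 (negPf k0)/= subr_eq0 => /eqP.
Qed.

End LocalDerivation.

(** * Finite families of hyperplanes and nonsingular parameters *)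

Section PolytopalWindows.
Context (R : realType) (F : normedVectType R).

Lemma polytopal_hyperplanes (X : set F) : polytopal X ->
  exists s : seq ('Hom(F, R^o) * R),
    (forall z, z \in s -> exists w, supp_at X z.1 z.2 w) /\
    forall x, boundary X x -> exists2 z, z \in s & z.1 x = z.2.
Proof.
move=> [A [Afin Asupp bA]].
have [t tE] : exists t : seq (set F), A = [set H | List.In H t].
  have /finite_seqP[t ->] : finite_set (A : set {classic set F}) by [].
  exists t; apply/seteqP; split=> H /=.
    by elim: t => //= H' t IH; rewrite inE => /orP[/eqP ->|/IH]; [left|right].
  by elim: t => //= H' t IH [->|/IH]; rewrite inE ?eqxx// => ->; rewrite orbT.
have : forall H, List.In H t -> supporting X H by move=> H Ht; apply: Asupp; rewrite tE.
have : forall x, boundary X x -> exists2 H, List.In H t & H x.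
  by move=> x /bA[H]; rewrite tE => Ht Hx; exists H.
move=> {tE bA Asupp Afin A} h1 h2.
suff [s [sX sE]] : exists s : seq ('Hom(F, R^o) * R),
    (forall z, z \in s -> exists w, supp_at X z.1 z.2 w) /\
    forall H x, List.In H t -> H x -> exists2 z, z \in s & z.1 x = z.2.
  by exists s; split=> // x /h1[H Ht Hx]; exact: (sE H).
move: h2 {h1}; elim: t => [|H t IH] h; first by exists [::].
have [s [sX sE]] := IH (fun H' Ht => h H' (or_intror Ht)).
have [phi [c [w [HE sw]]]] := iffLR (supportingP _ _) (h H (or_introl erefl)).
exists ((phi, c) :: s); split=> [z|H' x [<-|Ht] Hx].
- by rewrite inE => /orP[/eqP ->|/sX//]; exists w.
- by exists (phi, c); rewrite ?mem_head//=; move: Hx; rewrite HE.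
- by have [z zs zx] := sE _ _ Ht Hx; exists z; rewrite // inE zs orbT.
Qed.

Lemma window_hyperplanes l (W : 'I_l -> set F) : (forall i, polytopal (W i)) ->
  exists (J : finType) (phi : J -> 'Hom(F, R^o)) (c : J -> R),
    [/\ forall j, phi j != 0,
        forall i x, boundary (W i) x -> exists j, phi j x = c j &
        forall j, exists i w, supp_at (W i) (phi j) (c j) w].
Proof.
move=> hW; have [s sP] := choice (fun i => polytopal_hyperplanes (hW i)).
pose t := flatten [seq s i | i <- enum 'I_l].
have tP z : z \in t -> exists i w, supp_at (W i) z.1 z.2 w.
  move=> /flattenP[_ /mapP[i _ ->] zs]; by exists i; apply: (sP i).1.
exists 'I_(size t), (fun j : 'I_(size t) => (nth (0, 0) t j).1),
  (fun j : 'I_(size t) => (nth (0, 0) t j).2); split.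
- by move=> j; have [i [w []]] := tP _ (mem_nth (0, 0) (ltn_ord j)).
- move=> i x bx; have [_ /(_ x bx)[z zs zx]] := sP i.
  have zt : z \in t by apply/flattenP; exists (s i) => //; apply: map_f; rewrite mem_enum.
  have zi : (index z t < size t)%N by rewrite index_mem.
  by exists (Ordinal zi); rewrite /= nth_index.
- by move=> j; apply: tP; exact: mem_nth.
Qed.

Lemma supporting_subspacesP l (W : 'I_l -> set F) U :
  supporting_subspaces W U <->
  exists i psi d w, supp_at (W i) psi d w /\ U = [set x | psi x = 0].
Proof.
have dir (psi : 'Hom(F, R^o)) d : psi != 0 ->
    [set x - y | x in [set x | psi x = d] & y in [set x | psi x = d]] = [set x | psi x = 0].
  move=> /functional_neq0[z z1]; apply/seteqP; split=> [_ [x /= xd [y /= yd <-]]|x /= x0].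
    by rewrite functionalB xd yd subrr.
  exists (x + d *: z) => /=; first by rewrite functionalD functionalZ x0 z1 mulr1 add0r.
  by exists (d *: z); rewrite /= ?addrK// functionalZ z1 mulr1.
split=> [[H [i /supportingP[psi [d [w [-> sw]]]]] <-]|[i [psi [d [w [sw ->]]]]]].
  by exists i, psi, d, w; split=> //; apply: dir; case: sw.
exists [set x | psi x = d]; last by apply: dir; case: sw.
by exists i; apply/supportingP; exists psi, d, w.
Qed.

(** Without boundary points, segments would carry membership to the whole space, which is
    unbounded. *)
Lemma compact_boundary_neq0 (X : set F) : compact X -> (exists x : F, x != 0) -> X !=set0 ->
  exists x, boundary X x.
Proof.
move=> Xc [x x0] [b Xb]; apply: contrapT => nb.
have Xcl : closed X by apply: compact_closed => //; exact: norm_hausdorff.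
have XT y : X y.
  by apply: (segment_avoiding_boundary Xcl _ Xb) => t _ bt; apply: nb; eexists; exact: bt.
have [C C0 CP] := compact_dist_bounded Xc.
have xn : 0 < `|x| by rewrite normr_gt0.
have := CP _ (XT ((2 * C / `|x|) *: x)).
rewrite normrZ ger0_norm; last by rewrite divr_ge0// mulr_ge0// ltW.
by rewrite divfK ?gt_eqF//; lra.
Qed.

Lemma uncountable_line (D : set R) : countable D -> exists t, ~ D t.
Proof.
move=> cD; apply: contrapT => h.
have D01 : countable (`[0 : R, 1]%classic : set R).
  apply: (@sub_countable R R _ D _ cD); apply: subset_card_le => t _.
  by apply: contrapT => nt; apply: h; exists t.
have := countable_lebesgue_measure0 D01.
rewrite lebesgue_measure_itv /= lte_fin ltr01 oppr0 adde0 => /eqP.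
by rewrite eqe oner_eq0.
Qed.

(** Along a line transverse to all hyperplanes, each lattice point and hyperplane exclude one
    parameter, so countably many are excluded. *)
Lemma nonsingular_exists (E : normedVectType R) l (W : 'I_l -> set F)
  (q : {linear E -> F}) (G : set E) (J : finType) (phi : J -> 'Hom(F, R^o)) (c : J -> R) :
  countable G -> (forall j, phi j != 0) ->
  (forall i x, boundary (W i) x -> exists j, phi j x = c j) ->
  exists s, nonsingular_at q G W s.
Proof.
move=> cG phi0 bW.
have [|u [_ _] uP] := @functional_dense_off _ _ [seq (phi j, 0) | j <- enum J] 0 0 0 1
    ltac:(by rewrite zero_lfunE) ltr01.
  move=> _ /mapP[j _ ->] /=; have [z z1] := functional_neq0 (phi0 j).
  by exists z; rewrite ?zero_lfunE// z1 oner_eq0.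
have u0 j : phi j u != 0.
  by apply: (uP (phi j, 0)); apply: map_f; rewrite mem_enum.
pose D := \bigcup_(j in [set: J]) ((fun g => (c j - phi j (q g)) / phi j u : R) @` G).
have [|t tD] := @uncountable_line D.
  apply: bigcup_countable => [|j _]; first exact: finite_set_countable.
  by move: cG; apply: sub_countable; exact: card_image_le.
exists (t *: u) => g i Gg /bW[j]; rewrite functionalD functionalZ => e.
apply: tD; exists j => //; exists g => //.
by rewrite -e addrAC subrr add0r mulfK.
Qed.

End PolytopalWindows.

(** * The equivalence *)

Section MainEquivalence.
Context (R : realType) (E V F : normedVectType R) (l : nat).
Context (p : {linear E -> V}) (q : {linear E -> F}) (jv : {linear V -> E}) (jf : {linear F -> E}).
Context (G : set E) (W : 'I_l -> set F).
Hypothesis pqE : forall x, x = jv (p x) + jf (q x).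
Hypothesis pjv : forall a, p (jv a) = a.
Hypothesis qjv : forall a, q (jv a) = 0.
Hypothesis F_neq0 : exists x : F, x != 0.
Hypothesis hG : lattice_set G.
Hypothesis p_inj : forall g, G g -> p g = 0 -> g = 0.
Hypothesis q_inj : forall g, G g -> q g = 0 -> g = 0.
Hypothesis q_dense : forall x (e : R), 0 < e -> exists2 g, G g & `|x - q g| < e.
Hypothesis Ww : is_window W.
Hypothesis Wpol : forall i, polytopal (W i).
Context (M N : 'End(E)) (L La : 'End(V)) (A B : 'End(F)).
Hypothesis MK : forall x, M (N x) = x.
Hypothesis NK : forall x, N (M x) = x.
Hypothesis LK : forall x, L (La x) = x.
Hypothesis BK : forall x, A (B x) = x.
Hypothesis AK : forall x, B (A x) = x.
Hypothesis pM : forall x, p (M x) = L (p x).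
Hypothesis pN : forall x, p (N x) = La (p x).
Hypothesis qM : forall x, q (M x) = A (q x).
Hypothesis qN : forall x, q (N x) = B (q x).
Hypothesis MG : forall g, G g -> G (M g).
Hypothesis NG : forall g, G g -> G (N g).
Hypothesis contracting : exists n0, forall n, (n0 <= n)%N -> forall x, `|iter n La x| <= 2^-1 * `|x|.

Definition model_hull (P : 'I_l -> set V) := exists2 s, nonsingular_at q G W s &
  Delone_multiset P /\ LI P (Lam p q G W (principal_filter s) 0).

Definition lattice_rational := exists2 d : nat, (1 <= d)%N &
  forall v v', Ver W v -> Ver W v' -> exists2 g, G g & v - v' = d%:R^-1 *: q g.

Let Wc i : compact (W i). Proof. by have [] := Ww.1 i. Qed.
Let Wreg i : regclosed (W i). Proof. by have [] := Ww.1 i. Qed.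

Let Wint : exists i x, (W i)° x.
Proof.
have [_ [i [x Wx]]] := Ww; exists i.
by have [y Wy _] := regclosed_approx (Wreg i) Wx ltr01; exists y.
Qed.

Let powers (n : nat) :
  [/\ forall x, lfpow M n (lfpow N n x) = x,
      forall x, lfpow N n (lfpow M n x) = x,
      forall x, lfpow L n (lfpow La n x) = x,
      forall x, lfpow A n (lfpow B n x) = x &
      forall x, lfpow B n (lfpow A n x) = x].
Proof. by split=> x; rewrite !lfpowE iter_cancel. Qed.

Let intertwining (n : nat) :
  [/\ forall x, p (lfpow M n x) = lfpow L n (p x),
      forall x, p (lfpow N n x) = lfpow La n (p x),
      forall x, q (lfpow M n x) = lfpow A n (q x) &
      forall x, q (lfpow N n x) = lfpow B n (q x)].
Proof. by split=> x; rewrite !lfpowE; apply: iter_intertwine. Qed.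

Let lattice_powers (n : nat) :
  (forall g, G g -> G (lfpow M n g)) /\ (forall g, G g -> G (lfpow N n g)).
Proof. by split=> g Gg; rewrite lfpowE; exact: lattice_iter. Qed.

Lemma model_hull_Lam P : model_hull P ->
  exists p0 U uh, good_ultra q G W U uh /\ P = Lam p q G W U p0.
Proof.
move=> [s ns [[_ [r r0 PD]] PLI]]; apply: (LI_Lam hG p_inj Wc ns _ PLI).
by have [y Py _] := PD 0; exists y.
Qed.

Lemma substitutional_of_rational : (exists2 n : nat, (1 <= n)%N & FD_invariant W (iter n A)) ->
  lattice_rational ->
  exists2 m : nat, (1 <= m)%N & forall P, model_hull P -> sub_wrt (iter m L) P.
Proof.
move=> [n n1 FD] [d d0 rat].
have [J [phi [c [phi0 bW suppW]]]] := window_hyperplanes Wpol.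
have [n0 n0P] := contracting.
(* A multiple of [n], for the invariance of the supporting subspaces, and at least [n0], for the
   contraction. *)
pose Q := (n * n0.+1)%N.
have half x : `|lfpow La Q x| <= 2^-1 * `|x|.
  by rewrite lfpowE; apply: n0P; rewrite /Q; nia.
have FDj j : iter n A @` [set x | phi j x = 0] = [set x | phi j x = 0].
  apply: FD; apply/supporting_subspacesP; have [i [w sw]] := suppW j.
  by exists i, (phi j), (c j), w.
have An j x : phi j x = 0 -> phi j (iter n A x) = 0.
  move=> x0; suff : [set x | phi j x = 0] (iter n A x) by [].
  by rewrite -FDj; exists x.
have Bn j x : phi j x = 0 -> phi j (iter n B x) = 0.
  move=> x0; have : [set x | phi j x = 0] x by [].
  by rewrite -FDj => -[y /= y0 <-]; rewrite (iter_cancel n AK).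
have AV j x : phi j x = 0 -> phi j (lfpow A Q x) = 0.
  rewrite lfpowE /Q mulnC => x0; elim: n0.+1 => [//|k IH].
  by rewrite mulSn iterD; exact: An.
have BV j x : phi j x = 0 -> phi j (lfpow B Q x) = 0.
  rewrite lfpowE /Q mulnC => x0; elim: n0.+1 => [//|k IH].
  by rewrite mulSn iterD; exact: Bn.
have [MKQ NKQ LKQ BKQ AKQ] := powers Q.
have [pMQ pNQ qMQ qNQ] := intertwining Q.
have [MGQ NGQ] := lattice_powers Q.
have [j0] : exists j0 : J, true.
  have [i [b Wb]] := Wint; have [x /bW[j _]] := compact_boundary_neq0 (@Wc i) F_neq0 (ex_intro _ b (interior_subset Wb)).
  by exists j.
move=> _; have dense := hyperplane_dense pqE hG q_dense Wc Wreg phi0 bW suppW MKQ BKQ pNQ qNQ NGQ MGQ half BV AV d0 rat AKQ qMQ.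
have [a a0 [t0 sim]] := window_similarity hG Wc Wreg phi0 bW suppW MKQ qNQ NGQ MGQ BV d0 rat AKQ j0.
pose m := (a * Q)%N.
have [MKm NKm LKm BKm AKm] := powers m.
have [pMm pNm qMm qNm] := intertwining m.
have [MGm NGm] := lattice_powers m.
exists m; first by rewrite /m /Q !muln_gt0 a0 n1.
move=> P /model_hull_Lam[p0 [U [uh [Ugood ->]]]].
have -> : iter m L = lfpow L m by apply/funext => x; rewrite lfpowE.
apply: (Lam_substitution pqE pjv qjv hG p_inj q_dense Wc Wreg Wint bW suppW dense
  MKm NKm LKm BKm AKm pMm qNm NGm MGm (t0 := t0) _ p0 Ugood).
move=> j; have [kappa [nu [Gk nu0 kE]]] := sim j.
exists kappa, nu; split=> // x.
by rewrite -kE iter_lfpow -lfpowE.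
Qed.

Lemma rational_of_substitutional :
  (exists2 m : nat, (1 <= m)%N & forall P, model_hull P -> sub_wrt (iter m L) P) ->
  (exists2 n : nat, (1 <= n)%N & FD_invariant W (iter n A)) /\ lattice_rational.
Proof.
move=> [m m1 sub].
have [J [phi [c [phi0 bW suppW]]]] := window_hyperplanes Wpol.
have [s ns] := nonsingular_exists q (lattice_countable hG) phi0 bW.
have [MKm NKm LKm BKm AKm] := powers m.
have [pMm pNm qMm qNm] := intertwining m.
have [MGm NGm] := lattice_powers m.
have sgood := principal_good ns.
have P0D := Lam_Delone pjv qjv pqE hG q_dense Wc 0 Wint sgood.
have P0LI := Lam_LI pqE hG q_dense Wc 0 0 sgood sgood.
have [P1 [P1D P1LI der]] := sub _ (ex_intro2 _ _ s ns (conj P0D P0LI)).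
have [p1 [U [uh [Ugood P1E]]]] := model_hull_Lam (ex_intro2 _ _ s ns (conj P1D P1LI)).
have mL : iter m L = lfpow L m by apply/funext => x; rewrite lfpowE.
rewrite P1E mL in der.
have [C0 cov1] := facet_covering_of_derivation pqE hG p_inj q_dense Wc Wreg phi0 bW
  MKm NKm AKm pMm pNm qNm NGm Ugood der.
have [n0 n0P] := contracting.
have halfm n x : (n0 <= n)%N -> `|iter n (lfpow La m) x| <= 2^-1 * `|x|.
  by move=> nn; rewrite iter_lfpow; apply: n0P; nia.
have Shyp := @facet_points_hyp R F l W J phi c.
have Sopen := @facet_points_open R F l W J phi c.
have Sex := facet_points_ex suppW.
have [D SD] := facet_points_bound Wc phi c.
have [K K0 KP] := lin_bound (lfpow La m).
(* Starting from the exponent [n0 + 1], every multiple [Q] of it found below exceeds [n0], so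
   self-returning hyperplanes and contraction hold for the same power. *)
have [C1 cov2] := facet_covering_mul hG BKm AKm pNm qNm NGm Shyp Sopen (n := 1)
  (K := K) KP (ltW K0) cov1 n0.
rewrite muln1 in cov2.
have [e e0 [beta self]] := hyperplane_image_self hG NKm qNm NGm MGm Sex cov2.
pose Q := (e * n0.+1)%N.
have Qn0 : (n0 < Q)%N by rewrite /Q; nia.
have [C2 cov3] : exists C2, facet_covering p q G (lfpow B m) phi c (facet_points W phi c) Q C2.
  have [C2] := facet_covering_mul hG BKm AKm pNm qNm NGm Shyp Sopen (n := 1)
    (K := K) KP (ltW K0) cov1 Q.-1.
  by rewrite muln1 prednK ?(leq_trans _ Qn0)//; exists C2.
have covk k := facet_covering_uniform hG BKm AKm pNm qNm NGm Shyp Sopen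
  (fun x => halfm Q x (ltnW Qn0)) cov3 k.
pose T := (Q * m)%N.
have [MKT NKT LKT BKT AKT] := powers T.
have [pMT pNT qMT qNT] := intertwining T.
have [MGT NGT] := lattice_powers T.
have halfT x : `|lfpow La T x| <= 2^-1 * `|x|.
  by rewrite lfpowE -iter_lfpow; apply: halfm; exact: ltnW.
have iterT k x : iter k (lfpow B T) x = iter (k * Q) (lfpow B m) x.
  by rewrite !iter_lfpow mulnA.
have covT k : facet_covering p q G (lfpow B T) phi c (facet_points W phi c) k.+1 (2 * `|C2|).
  have [b bP] := covk k; exists b => j y r sy r0.
  have [y' [th [j' [yy' sy' Gth sz HH]]]] := bP j y r sy r0.
  by exists y', th, j'; split=> //; [rewrite iterT|move=> x; rewrite iterT; exact: HH].
have selfT j : hyperplane_image q G (lfpow B T) phi c 1 beta j j.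
  have [th Gth H] := self j; exists th => // x.
  by rewrite iterT mul1n; exact: H.
have lin := self_image_linear Shyp Sex selfT.
split.
  exists T; first by rewrite /T /Q !muln_gt0 e0.
  move=> _ /supporting_subspacesP[i [psi [d [w [sw ->]]]]].
  have [j [k k0 [jE _]]] := supporting_listed phi0 bW sw.
  have psi_phi x : psi x = 0 <-> phi j x = 0.
    rewrite jE; split=> [->|/eqP]; first by rewrite mulr0.
    by rewrite mulf_eq0 (negPf k0) => /eqP.
  have BU x : x \in lker (phi j) -> lfpow B T x \in lker (phi j).
    by rewrite !memv_ker => /eqP x0; apply/eqP; exact: lin.
  have AU x : phi j x = 0 -> phi j (lfpow A T x) = 0.
    move=> x0; apply/eqP; rewrite -memv_ker; apply: (stable_inj _ BU).
      by move=> y By0; rewrite -[y]BKT By0 linear0.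
    by rewrite AKT memv_ker x0.
  apply/seteqP; split=> [_ [x /= /psi_phi x0 <-]|x /= /psi_phi x0].
    by apply/psi_phi; rewrite -lfpowE; exact: AU.
  exists (lfpow B T x); first by apply/psi_phi; exact: lin.
  by rewrite -lfpowE BKT.
have [|d d0 dP] := rational_points pqE hG q_inj q_dense MKT AKT pNT qNT NGT halfT phi0 Shyp Sopen
  Sex SD covT selfT (X := Ver W); last by exists d.
move=> v w [i _ vi] vw; have Wcl : closed (W i) by rewrite -(Wreg i); exact: closed_closure.
exact: (polytope_vertex_kernel phi0 Wcl (@bW i) (Wreg i) vi vw).
Qed.

End MainEquivalence.

(** * Specialisation to the cut and project scheme *)

Section ProjAlong.
Context (R : realType) (V : vectType R) (U U' : {vspace V}).

Lemma proj_along_is_linear : linear (proj_along U U').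
Proof. by move=> a x y; apply/val_inj; rewrite /= linearP. Qed.

HB.instance Definition _ := @GRing.isLinear.Build R V (subvs_of U) _ (proj_along U U')
  proj_along_is_linear.

Hypothesis UI : (U :&: U' = 0)%VS.

Lemma proj_along_id u : proj_along U U' (vsval u) = u.
Proof. by apply/val_inj; rewrite /= daddv_pi_id// subvsP. Qed.

Lemma proj_along_eq0 (u : subvs_of U') : proj_along U U' (vsval u) = 0.
Proof.
apply/val_inj; have uUU : vsval u \in (U + U')%VS by rewrite -[vsval u]add0r memv_add ?mem0v ?subvsP.
have := daddv_pi_add UI uUU; rewrite (daddv_pi_id _ (subvsP u)); last by rewrite capvC.
by move=> h; apply: (addIr (vsval u)); rewrite h add0r.
Qed.

End ProjAlong.

Section RestrictEnd.
Context (R : realType) (V : vectType R) (f : 'End(V)) (U : {vspace V}).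
Hypothesis fU : (f @: U <= U)%VS.

Lemma restrict_endE u : vsval (restrict_end f U u) = f (vsval u).
Proof.
have -> : restrict_end f U u = vsproj U (f (vsval u)).
  exact: (lfunE (vsproj U \o (f \o vsval)) u).
by rewrite vsprojK//; apply: (subvP fU); rewrite memv_img// subvsP.
Qed.

End RestrictEnd.

Section Translate.
Context (R : realType) (F : normedVectType R) (X : set F) (s : F).

Lemma boundary_translate x : boundary [set w + s | w in X] x <-> boundary X (x - s).
Proof.
have mem y : [set w + s | w in X] y <-> X (y - s).
  by split=> [[w Xw <-]|Xy]; [rewrite addrK|exists (y - s); rewrite ?subrK].
have cl : closure [set w + s | w in X] x <-> closure X (x - s).
  split=> /closure_distP h; apply/closure_distP => e /h[y].
    by move=> /mem Xy xy; exists (y - s) => //; rewrite opprB addrA subrK.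
  by move=> Xy xy; exists (y + s); [apply/mem; rewrite addrK|rewrite opprD addrA addrAC].
have int : [set w + s | w in X]° x <-> X° (x - s).
  split=> /interior_distP[e e0 h]; apply/interior_distP; exists e => // y xy.
    have /mem : [set w + s | w in X] (y + s) by apply: h; rewrite opprD addrA addrAC.
    by rewrite addrK.
  by apply/mem/h; rewrite opprB addrA subrK.
by rewrite /boundary /=; split=> -[/cl ? ni]; split=> // /int.
Qed.

End Translate.

Section CutAndProject.
Context (R : realType) (E : normedVectType R) (S : cpscheme E) (l : nat).
Context (W : 'I_l -> set (subvs_of (Eint S))).
Let p := proj_along (Evee S) (Eint S).
Let q := proj_along (Eint S) (Evee S).

(** A point lies in the window translated by [s] exactly when subtracting [s] puts it in the
    original one; hence the internal parameter [- s]. *)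
Lemma nonsingular_translate s :
  nonsingular (translate_window W s) <-> nonsingular_at q (lat S) W (- s).
Proof.
split=> [ns g i Sg b|ns i].
  have : ((star S @` lat S) `&` boundary (translate_window W s i)) (q g).
    by split; [exists g|apply/boundary_translate].
  by rewrite ns.
rewrite -subset0 => _ [[g Sg <-] /boundary_translate]; exact: ns.
Qed.

Lemma cpset_translate s : cpset (translate_window W s) =
  Lam p q (lat S) W (principal_filter (- s)) 0.
Proof.
rewrite Lam_principal; apply/funext => i; apply/seteqP; split=> x.
  by move=> [g [Sg [w Ww ws]] <-]; exists g; rewrite add0r; split=> //; rewrite -[W i _]/(W i (star S g - s)) -ws addrK.
by move=> [g [Sg -> Wg]]; rewrite add0r; exists g => //; split=> //; exists (q g - s); rewrite ?subrK.
Qed.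

Lemma Omega_model_hull P : Omega W P <-> model_hull p q (lat S) W P.
Proof.
split=> [[s ns [PD PLI]]|[s ns [PD PLI]]].
  exists (- s); first exact/nonsingular_translate.
  by split=> //; rewrite -cpset_translate.
exists (- s); first by apply/nonsingular_translate; rewrite opprK.
by split=> //; rewrite cpset_translate opprK.
Qed.

End CutAndProject.

Theorem theorem3p14 (R : realType) (E : normedVectType R) (S : cpscheme E)
  (l : nat) (W : 'I_l -> set (subvs_of (Eint S)))
  (hW : is_window W) (hpol : forall i, polytopal (W i))
  (M : 'End(E)) (hMaut : lker M == 0%VS)
  (hMlat : M @` lat S = lat S)
  (hMvee : (M @: Evee S)%VS = Evee S)
  (hMint : (M @: Eint S)%VS = Eint S)
  (hexp : expansive (restrict_end M (Evee S))) :
  (exists2 m : nat, (1 <= m)%N &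
     forall P, Omega W P -> sub_wrt (iter m (restrict_end M (Evee S))) P)
  <->
  ((exists2 p : nat, (1 <= p)%N &
      FD_invariant W (iter p (restrict_end M (Eint S))))
   /\ rational_window W).
Proof.
pose p := proj_along (Evee S) (Eint S).
pose q := proj_along (Eint S) (Evee S).
pose N := (M^-1)%VF.
have NK : cancel M N by exact: lker0_lfunK.
have MK : cancel N M by exact: lker0_lfunVK.
have Nimg (U : {vspace E}) : (M @: U)%VS = U -> (N @: U)%VS = U.
  move=> MU; apply/eqP; rewrite -{1}MU -limg_comp lker0_compVf//.
  by rewrite lim1g.
have capC : (Eint S :&: Evee S = 0)%VS by rewrite capvC cps_cap.
have pqE x : x = vsval (p x) + vsval (q x).
  by rewrite /= daddv_pi_add ?cps_cap// cps_sum memvf.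
have pj a : p (vsval a) = a by apply: proj_along_id; exact: cps_cap.
have qj (a : subvs_of (Evee S)) : q (vsval a) = 0 by apply: proj_along_eq0.
have pj0 (a : subvs_of (Eint S)) : p (vsval a) = 0 by apply: proj_along_eq0; exact: cps_cap.
have qjf a : q (vsval a) = a by apply: proj_along_id.
have rV (f : 'End(E)) : (f @: Evee S)%VS = Evee S -> forall u, vsval (restrict_end f (Evee S) u) = f (vsval u).
  by move=> fU; apply: restrict_endE; rewrite fU.
have rI (f : 'End(E)) : (f @: Eint S)%VS = Eint S -> forall u, vsval (restrict_end f (Eint S) u) = f (vsval u).
  by move=> fU; apply: restrict_endE; rewrite fU.
have fE (f : 'End(E)) : (f @: Evee S)%VS = Evee S -> (f @: Eint S)%VS = Eint S ->
    forall x, f x = vsval (restrict_end f (Evee S) (p x)) + vsval (restrict_end f (Eint S) (q x)).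
  by move=> fv fi x; rewrite rV// rI// {1}(pqE x) [LHS]linearD.
have pf (f : 'End(E)) : (f @: Evee S)%VS = Evee S -> (f @: Eint S)%VS = Eint S ->
    forall x, p (f x) = restrict_end f (Evee S) (p x).
  move=> fv fi x; rewrite fE// [LHS]linearD /=.
  by rewrite [X in X + _]pj [X in _ + X]pj0 addr0.
have qf (f : 'End(E)) : (f @: Evee S)%VS = Evee S -> (f @: Eint S)%VS = Eint S ->
    forall x, q (f x) = restrict_end f (Eint S) (q x).
  move=> fv fi x; rewrite fE// [LHS]linearD /=.
  by rewrite [X in X + _]qj [X in _ + X]qjf add0r.
have Nvee := Nimg _ hMvee; have Nint := Nimg _ hMint.
have LK x : restrict_end M (Evee S) (restrict_end N (Evee S) x) = x.
  by apply/val_inj; rewrite /= rV// rV// MK.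
have LK' x : restrict_end N (Evee S) (restrict_end M (Evee S) x) = x.
  by apply/val_inj; rewrite /= rV// rV// NK.
have BK x : restrict_end M (Eint S) (restrict_end N (Eint S) x) = x.
  by apply/val_inj; rewrite /= rI// rI// MK.
have AK x : restrict_end N (Eint S) (restrict_end M (Eint S) x) = x.
  by apply/val_inj; rewrite /= rI// rI// NK.
have MG g : lat S g -> lat S (M g) by move=> Sg; rewrite -hMlat; exists g.
have NG g : lat S g -> lat S (N g) by rewrite -{1}hMlat => -[h Sh <-]; rewrite NK.
have hG := full_rank_lattice_set (lat_lattice S).
have p_inj g : lat S g -> p g = 0 -> g = 0.
  move=> Sg pg; apply: (vee_inj (c := S)); rewrite ?inE//; first exact: lattice0 hG.
  by rewrite [LHS]pg [RHS]linear0.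
have q_inj g : lat S g -> q g = 0 -> g = 0.
  move=> Sg pg; apply: (star_inj (c := S)); rewrite ?inE//; first exact: lattice0 hG.
  by rewrite [LHS]pg [RHS]linear0.
have q_dense x (e : R) : 0 < e -> exists2 g, lat S g & `|x - q g| < e.
  move=> e0; have [||y [xy [g Sg gy]]] := @star_dense R E S [set y | `|x - y| < e].
  - by exists x; rewrite /= subrr normr0.
  - by apply/open_distP => y /= xy; exists (e - `|x - y|); [rewrite subr_gt0|move=> z yz /=; rewrite -(subrKA y); apply: le_lt_trans (ler_normD _ _) _; lra].
  by exists g => //; rewrite /q [X in _ - X]gy.
have F_neq0 : exists x : subvs_of (Eint S), x != 0.
  exists (vsproj (Eint S) (vpick (Eint S))); apply/eqP => /(congr1 vsval).
  rewrite vsprojK ?memv_pick// linear0 => /eqP; rewrite vpick0 -dimv_eq0.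
  by rewrite eqn0Ngt dim_Eint.
(* Expansion of the iterates of [M] on the physical space, read at inverse iterates. *)
have contracting : exists n0, forall n, (n0 <= n)%N ->
    forall x, `|iter n (restrict_end N (Evee S)) x| <= 2^-1 * `|x|.
  have [|n0 n0P] := expansive_iter hexp.
    rewrite -subv0; apply/subvP => y; rewrite memv_ker => /eqP y0.
    by rewrite -[y]LK' y0 linear0 mem0v.
  exists n0 => n nn x; rewrite -[X in _ <= _ * `|X|](iter_cancel n LK); exact: n0P.
have eq := fun P => Omega_model_hull W P.
split=> [[m m1 sub]|[FD rat]].
  apply: (rational_of_substitutional pqE pj qj hG p_inj q_inj q_dense hW hpol MK NK LK BK AK
    (pf M hMvee hMint) (pf N Nvee Nint) (qf M hMvee hMint) (qf N Nvee Nint) MG NG contracting).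
  by exists m => // P /eq/sub.
have [m m1 sub] := substitutional_of_rational pqE pj qj F_neq0 hG p_inj q_dense hW hpol MK NK LK
  BK AK (pf M hMvee hMint) (pf N Nvee Nint) (qf M hMvee hMint) (qf N Nvee Nint) MG NG contracting
  FD rat.
by exists m => // P /eq/sub.
Qed.
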